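(* Let $G=(V,E)$ be a connected, locally finite, vertex-transitive infinite graph with origin $0\in V$, and let $(J_{x,y})_{x,y\in V}$ be an invariant family of coupling constants. Consider the associated Ising model, with critical parameter $\beta_c$. Then: 1. For every $\beta>\beta_c$, $$\langle\sigma_0\rangle_\beta^+\ \ge\ \sqrt{\frac{\beta^2-\beta_c^2}{\beta^2}}.$$ 2. For every $\beta<\beta_c$ (with $\beta>0$), the susceptibility is finite, i.e. $$\sum_{x\in V}\langle\sigma_0\sigma_x\rangle_\beta^+<\infty.$$ 3. If $(J_{x,y})_{x,y\in V}$ is finite-range, then for every $\beta<\beta_c$ (with $\beta>0$) there exists $c=c(\beta)>0$ such that $$\langle\sigma_0\sigma_x\rangle_\beta^+\le e^{-c\,\mathrm{d}(0,x)}\qquad\text{for all }x\in V.$$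
   Context: $\mathrm{d}(\cdot,\cdot)$ is the graph distance on $G$. Coupling constants: $J_{x,y}=J_{y,x}\ge 0$ for all $x,y\in V$. They are invariant: there is a group $\Gamma$ of automorphisms of $G$ acting transitively on $V$ such that $J_{\gamma(x),\gamma(y)}=J_{x,y}$ for all $\gamma\in\Gamma$ and $x,y\in V$. They are not assumed to vanish on non-neighbouring pairs. The family is finite-range if there exists $R>0$ such that $J_{x,y}=0$ whenever $\mathrm{d}(x,y)>R$. Ising model: for a finite $\Lambda\subset V$, $\beta>0$, $h\in\mathbb{R}$ and $\sigma=(\sigma_x)_{x\in\Lambda}\in\{-1,1\}^\Lambda$, set $$H_{\Lambda,\beta,h}(\sigma):=-\beta\sum_{\{x,y\}\subset\Lambda}J_{x,y}\sigma_x\sigma_y-h\sum_{x\in\Lambda}\sigma_x,$$ where the first sum is over unordered pairs of distinct vertices. The Gibbs measure on $\Lambda$ with free boundary conditions is $$\langle f\rangle_{\Lambda,\beta,h}=\frac{\sum_{\sigma\in\{-1,1\}^\Lambda}f(\sigma)\exp[-H_{\Lambda,\beta,h}(\sigma)]}{\sum_{\sigma\in\{-1,1\}^\Lambda}\exp[-H_{\Lambda,\beta,h}(\sigma)]},\qquad f:\{-1,1\}^\Lambda\to\mathbb{R}.$$ The infinite-volume measure $\langle\cdot\rangle_{\beta,h}$ is the weak limit of $\langle\cdot\rangle_{\Lambda,\beta,h}$ as $\Lambda\nearrow V$, and $\langle\cdot\rangle_\beta^+$ is the weak limit of $\langle\cdot\rangle_{\beta,h}$ as $h\searrow 0$. Critical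 parameter: $\beta_c:=\inf\{\beta>0:\langle\sigma_0\rangle_\beta^+>0\}$, with $\inf\emptyset=+\infty$. *)

(* Defs.v *)
From HB Require Import structures.
From mathcomp Require Import all_boot all_order all_algebra finmap.
From mathcomp Require Import all_classical all_reals all_analysis.
From mathcomp.analysis.showcase Require Import summability.
Set Implicit Arguments.
Unset Strict Implicit.
Unset Printing Implicit Defensive.
Import Order.TTheory GRing.Theory Num.Theory numFieldNormedType.Exports.

Local Open Scope classical_set_scope.
Local Open Scope ring_scope.

Section Graph.
Context {V : choiceType}.
Implicit Types (E : rel V) (x y : V) (p : seq V) (g : V -> V)
  (Gamma : set (V -> V)).

Definition walk E x y p := path E x p /\ last x p = y.

Definition simple_graph E := symmetric E /\ irreflexive E.

Definition connected_graph E := forall x y, exists p, walk E x y p.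

Definition locally_finite E := forall x, finite_set [set y | E x y].

(* The number of edges of a shortest walk; the value is 0 if there is no walk,
   which does not happen in a connected graph. *)
Definition gdist E x y : nat :=
  xget 0%N [set n | (exists2 p, walk E x y p & size p = n) /\
                    (forall p, walk E x y p -> (n <= size p)%N)].

Definition automorphism E g :=
  bijective g /\ forall x y, E (g x) (g y) = E x y.

Definition vertex_transitive E :=
  forall x y, exists2 g, automorphism E g & g x = y.

Definition automorphism_group E Gamma :=
  [/\ (forall g, Gamma g -> automorphism E g),
      Gamma id,
      (forall g1 g2, Gamma g1 -> Gamma g2 -> Gamma (g1 \o g2)) &
      (forall g, Gamma g ->
         exists2 g', Gamma g' & cancel g g' /\ cancel g' g)].

Definition acts_transitively Gamma :=
  forall x y, exists2 g, Gamma g & g x = y.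
End Graph.

Section Coupling.
Context {R : realType} {V : choiceType}.
Implicit Types (E : rel V) (J : V -> V -> R).

Definition coupling_constants J :=
  (forall x y, J x y = J y x) /\ (forall x y, 0 <= J x y).

Definition invariant_coupling E J :=
  exists Gamma, [/\ automorphism_group E Gamma, acts_transitively Gamma &
    forall g x y, Gamma g -> J (g x) (g y) = J x y].

Definition finite_range E J :=
  exists2 r : R, 0 < r & forall x y, r < (gdist E x y)%:R -> J x y = 0.
End Coupling.

Section Ising.
Context {R : realType} {V : choiceType}.
Implicit Types (J : V -> V -> R) (L : {fset V}) (b h : R).

(* A spin is a boolean; its value in {-1, 1} is given by [spin]. *)
Definition spin (s : bool) : R := if s then 1 else -1.

(* The sum over unordered pairs of distinct vertices is half of the sum over
   ordered pairs, J being symmetric. *)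
Definition hamiltonian J L b h (s : {ffun L -> bool}) : R :=
  - b * (2^-1 * \sum_(x : L) \sum_(y : L | y != x)
           J (val x) (val y) * spin (s x) * spin (s y))
  - h * \sum_(x : L) spin (s x).

Definition gibbs J L b h (f : {ffun L -> bool} -> R) : R :=
  (\sum_(s : {ffun L -> bool}) f s * expR (- hamiltonian J b h s)) /
  (\sum_(s : {ffun L -> bool}) expR (- hamiltonian J b h s)).

(* Extension of a configuration on L to V. A local observable does not see the
   value chosen outside L as soon as L contains its support. *)
Definition extend L (s : {ffun L -> bool}) : V -> bool :=
  fun x => if insub x is Some u then s u else true.

(* The infinite-volume measures are given by the expectations of observables on
   {-1, 1}^V: weak convergence is convergence of the expectation of each local
   observable. The filter [totally] on {fset V} is generated by the sets
   {L | S `<=` L} with S finite, i.e. the limit is along L increasing to V. *)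
Definition infinite_volume J b h (f : (V -> bool) -> R) : R :=
  lim ((fun L : {fset V} =>
          gibbs J b h (fun s : {ffun L -> bool} => f (extend s))) @ totally).

Definition plus_state J b (f : (V -> bool) -> R) : R :=
  lim (infinite_volume J b h f @[h --> 0^'+]).

Definition magnetization J b (o : V) : R :=
  plus_state J b (fun s => spin (s o)).

Definition two_point J b (x y : V) : R :=
  plus_state J b (fun s => spin (s x) * spin (s y)).

Definition beta_c J (o : V) : \bar R :=
  ereal_inf [set b%:E | b in [set b | 0 < b /\ 0 < magnetization J b o]].
End Ising.

(* Main.v *)
Require Import Defs.
From HB Require Import structures.
From mathcomp Require Import all_boot all_order all_algebra finmap.
From mathcomp Require Import all_classical all_reals all_analysis.
From mathcomp Require Import ring lra zify.
From mathcomp.analysis.showcase Require Import summability.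
Set Implicit Arguments.
Unset Strict Implicit.
Unset Printing Implicit Defensive.
Import Order.TTheory GRing.Theory Num.Theory numFieldNormedType.Exports.
Local Open Scope ring_scope.

(** The theorem rests on a dichotomy for the quantity
    phi(S) = sum_(x in S, y notin S) b J x y <s_o s_x>_S of Duminil-Copin and
    Tassion, [outflow] below, where S is a finite set containing [o].

    If phi(S) < 1 for some S at [b], a correlation leaving S is controlled by the
    bonds that leave S ([lieb_ising]), and by transitivity this is a strict
    contraction valid around every point ([contraction_step]). It follows that
    the magnetization vanishes ([magnetization_contracting]), that the
    susceptibility is at most |S| / (1 - phi(S)) ([sum_two_point_contracting])
    and, by iteration, that correlations decay exponentially when the couplings
    have finite range ([two_point_decay]).

    If phi(S) >= 1 for all S at [b0], the same holds for every [s >= b0]. The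
    magnetization M(s) in a field satisfies M dM/ds >= sum_T p(T) phi(T) / s, where
    p is a nonnegative weight of total mass 1 - M ^ 2
    ([differential_inequality]), so that (1 - M ^ 2) s ^ 2 is nonincreasing, and
    M(b) ^ 2 >= 1 - b0 ^ 2 / b ^ 2 ([supercritical_bound]). In a finite volume L
    the bonds leaving L are missing from phi; the error is a sum of truncated
    correlations near the boundary, and the Griffiths-Hurst-Sherman inequality
    bounds it by a difference of magnetizations ([boundary_trunc]). As this uses
    bounded bond sums, infinite bond sums are treated apart: there the star
    around [o] magnetizes it completely ([vcor_star]).

    A parameter below the critical one is therefore contracting, since otherwise
    larger parameters that are still subcritical would be magnetized; a parameter
    above it is not.

    A field [h] is encoded as a bond of weight [h] between each point and a ghost
    point [None], so that all correlations are ratios of the moments [moment E A]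
    of zero-field models given by lists [E] of weighted bonds. The correlation
    inequalities come from a duplicated system. Given the set S
    where two independent copies of the spins disagree, S and its complement
    carry independent models with doubled weights, so a product of two moments is
    a signed sum over S of products of nonnegative moments ([duplication]). A
    factor can moreover be expanded, with nonnegative coefficients, over the
    cluster of a chosen point ([cluster_weight_exists]); outside the cluster the
    two sides play symmetric roles, and most signed terms cancel. This replaces
    the switching lemma for random currents. *)

(** * Hyperbolic functions *)

Section Hyperbolic.
Context {R : realType}.
Implicit Type t : R.
Definition ch t : R := (expR t + expR (- t)) / 2.
Definition sh t : R := (expR t - expR (- t)) / 2.

Lemma ch0 : ch 0 = 1. Proof. by rewrite /ch oppr0 expR0; field. Qed.
Lemma sh0 : sh 0 = 0. Proof. by rewrite /sh oppr0 subrr mul0r. Qed.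
Lemma ch2_sh2 t : ch t ^+ 2 - sh t ^+ 2 = 1.
Proof. by rewrite -(expRxMexpNx_1 t) /ch /sh; field. Qed.
Lemma ch_double t : ch (t *+ 2) = ch t ^+ 2 + sh t ^+ 2.
Proof. by rewrite /ch /sh !mulr2n opprD !expRD; field. Qed.
Lemma sh_double t : sh (t *+ 2) = (ch t * sh t) *+ 2.
Proof. by rewrite /ch /sh !mulr2n opprD !expRD; field. Qed.
Lemma ch_gt0 t : 0 < ch t.
Proof. by rewrite divr_gt0 ?addr_gt0 ?expR_gt0. Qed.
Lemma ch_sub_sh t : ch t - sh t = expR (- t).
Proof. by rewrite /ch /sh; field. Qed.
Lemma tanh_le1 t : sh t / ch t <= 1.
Proof.
by rewrite ler_pdivrMr ?ch_gt0// mul1r -subr_ge0 ch_sub_sh expR_ge0.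
Qed.
Lemma ch_ge1 t : 1 <= ch t.
Proof.
have := ch2_sh2 t; have := sqr_ge0 (sh t); have := ch_gt0 t; nra.
Qed.
Lemma is_derive_ch t : is_derive t 1 ch (sh t).
Proof. by apply: is_derive_eq; rewrite /GRing.scale /= /sh; field. Qed.
Lemma is_derive_sh t : is_derive t 1 sh (ch t).
Proof. by apply: is_derive_eq; rewrite /GRing.scale /= /ch; field. Qed.

Lemma le_is_derive (f df : R -> R) (a b : R) : a <= b ->
  (forall x : R, is_derive x 1 f (df x)) ->
  (forall x, a <= x -> 0 <= df x) -> f a <= f b.
Proof.
move=> ab fdf df0; have [|c] := @MVT_segment R f df a b ab (fun x _ => fdf x).
- by apply: derivable_within_continuous => x _; have [] := fdf x.
rewrite in_itv/= => /andP[ac _] fab.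
by rewrite -subr_ge0 fab mulr_ge0 ?df0// subr_ge0.
Qed.

Lemma sh_ge t : 0 <= t -> t <= sh t.
Proof.
move=> t0; rewrite -subr_ge0.
have := @le_is_derive (sh - id) (fun t => ch t - 1) 0 t t0.
rewrite /= !fctE sh0 subrr; apply.
  by move=> x; apply: is_deriveB; exact: is_derive_sh.
by move=> x _; rewrite subr_ge0 ch_ge1.
Qed.

Lemma sh_ge0 t : 0 <= t -> 0 <= sh t.
Proof. by move=> t0; apply: le_trans (sh_ge t0). Qed.

Lemma sh_le_mul_ch t : 0 <= t -> sh t <= t * ch t.
Proof.
move=> t0; rewrite -subr_ge0.
have := @le_is_derive (id * ch - sh) (fun t => t * sh t) 0 t t0.
rewrite /= !fctE sh0 mul0r subrr; apply.
  move=> x; have h1 := is_derive_sh x; have h2 := is_derive_ch x.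
  by apply: is_derive_eq; rewrite /GRing.scale /=; ring.
by move=> x x0; rewrite mulr_ge0// sh_ge0.
Qed.

Lemma expR_spin t (b : R) : b ^+ 2 = 1 -> expR (t * b) = ch t + sh t * b.
Proof.
move=> /eqP; rewrite sqrf_eq1 => /orP[]/eqP->; rewrite ?mulrN1 ?mulr1 /ch /sh; first by field.
by field.
Qed.
End Hyperbolic.

(** * Moments of a list of bonds *)

Definition eq_parity (I : eqType) (A B : seq I) :=
  forall x, odd (count_mem x A) = odd (count_mem x B).

Ltac eq_parity_tac :=
  let z := fresh "z" in
  move=> z; rewrite /= ?count_cat /= ?count_cat /= ?oddD ?oddb;
  repeat match goal with
  | |- context [?a == z] => case: (a == z)
  | |- context [odd (count ?p ?A)] => case: (odd (count p A))
  end; by [].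

Section EvenSeq.
Context {I : eqType}.
Implicit Types (A B : seq I) (S : pred I) (x : I).

Definition all_even A := all (fun x => ~~ odd (count_mem x A)) A.

Lemma all_evenP A : reflect (forall x, ~~ odd (count_mem x A)) (all_even A).
Proof.
apply: (iffP allP) => [h x|h x _]; last exact: h.
have [/h//|/count_memPn->//] := boolP (x \in A).
Qed.

Lemma eq_parity_all_even A B : eq_parity A B -> all_even A = all_even B.
Proof.
by move=> AB; apply/all_evenP/all_evenP => h x; [rewrite -AB|rewrite AB].
Qed.

Lemma eq_parity_cons x A B : eq_parity A B -> eq_parity (x :: A) (x :: B).
Proof. by move=> AB y; rewrite /= !oddD AB. Qed.

Lemma all_even_count A S : all_even A -> ~~ odd (count S A).
Proof.
have [n] := ubnP (size A); elim: n A => // n IH [|x A]//= /ltnSE An /[dup] ev.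
move=> /all_evenP/(_ x); rewrite /= eqxx/= negbK => xA.
have {}xA : x \in A by apply: contraTT xA => /count_memPn->.
have /permP pA := perm_to_rem xA; rewrite pA /= addnA oddD addnn odd_double/=.
apply: IH; first by rewrite size_rem//; case: (A) xA An => //= *; apply: ltnW.
rewrite -(eq_parity_all_even _ : all_even (x :: A) = _)// => y /=.
by rewrite pA/= addnA oddD addnn odd_double.
Qed.

Lemma all_even_filter A S :
  all_even A = all_even [seq z <- A | S z] && all_even [seq z <- A | ~~ S z].
Proof.
have h T x : count_mem x [seq z <- A | T z] = (T x * count_mem x A)%N.
  rewrite count_filter; case Tx : (T x); rewrite ?mul1n ?mul0n.
    by apply: eq_count => y /=; case: eqP => // ->; rewrite Tx.
  by apply/eqP; rewrite -leqn0 leqNgt -has_count; apply/hasPn => y _ /=;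
    case: eqP => // ->; rewrite Tx.
apply/all_evenP/andP => [ev|[/all_evenP ev1 /all_evenP ev2] x].
  by split; apply/all_evenP => x; rewrite h oddM negb_and ev orbT.
have := ev1 x; have := ev2 x; rewrite !h/=.
by case: (S x); rewrite !mul1n.
Qed.
End EvenSeq.

Section EdgeList.
Context {R : realType}.

(** The average over all spin configurations of the product of the spins in [A]
    times the weight exp (t s_x s_y) of each bond, where exp (t s_x s_y) = ch t
    + s_x s_y sh t: each bond either leaves the list of sources unchanged or
    adds its two ends to it. *)
Fixpoint moment (I : eqType) (E : seq (I * I * R)) (A : seq I) : R :=
  if E is (x, y, t) :: E' then ch t * moment E' A + sh t * moment E' (x :: y :: A)
  else (all_even A)%:R.

Definition restr (I : eqType) (S : pred I) (E : seq (I * I * R)) :=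
  [seq e <- E | S e.1.1 && S e.1.2].

Definition nng (I : eqType) (E : seq (I * I * R)) := all (fun e => 0 <= e.2) E.

Context {I : eqType}.
Implicit Types (A B : seq I) (S : pred I) (x : I) (E : seq (I * I * R)).

Lemma eq_parity_moment E A B : eq_parity A B -> moment E A = moment E B.
Proof.
elim: E A B => [|[[x y] t] E IH] A B AB /=; first by rewrite (eq_parity_all_even AB).
by rewrite (IH _ _ AB) (IH (x :: y :: A) (x :: y :: B))//; do 2!apply: eq_parity_cons.
Qed.

Lemma moment_cons x y t E A :
  moment ((x, y, t) :: E) A = ch t * moment E A + sh t * moment E (x :: y :: A).
Proof. by []. Qed.

Lemma moment_swap e f E A : moment (e :: f :: E) A = moment (f :: e :: E) A.
Proof.
case: e f => [[x y] t] [[x' y'] t'] /=.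
rewrite (@eq_parity_moment E [:: x', y', x, y & A] [:: x, y, x', y' & A]); last by eq_parity_tac.
ring.
Qed.

Lemma eq_moment_cons e E E' : (forall A, moment E A = moment E' A) ->
  forall A, moment (e :: E) A = moment (e :: E') A.
Proof. by case: e => [[x y] t] h A /=; rewrite !h. Qed.

Lemma moment_catC E E' A : moment (E ++ E') A = moment (E' ++ E) A.
Proof.
elim: E A => [|e E IH] A; first by rewrite cats0.
have -> : moment (E' ++ e :: E) A = moment (e :: E' ++ E) A; last exact: eq_moment_cons.
elim: E' A {IH} => [//|f E' IH] A.
transitivity (moment (f :: e :: E' ++ E) A); last exact: moment_swap.
by rewrite cat_cons; apply: eq_moment_cons.
Qed.

Lemma eq_moment_cat E1 E E' : (forall A, moment E A = moment E' A) ->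
  forall A, moment (E1 ++ E) A = moment (E1 ++ E') A.
Proof.
by move=> h; elim: E1 => [//|e E1 IH] A; rewrite !cat_cons; apply: eq_moment_cons.
Qed.

Lemma moment_perm E E' : perm_eq E E' -> forall A, moment E A = moment E' A.
Proof.
move=> pE; pose P E2 := forall A, moment E A = moment E2 A.
suff: P E' by [].
apply: (catCA_perm_ind (P := P) _ pE); last by [].
move=> s1 s2 s3 h A; rewrite h catA catA.
rewrite [RHS]moment_catC [LHS]moment_catC.
by apply: eq_moment_cat => B; rewrite moment_catC.
Qed.

Lemma moment_ge0 E A : nng E -> 0 <= moment E A.
Proof.
elim: E A => [|[[x y] t] E IH] A /=; first by rewrite ler0n.
by move=> /andP[t0 E0]; rewrite addr_ge0// mulr_ge0 ?IH ?sh_ge0// ltW ?ch_gt0.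
Qed.

Lemma moment_gt0 E : nng E -> 0 < moment E [::].
Proof.
elim: E => [|[[x y] t] E IH]/=; first by rewrite ltr01.
move=> /andP[t0 E0]; apply: ltr_wpDr; last by rewrite mulr_gt0 ?IH ?ch_gt0.
by rewrite mulr_ge0 ?moment_ge0 ?sh_ge0.
Qed.

Lemma nng_cat E E' : nng (E ++ E') = nng E && nng E'.
Proof. exact: all_cat. Qed.

Lemma nng_filter p E : nng E -> nng [seq e <- E | p e].
Proof. by move=> h; rewrite /nng all_filter; apply: sub_all h => e /= ->; apply: implybT. Qed.

(** No bond leaves [S], so flipping the spins of [S] preserves the weight and
    changes the sign of the product. *)
Lemma moment_odd S E A : all (fun e => S e.1.1 == S e.1.2) E ->
  odd (count S A) -> moment E A = 0.
Proof.
elim: E A => [|[[x y] t] E IH] A /=.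
  by move=> _ oA; rewrite (negbTE (contraL (@all_even_count _ A S) oA)).
move=> /andP[/eqP xy E0] oA; rewrite !IH ?mulr0 ?addr0//= xy addnA oddD addnn.
by rewrite odd_double.
Qed.

(** No bond joins [S] to its complement, so the two families of spins are
    independent. *)
Lemma moment_split S E A : all (fun e => S e.1.1 == S e.1.2) E ->
  moment E A = moment (restr S E) [seq z <- A | S z] *
          moment (restr (predC S) E) [seq z <- A | ~~ S z].
Proof.
elim: E A => [|[[x y] t] E IH] A /=.
  by rewrite (all_even_filter A S) -natrM mulnb.
move=> /andP[/eqP xy E0]; rewrite !IH//= -!xy andbb.
by case: (S x); rewrite /= -/(restr _ _); ring.
Qed.
End EdgeList.

Lemma moment_map (R : realType) (I I' : eqType) (f : I -> I') (E : seq (I * I * R)) A :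
  injective f ->
  moment [seq (f e.1.1, f e.1.2, e.2) | e <- E] (map f A) = moment E A.
Proof.
move=> fI; elim: E A => [|[[x y] t] E IH] A /=; last by rewrite -!map_cons !IH.
congr (nat_of_bool _)%:R; rewrite /all_even all_map; apply: eq_all => x /=.
by rewrite count_map; congr (~~ odd _); apply: eq_count => y /=; rewrite inj_eq.
Qed.

(** * The duplicated system *)

Section SubsetSums.
Import boot.finset.
Context {R : realType} {I : finType}.
Implicit Types (S T W : {set I}).

Lemma sum_subsetC (F : {set I} -> {set I} -> R) T :
  \sum_(S : {set I} | S \subset T) F S (T :\: S) =
  \sum_(S : {set I} | S \subset T) F (T :\: S) S.
Proof.
have h S : S \subset T -> T :\: (T :\: S) = S.
  by move=> ST; rewrite setDDr setDv set0U; apply/setIidPr.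
rewrite (reindex_onto (fun S => T :\: S) (fun S => T :\: S)) //=.
apply: eq_big => S; last by case/andP => _ /eqP->.
rewrite subsetDl/=; apply/eqP/idP => [<-|/h//]; exact: subsetDl.
Qed.

(** Associativity of the convolution over disjoint unions. *)
Lemma sum_subsetA (F : {set I} -> {set I} -> {set I} -> R) T :
  \sum_(W : {set I} | W \subset T) \sum_(W1 : {set I} | W1 \subset W)
     F W1 (W :\: W1) (T :\: W) =
  \sum_(W1 : {set I} | W1 \subset T) \sum_(W2 : {set I} | W2 \subset T :\: W1)
     F W1 W2 (T :\: W1 :\: W2).
Proof.
rewrite (exchange_big_dep (fun W1 => W1 \subset T)) /=; last first.
  by move=> W W1 WT W1W; exact: fintype.subset_trans W1W WT.
apply: eq_bigr => W1 W1T.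
rewrite (reindex_onto (fun W2 => W1 :|: W2) (fun W => W :\: W1)) /=; last first.
  by move=> W /andP[_ W1W]; rewrite setDE setUIr setUCr setIT; apply/setUidPr.
apply: eq_big => W2.
  rewrite subUset W1T/= subsetUl andbT setDUl setDv set0U subsetD.
  by congr andb; apply/eqP/idP => [/setDidPl//|/setDidPl].
by case/andP => _ /eqP ->; rewrite -setDDl.
Qed.

Lemma count_setD S W (A : seq I) : W \subset S ->
  count (mem S) A = (count (mem W) A + count (mem (S :\: W)) A)%N.
Proof.
move=> WS; elim: A => //= z A ->; rewrite addnACA; congr (_ + _)%N; rewrite inE.
have := fintype.subsetP WS z; case: (z \in W) => /=; last by [].
by move=> /(_ isT) ->.
Qed.
End SubsetSums.

Section Duplication.
Import boot.finset.
Context {R : realType} {I : finType}.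
Implicit Types (A B C : seq I) (S T W : {set I}) (E F : seq (I * I * R)).

Definition dbl E : seq (I * I * R) := [seq (e.1, e.2 *+ 2) | e <- E].

Definition rmoment E T A : R := moment (restr (mem T) E) A.

(** Used with doubled weights: this is the contribution of one of the two sides
    of a duplicated system. *)
Definition dmoment F C S : R := rmoment F S [seq z <- C | z \in S].

Definition sgn B S : R := (-1) ^+ count (mem S) B.

Lemma nng_dbl E : nng E -> nng (dbl E).
Proof. by move=> h; rewrite /nng all_map; apply: sub_all h => e /= *; rewrite mulrn_wge0. Qed.

Lemma nng_restr (p : pred I) E : nng E -> nng (restr p E).
Proof. exact: nng_filter. Qed.

Lemma dmoment_ge0 F C S : nng F -> 0 <= dmoment F C S.
Proof. by move=> h; rewrite moment_ge0// nng_restr. Qed.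

Lemma dmoment_odd F C S : odd (count (mem S) C) -> dmoment F C S = 0.
Proof.
move=> oC; apply: (@moment_odd _ _ predT); first exact/allP.
by rewrite count_predT size_filter.
Qed.

Lemma dmoment_local F C C' S :
  (forall x, x \in S -> odd (count_mem x C) = odd (count_mem x C')) ->
  dmoment F C S = dmoment F C' S.
Proof.
move=> h; apply: eq_parity_moment => x; rewrite !count_filter.
have [xS|xS] := boolP (x \in S).
  have q D : count (predI (pred1 x) (mem S)) D = count_mem x D.
    by apply: eq_count => y /=; case: eqP => // ->; rewrite xS.
  by rewrite !q h.
have q D : count (predI (pred1 x) (mem S)) D = 0%N.
  rewrite (@eq_count _ _ pred0) ?count_pred0// => y /=.
  by case: eqP => // ->; rewrite (negbTE xS).
by rewrite !q.
Qed.

Lemma sgn_cons x B S : sgn (x :: B) S = (-1) ^+ (x \in S) * sgn B S.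
Proof. by rewrite /sgn /= exprD. Qed.

(** If [x] has odd multiplicity in [B], moving [x] in or out of [S] changes the
    sign. *)
Lemma sum_sgn T B : {subset B <= T} ->
  \sum_(S : {set I} | S \subset T) sgn B S = 2 ^+ #|T| * (all_even B)%:R.
Proof.
move=> BT; have [ev|] := boolP (all_even B).
  rewrite (eq_bigr (fun => 1)) => [|S _]; last first.
    by rewrite /sgn -signr_odd (negbTE (all_even_count _ ev)).
  rewrite sumr_const mulr1 -natrX -card_powerset.
  by congr (_%:R); apply: eq_card => S; rewrite powersetE.
rewrite -has_predC => /hasP[x xB /= /negPn ox]; rewrite mulr0.
have xT := BT _ xB.
(* The involution that moves x across S. *)
pose f S := if x \in S then S :\ x else x |: S.
have fK : involutive f.
  move=> S; rewrite /f; case: (boolP (x \in S)) => xS.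
    by rewrite !inE eqxx setD1K.
  by rewrite setU11 setU1K.
suff h : \sum_(S : {set I} | S \subset T) sgn B S =
         - \sum_(S : {set I} | S \subset T) sgn B S.
  by apply/eqP; rewrite -[_ == 0](mulrn_eq0 _ 2) mulr2n {1}h addNr.
rewrite [LHS](reindex_inj (inv_inj fK)) -sumrN.
have fs S y : (y \in f S) = (y \in S) (+) (y == x).
  rewrite /f; case: ifP => xS; rewrite !inE;
  by case: eqP => [->|_]; rewrite ?xS ?addbF.
apply: eq_big => S.
  apply/fintype.subsetP/fintype.subsetP => h y; have := h y; rewrite fs; case: eqP => [->//|_];
  by rewrite addbF.
move=> _; rewrite /sgn -[in LHS]signr_odd -[in RHS]signr_odd.
suff -> : odd (count (mem (f S)) B) = ~~ odd (count (mem S) B).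
  by rewrite signrN.
rewrite -[~~ _]addbT -ox -oddD; elim: (B) => //= y B' IH.
rewrite addnACA [in RHS]oddD -IH oddD fs !oddD.
by case: (y \in S); case: (y == x).
Qed.

Lemma duplication_aux E T A B : all (fun e => (e.1.1 \in T) && (e.1.2 \in T)) E ->
  {subset B <= T} ->
  2 ^+ #|T| * (moment E A * moment E B) = \sum_(S : {set I} | S \subset T) sgn B S *
     moment [seq e <- dbl E | (e.1.1 \in S) == (e.1.2 \in S)] (A ++ B).
Proof.
elim: E A B => [|[[x y] t] E IH] A B /=.
  move=> _ BT; rewrite -natrM mulnb -mulr_suml sum_sgn// -mulrA -natrM mulnb.
  congr (_ * (nat_of_bool _)%:R).
  apply/andP/andP => -[]; move=> /all_evenP h1 /all_evenP h2; split; apply/all_evenP => z//;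
    have := h1 z; have := h2 z; rewrite !count_cat !oddD;
    by case: (odd _); case: (odd _).
move=> /andP[/andP[xT yT] ET] BT.
have BT' : {subset [:: x, y & B] <= T}.
  by move=> z; rewrite !inE => /or3P[/eqP->|/eqP->|/BT].
transitivity (ch t ^+ 2 * (2 ^+ #|T| * (moment E A * moment E B)) +
  ch t * sh t * (2 ^+ #|T| * (moment E [:: x, y & A] * moment E B)) +
  ch t * sh t * (2 ^+ #|T| * (moment E A * moment E [:: x, y & B])) +
  sh t ^+ 2 * (2 ^+ #|T| * (moment E [:: x, y & A] * moment E [:: x, y & B]))).
  ring.
rewrite !IH// !mulr_sumr -!big_split /=; apply: eq_bigr => S ST.
set E' := [seq e <- dbl E | _]; rewrite !sgn_cons.
have e1 : moment E' (A ++ [:: x, y & B]) = moment E' [:: x, y & A ++ B].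
  by apply: eq_parity_moment; eq_parity_tac.
have e2 : moment E' (x :: y :: A ++ [:: x, y & B]) = moment E' (A ++ B).
  by apply: eq_parity_moment; eq_parity_tac.
(* On a common side the bond gets weight 2 t; between the sides it disappears,
   as ch ^ 2 - sh ^ 2 = 1. *)
rewrite e1 e2; have := ch2_sh2 t => hc.
case: (x \in S) (y \in S) => -[] /=; rewrite ?expr0 ?expr1 ?ch_double ?sh_double.
- by ring.
- transitivity ((ch t ^+ 2 - sh t ^+ 2) * (sgn B S * moment E' (A ++ B))).
    by ring.
  by rewrite hc mul1r.
- transitivity ((ch t ^+ 2 - sh t ^+ 2) * (sgn B S * moment E' (A ++ B))).
    by ring.
  by rewrite hc mul1r.
- by ring.
Qed.

(** Two independent copies of the spins on [T] disagree on a random set [S]. A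
    bond with both ends on the same side has equal energies in the two copies,
    hence doubled weight; the energies of a bond between the sides cancel. A
    source of the second copy is replaced by one of the first copy at the cost
    of a sign if it lies in [S]. *)
Lemma duplication E T A B : {subset A <= T} -> {subset B <= T} ->
  2 ^+ #|T| * (rmoment E T A * rmoment E T B) = \sum_(S : {set I} | S \subset T)
    sgn B S * (dmoment (dbl E) (A ++ B) S * dmoment (dbl E) (A ++ B) (T :\: S)).
Proof.
move=> AT BT; rewrite (duplication_aux A _ BT); last first.
  by rewrite all_filter; apply/allP => e _ /=; apply/implyP.
apply: eq_bigr => S ST; congr (_ * _).
have h (e : I * I * R) : (e.1.1 \in S) && (e.1.2 \in S) -> (e.1.1 \in T) && (e.1.2 \in T).
  by move=> /andP[? ?]; rewrite !(fintype.subsetP ST).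
rewrite (moment_split (S := mem S)); last first.
  by rewrite all_filter; apply/allP => e _ /=; apply/implyP.
rewrite /dmoment /rmoment /restr /dbl -!filter_predI !filter_map -!filter_predI.
congr (_ * _); apply: f_equal2.
- congr map; apply: eq_filter => e /=; have := h e.
  by case: (_ \in S); case: (_ \in S) => //= ->.
- by [].
- congr map; apply: eq_filter => e /=; rewrite !inE.
  by case: (_ \in S); case: (_ \in S); rewrite ?andbF//=.
- apply: eq_in_filter => z; rewrite mem_cat !inE => /orP[/AT|/BT] ->;
  by rewrite andbT.
Qed.
End Duplication.

(** * Cluster weights *)

Section Cluster.
Import boot.finset.
Context {R : realType} {I : finType}.
Implicit Types (A B C D : seq I) (S T W : {set I}) (E F : seq (I * I * R)).

(** [k r C W] is the contribution to a moment of the cluster [W] of [r]. The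
    last property is the expansion of a moment over this cluster; the others
    give its signs and cancellations. *)
Definition cluster_weight F (k : I -> seq I -> {set I} -> R) :=
  [/\ forall r C W, 0 <= k r C W,
      forall r C W, r \notin W -> k r C W = 0,
      forall r C W, odd (count (mem W) C) -> k r C W = 0,
      forall r C D W,
        (forall x, x \in W -> odd (count_mem x C) = odd (count_mem x D)) ->
        k r C W = k r D W &
      forall r C T, r \in T -> dmoment F C T =
        \sum_(W : {set I} | W \subset T) k r C W * dmoment F C (T :\: W)].

Section Step.
Variables (x y : I) (t : R) (F : seq (I * I * R)).
Variable k : I -> seq I -> {set I} -> R.
Hypothesis t0 : 0 <= t.
Hypothesis kF : cluster_weight F k.

Let far_end W := if x \in W then y else x.

(** The bond [(x, y)] joins the cluster [W1] of the root, which contains one of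
    its ends, to the cluster [W2] of the end outside of [W1]. *)
Definition merge r C W1 W2 :=
  if (x \in W1) (+) (y \in W1) then
    (ch t - 1) * (k r C W1 * k (far_end W1) C W2) +
    sh t * (k r [:: x, y & C] W1 * k (far_end W1) [:: x, y & C] W2)
  else 0.

Definition cons_weight r C W :=
  (if (x \in W) && (y \in W) then ch t * k r C W + sh t * k r [:: x, y & C] W
   else k r C W) +
  \sum_(W1 : {set I} | W1 \subset W) merge r C W1 (W :\: W1).

Lemma dmoment_cons_in C T : x \in T -> y \in T ->
  dmoment ((x, y, t) :: F) C T = ch t * dmoment F C T + sh t * dmoment F [:: x, y & C] T.
Proof. by move=> xT yT; rewrite /dmoment /rmoment /= xT yT. Qed.

Lemma dmoment_cons_out C T : ~~ ((x \in T) && (y \in T)) ->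
  dmoment ((x, y, t) :: F) C T = dmoment F C T.
Proof. by move=> /negbTE xyT; rewrite /dmoment /rmoment /= xyT. Qed.

Lemma local_cons2 C S : x \notin S -> y \notin S -> forall z, z \in S ->
  odd (count_mem z C) = odd (count_mem z [:: x, y & C]).
Proof.
move=> xS yS z zS /=.
have /negbTE -> : x != z by apply: contraNneq xS => ->.
by have /negbTE -> : y != z by apply: contraNneq yS => ->.
Qed.

Lemma merge_out r C W W1 : ~~ ((x \in W) && (y \in W)) -> W1 \subset W ->
  merge r C W1 (W :\: W1) = 0.
Proof.
have [_ k0 _ _ _] := kF.
move=> xyW W1W; rewrite /merge; case: ifP => // xy.
have oW : far_end W1 \notin W :\: W1.
  apply: contra xyW; rewrite /far_end inE.
  move: xy; case: (boolP (x \in W1)) => [xW1 /= _ /andP[_ ->]|_ /= yW1 /andP[_ ->]].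
    by rewrite (fintype.subsetP W1W).
  by rewrite (fintype.subsetP W1W).
by rewrite !(k0 (far_end W1))// !mulr0 addr0.
Qed.

(** Write ch t = 1 + (ch t - 1). If the cluster of the root contains one end of
    the new bond, the term 1 leaves the cluster as it is. The other terms use
    the bond: the moment of the remaining sites is expanded again, around the
    other end, and the two clusters merge. If it contains both ends or none, the
    bond is absorbed by the cluster or by the remaining moment. *)
Lemma cluster_weight_step : cluster_weight ((x, y, t) :: F) cons_weight.
Proof.
have [k_ge0 k_root k_odd k_loc k_dec] := kF.
have c1 : 0 <= ch t - 1 by rewrite subr_ge0 ch_ge1.
have c0 := ltW (ch_gt0 t); have s0 := sh_ge0 t0.
have merge_ge0 r C W1 W2 : 0 <= merge r C W1 W2.
  by rewrite /merge; case: ifP => // _; apply: addr_ge0; apply: mulr_ge0 => //; apply: mulr_ge0.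
split.
- move=> r C W; apply: addr_ge0; last exact: sumr_ge0.
  by case: ifP => // _; apply: addr_ge0; apply: mulr_ge0.
- move=> r C W rW; rewrite /cons_weight !k_root// !mulr0 addr0 if_same add0r.
  rewrite big1// => W1 W1W; rewrite /merge !(k_root r) ?mul0r ?mulr0 ?addr0 ?if_same//;
  by apply: contra rW; apply/fintype.subsetP.
- move=> r C W oW; have oW' : odd (count (mem W) [:: x, y & C]) = (x \in W) (+) (y \in W) (+) true.
    by rewrite /= !oddD !oddb oW addbA.
  rewrite /cons_weight big1 ?addr0 => [|W1 W1W].
    by case: ifP => [/andP[xW yW]|_]; rewrite !k_odd ?mulr0 ?addr0// oW' xW yW.
  have [xyW|/merge_out->//] := boolP ((x \in W) && (y \in W)).
  rewrite /merge; case: ifP => // _.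
  have z A : odd (count (mem W) A) -> k r A W1 * k (far_end W1) A (W :\: W1) = 0.
    rewrite (count_setD _ W1W) oddD; case: (boolP (odd (count (mem W1) A))) => [h _|_ /= h].
      by rewrite (k_odd _ _ _ h) mul0r.
    by rewrite (k_odd _ _ _ h) mulr0.
  by rewrite !z ?mulr0 ?addr0// oW'; case/andP: xyW => -> ->.
- move=> r C D W CD.
  have CD' z : z \in W -> odd (count_mem z [:: x, y & C]) = odd (count_mem z [:: x, y & D]).
    by move=> zW; rewrite /= !oddD CD.
  rewrite /cons_weight (k_loc r C D)// (k_loc r [:: x, y & C] [:: x, y & D])//.
  congr (_ + _); apply: eq_bigr => W1 W1W; rewrite /merge; case: ifP => // _.
  have hW1 z : z \in W1 -> z \in W by exact: (fintype.subsetP W1W).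
  have hW2 z : z \in W :\: W1 -> z \in W by rewrite inE => /andP[].
  rewrite !(k_loc _ C D) => [|z /hW2/CD//|z /hW1/CD//].
  by rewrite !(k_loc _ [:: x, y & C] [:: x, y & D]) => [|z /hW2/CD'//|z /hW1/CD'//].
- move=> r C T rT; have [/andP[xT yT]|xyT] := boolP ((x \in T) && (y \in T)); last first.
    rewrite dmoment_cons_out// (k_dec r)//; apply: eq_bigr => W WT.
    have xyW : ~~ ((x \in W) && (y \in W)).
      by apply: contra xyT => /andP[xW yW]; rewrite !(fintype.subsetP WT).
    rewrite dmoment_cons_out; last first.
      by apply: contra xyT; rewrite !inE => /andP[/andP[_ ->] /andP[_ ->]].
    rewrite /cons_weight (negbTE xyW) big1 ?addr0// => W1; exact: merge_out.
  set D := [:: x, y & C].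
  rewrite dmoment_cons_in// !(k_dec r)// !mulr_sumr -big_split /=.
  rewrite (eq_bigr (fun W => (if (x \in W) && (y \in W) then
      ch t * k r C W + sh t * k r D W else k r C W) *
         dmoment ((x, y, t) :: F) C (T :\: W) +
    \sum_(W2 : {set I} | W2 \subset T :\: W) merge r C W W2 *
         dmoment ((x, y, t) :: F) C (T :\: W :\: W2))); last first.
    move=> W WT.
    have uCD S : (x \notin S) -> (y \notin S) -> dmoment F D S = dmoment F C S.
      by move=> xS yS; apply: dmoment_local => z zS; rewrite (local_cons2 C xS yS zS).
    have uC S : (x \notin S) || (y \notin S) -> dmoment ((x, y, t) :: F) C S = dmoment F C S.
      by move=> h; rewrite dmoment_cons_out// negb_and.
    have [xy|xy] := boolP ((x \in W) (+) (y \in W)).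
      have [zT zW] : far_end W \in T /\ far_end W \notin W.
        by move: xy; rewrite /far_end; case: (boolP (x \in W)) => [_ yW|xW _]; split.
      have -> : (x \in W) && (y \in W) = false.
        by move: xy; case: (x \in W); case: (y \in W).
      rewrite uC; last by move: xy; rewrite !inE; case: (x \in W); case: (y \in W); rewrite ?orbT.
      have e A : dmoment F A (T :\: W) = \sum_(W2 : {set I} | W2 \subset T :\: W)
          k (far_end W) A W2 * dmoment F A (T :\: W :\: W2).
        by apply: k_dec; rewrite inE zW.
      transitivity (k r C W * dmoment F C (T :\: W) + ((ch t - 1) *
        (k r C W * dmoment F C (T :\: W)) + sh t * (k r D W * dmoment F D (T :\: W)))); first by ring.
      congr (_ + _); rewrite !e !mulr_sumr -big_split /=.
      apply: eq_bigr => W2 _; rewrite /merge xy.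
      have [zW2|zW2] := boolP (far_end W \in W2); last by rewrite !(k_root (far_end W))//; ring.
      have [xo yo] : x \notin T :\: W :\: W2 /\ y \notin T :\: W :\: W2.
        by move: xy zW2; rewrite /far_end !inE; case: (x \in W) => /=;
          case: (y \in W) => //= _ ->; rewrite ?andbF.
      by rewrite uC ?xo// uCD// -/D; ring.
    rewrite big1 ?addr0 => [|W2 _]; last by rewrite /merge (negbTE xy) mul0r.
    move: xy; case: (boolP (x \in W)) => xW; case: (boolP (y \in W)) => yW //= _.
      by rewrite uCD ?uC ?inE ?xW ?yW//; ring.
    rewrite dmoment_cons_in ?inE ?xW ?yW// -(k_loc r C D); last exact: local_cons2.
    by rewrite -/D; ring.
  rewrite big_split /= -(sum_subsetA (fun W1 W2 W3 => merge r C W1 W2 * dmoment ((x, y, t) :: F) C W3)).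
  rewrite -big_split /=; apply: eq_bigr => W WT.
  by rewrite -mulr_suml -mulrDl.
Qed.
End Step.

Lemma cluster_weight_nil : cluster_weight [::]
  (fun r C W => ((W == [set r]) && ~~ odd (count_mem r C))%:R).
Proof.
split.
- by move=> r C W; rewrite ler0n.
- by move=> r C W rW; case: eqP => // We; rewrite We set11 in rW.
- move=> r C W; case: eqP => // -> /=.
  rewrite (@eq_count _ (mem [set r]) (pred1 r)) => [->//|z].
  by rewrite /= inE.
- move=> r C D W CD; case: eqP => // We /=.
  by rewrite (CD r)// We set11.
- move=> r C T rT; rewrite (bigD1 [set r]) ?sub1set//= eqxx big1 ?addr0.
    rewrite /dmoment /rmoment /= -natrM mulnb; congr (nat_of_bool _)%:R.
    rewrite (all_even_filter _ (pred1 r)) -!filter_predI; congr (_ && _).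
      apply/all_evenP/idP => [/(_ r)|h z].
        rewrite count_filter; congr (~~ odd _); apply: eq_count => z /=.
        by case: eqP => // ->; rewrite rT.
      rewrite count_filter; case: (z =P r) => [->|zr].
        rewrite (@eq_count _ _ (pred1 r))// => z'/=.
        by case: eqP => //= ->; rewrite ?eqxx rT.
      rewrite (@eq_count _ _ pred0) ?count_pred0// => z'/=.
      by case: eqP => // ->; case: eqP zr.
    by congr all_even; apply: eq_filter => z /=; rewrite !inE.
  by move=> W /andP[_ /negbTE->]; rewrite mul0r.
Qed.

Lemma cluster_weight_exists F : nng F -> exists k, cluster_weight F k.
Proof.
elim: F => [_|[[x y] t] F IH /= /andP[t0 /IH[k kF]]].
  by eexists; exact: cluster_weight_nil.
by exists (cons_weight x y t k); apply: cluster_weight_step.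
Qed.
End Cluster.

(** * The inequalities of Griffiths, Newman and Lieb *)

Section SubsetSymmetry.
Import boot.finset.
Context {R : realType} {I : finType}.
Implicit Types (S T W : {set I}).

Lemma sum_subsetAC (F : {set I} -> {set I} -> {set I} -> R) T :
  \sum_(W1 : {set I} | W1 \subset T) \sum_(W2 : {set I} | W2 \subset T :\: W1)
     F W1 W2 (T :\: W1 :\: W2) =
  \sum_(W2 : {set I} | W2 \subset T) \sum_(W1 : {set I} | W1 \subset T :\: W2)
     F W1 W2 (T :\: W2 :\: W1).
Proof.
rewrite -sum_subsetA -(sum_subsetA (fun W2 W1 => F W1 W2)).
by apply: eq_bigr => W _; rewrite (sum_subsetC (fun A B => F A B (T :\: W))).
Qed.

Lemma sum_subset_antisym (F : {set I} -> {set I} -> R) T :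
  (forall S S', F S S' = - F S' S) ->
  \sum_(S : {set I} | S \subset T) F S (T :\: S) = 0.
Proof.
move=> h; set s := \sum_(_ | _) _.
have : s = - s.
  by rewrite {1}/s sum_subsetC -sumrN; apply: eq_bigr.
lra.
Qed.

(** The terms where [p] does not separate the two sides vanish, and every other
    unordered pair of sides is counted once instead of twice. *)
Lemma sum_subset_half (p : pred {set I}) (F : {set I} -> {set I} -> R) T :
  (forall S S', F S S' = F S' S) ->
  (forall S, S \subset T -> p S = p (T :\: S) -> F S (T :\: S) = 0) ->
  \sum_(S : {set I} | S \subset T) (p S)%:R * F S (T :\: S) =
  2^-1 * \sum_(S : {set I} | S \subset T) F S (T :\: S).
Proof.
move=> Fs Fp; set s := LHS.
have h : \sum_(S : {set I} | S \subset T) F S (T :\: S) = s + s.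
  rewrite {2}/s (sum_subsetC (fun A B => (p A)%:R * F A B)) -big_split /=.
  apply: eq_bigr => S ST; rewrite (Fs (T :\: S) S).
  have [/(Fp _ ST)->|] := eqVneq (p S) (p (T :\: S)); first by rewrite !mulr0 addr0.
  by case: (p S); case: (p _) => // _; rewrite mul1r mul0r ?addr0 ?add0r.
by rewrite h; lra.
Qed.
End SubsetSymmetry.

Section FiniteInequalities.
Import boot.finset.
Context {R : realType} {I : finType}.
Implicit Types (A B C D : seq I) (S T W : {set I}) (E F : seq (I * I * R)).

Lemma rmoment_setT E A : rmoment E [set: I] A = moment E A.
Proof.
by congr moment; rewrite /restr (@eq_filter _ _ predT) ?filter_predT// => e /=; rewrite !inE.
Qed.

Lemma eq_parity_dmoment F C D S : eq_parity C D -> dmoment F C S = dmoment F D S.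
Proof. by move=> h; apply: dmoment_local => x _; exact: h. Qed.

Lemma duplicationT E A B C : eq_parity (A ++ B) C ->
  2 ^+ #|I| * (moment E A * moment E B) = \sum_(S : {set I} | S \subset [set: I])
    sgn B S * (dmoment (dbl E) C S * dmoment (dbl E) C ([set: I] :\: S)).
Proof.
move=> ABC; rewrite -!rmoment_setT -cardsT duplication; [|by move=> ? _; rewrite inE..].
by apply: eq_bigr => S _; rewrite !(eq_parity_dmoment _ _ ABC).
Qed.

Lemma sum_mem_seq S A : \sum_(a <- A) (a \in S)%:R = (count (mem S) A)%:R :> R.
Proof. by elim: A => [|a A IH]; rewrite ?big_nil// big_cons IH -natrD. Qed.

(** Duplicated, the two sides differ only by the signs [sgn B S], which are at
    most 1. *)
Lemma gks2_fin E A B : nng E ->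
  moment E A * moment E B <= moment E (A ++ B) * moment E [::].
Proof.
move=> E0; rewrite -(@ler_pM2l _ (2 ^+ #|I|)) ?exprn_gt0//.
rewrite (@duplicationT E A B (A ++ B))// (@duplicationT E (A ++ B) [::] (A ++ B)) ?cats0//.
apply: ler_sum => S _; apply: ler_wpM2r.
  by rewrite mulr_ge0// dmoment_ge0// nng_dbl.
rewrite /sgn /= expr0 -signr_odd; case: odd; rewrite ?expr0// expr1; lra.
Qed.

(** Duplicate both sides. By symmetry [v] may be assumed in [S]; expand this
    side over the cluster [W] of [v]. The numbers of points of [A] on the two
    sides of the remaining sites cancel by antisymmetry, and what is left is the
    number of points of [A] in [W], minus 1. It is nonnegative, because [W]
    contains an even number of sources, one of which is [v]. *)
Lemma newman_fin E v A : nng E ->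
  moment E (v :: A) * moment E [::] <= \sum_(a <- A) moment E [:: v; a] * moment E (a :: A).
Proof.
move=> E0; rewrite -(@ler_pM2l _ (2 ^+ #|I|)) ?exprn_gt0// -subr_ge0.
have [k [k_ge0 k_root k_odd k_loc k_dec]] := cluster_weight_exists (nng_dbl E0).
set C := v :: A; pose U := dmoment (dbl E) C.
pose n S : R := (count (mem S) A)%:R.
rewrite (@duplicationT E C [::] C) ?cats0// mulr_sumr.
rewrite (eq_bigr (fun a => \sum_(S : {set I} | S \subset [set: I]) sgn [:: v; a] S *
   (U S * U ([set: I] :\: S)))) => [|a _]; last first.
  by rewrite mulrA [_ * _ * _]mulrAC -mulrA (@duplicationT E (a :: A) [:: v; a] C)//; eq_parity_tac.
rewrite exchange_big /= -sumrB.
(* f is the sum over a of the signs of [:: v; a]. *)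
pose f S S' := ((v \in S)%:R - (v \in S')%:R) * (n S - n S').
have sgnE S a : sgn [:: v; a] S = ((v \in S)%:R - (v \in ~: S)%:R) * ((a \in S)%:R - (a \in ~: S)%:R) :> R.
  rewrite /sgn /= addn0 !inE.
  by case: (v \in S); case: (a \in S); rewrite /= ?expr0 ?expr1 ?sqrrN ?expr1n; ring.
have nE S : n S - n (~: S) = \sum_(a <- A) ((a \in S)%:R - (a \in ~: S)%:R).
  by rewrite sumrB !sum_mem_seq.
rewrite (eq_bigr (fun S : {set I} => (f S ([set: I] :\: S) - 1) * (U S * U ([set: I] :\: S)))); last first.
  move=> S _; rewrite -mulr_suml mulrBl /sgn /= expr0 mul1r; congr (_ * _ - _).
  by rewrite /f setTD nE mulr_sumr; apply: eq_bigr => a _; exact: sgnE.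
pose F S S' := (f S S' - 1) * (U S * U S').
have Fs S S' : F S S' = F S' S by rewrite /F /f; ring.
have Fp S : S \subset [set: I] -> (v \in S) = (v \in [set: I] :\: S) ->
    F S ([set: I] :\: S) = 0.
  by rewrite !inE; case: (v \in S).
rewrite -(@pmulr_rge0 _ (2^-1))// -(sum_subset_half Fs Fp).
rewrite (eq_bigr (fun S => \sum_(W : {set I} | W \subset S)
    (k v C W * (n W + n (S :\: W) - n ([set: I] :\: S) - 1) *
      (U (S :\: W) * U ([set: I] :\: S))))); last first.
    move=> S _; have [vS|vS] := boolP (v \in S); last first.
      rewrite mul0r big1// => W WS; rewrite k_root ?mul0r//.
      by apply: contra vS; apply/fintype.subsetP.
    rewrite mul1r /F {1}/U (k_dec v)// mulr_suml mulr_sumr; apply: eq_bigr => W WS.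
    by rewrite /f !inE vS /= {1}/n (count_setD _ WS) natrD -/(n _) -/(n _) -/(U _); ring.
  rewrite (sum_subsetA (fun W S' S'' => k v C W * (n W + n S' - n S'' - 1) * (U S' * U S''))).
  apply: sumr_ge0 => W _.
  rewrite (eq_bigr (fun S' => k v C W * (n W - 1) * (U S' * U ([set: I] :\: W :\: S')) +
    (n S' - n ([set: I] :\: W :\: S')) * (k v C W * (U S' * U ([set: I] :\: W :\: S'))))); last first.
    by move=> S' _; ring.
  rewrite big_split /= (@sum_subset_antisym _ _ (fun S' S'' => (n S' - n S'') * (k v C W * (U S' * U S'')))) ?addr0; last first.
    by move=> S S'; ring.
  (* Only the term n W - 1 is left. *)
  apply: sumr_ge0 => S _; apply: mulr_ge0; last by rewrite mulr_ge0// dmoment_ge0// nng_dbl.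
  have [vW|/k_root->] := boolP (v \in W); last by rewrite mul0r.
  have [oC|e] := boolP (odd (count (mem W) C)); first by rewrite k_odd// mul0r.
  rewrite mulr_ge0// subr_ge0 /n ler1n lt0n.
  by apply: contra e => /eqP hW; rewrite /C /= vW hW.
Qed.
End FiniteInequalities.

Section ListInequalities.
Context {R : realType} {W : choiceType}.
Implicit Types (A B : seq W) (E : seq (W * W * R)) (x y v : W) (t : R).

(** Finitely many points occur in [E] and [A], so that correlation inequalities
    only need a proof on finite types. *)
Lemma fintype_lift E A : exists (I : finType) (f : I -> W)
    (E' : seq (I * I * R)) (A' : seq I),
  [/\ injective f, E = [seq (f e.1.1, f e.1.2, e.2) | e <- E'] & A = map f A'].
Proof.
pose s := A ++ flatten [seq [:: e.1.1; e.1.2] | e <- E].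
have lA B : {subset B <= s} -> exists B' : seq (seq_sub s), B = map val B'.
  elim: B => [|b B IH] h; first by exists [::].
  have [|B' ->] := IH; first by move=> z zB; apply: h; rewrite inE zB orbT.
  by exists (SeqSub (h b (mem_head _ _)) :: B').
have lE E1 : {subset flatten [seq [:: e.1.1; e.1.2] | e <- E1] <= s} ->
    exists E' : seq (seq_sub s * seq_sub s * R),
      E1 = [seq (val e.1.1, val e.1.2, e.2) | e <- E'].
  elim: E1 => [|[[x y] t] E1 IH]/= h; first by exists [::].
  have [|E' ->] := IH; first by move=> z zB; apply: h; rewrite !inE zB !orbT.
  have hx : x \in s by apply: h; rewrite !inE eqxx.
  have hy : y \in s by apply: h; rewrite !inE eqxx orbT.
  by exists ((SeqSub hx, SeqSub hy, t) :: E').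
have [|A' eA] := lA A; first by move=> z zA; rewrite mem_cat zA.
have [|E' eE] := lE E; first by move=> z zA; rewrite mem_cat zA orbT.
by exists (seq_sub s), val, E', A'; split => //; exact: val_inj.
Qed.

Lemma gks2 E A B : nng E -> moment E A * moment E B <= moment E (A ++ B) * moment E [::].
Proof.
have [I [f [E' [C' [fI -> e]]]]] := fintype_lift E (A ++ B) => E0.
have eA : A = map f (take (size A) C') by rewrite map_take -e take_size_cat.
have eB : B = map f (drop (size A) C') by rewrite map_drop -e drop_size_cat.
rewrite eA eB -map_cat -[[::]]/(map f [::]) !moment_map//; apply: gks2_fin.
by move: E0; rewrite /nng all_map.
Qed.

Lemma newman E v A : nng E ->
  moment E (v :: A) * moment E [::] <= \sum_(a <- A) moment E [:: v; a] * moment E (a :: A).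
Proof.
have [I [f [E' [A' [fI -> e]]]]] := fintype_lift E (v :: A).
case: A' e => [//|v' A'] [-> ->] E0.
rewrite big_map; set E'' := map _ E'.
have h1 (B : seq I) : moment E'' (map f B) = moment E' B by exact: moment_map.
have h2 a (B : seq I) : moment E'' (f a :: map f B) = moment E' (a :: B) by exact: (h1 (a :: B)).
under eq_bigr do rewrite (h2 _ A') (h2 v' [:: _]).
rewrite h2 (h1 [::]); apply: newman_fin; move: E0; by rewrite /nng all_map.
Qed.

(** Iterating the linearity of [moment] in the edges of [E1] reduces the inequality
    to Newman's for [E0]; opening an edge [(x, y)] inserts the two spins [x], [y]
    into the source set, which accounts for the boundary terms. *)
Lemma lieb E0 E1 v A : nng E0 -> nng E1 ->
  moment E0 [::] * moment (E1 ++ E0) (v :: A) <=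
  \sum_(a <- A) moment E0 [:: v; a] * moment (E1 ++ E0) (a :: A) +
  \sum_(e <- E1) e.2 * (moment E0 [:: v; e.1.1] * moment (E1 ++ E0) (e.1.2 :: A) +
                        moment E0 [:: v; e.1.2] * moment (E1 ++ E0) (e.1.1 :: A)).
Proof.
move=> E0_ge0; elim: E1 A => [|[[x y] t] E1 IH] A /=.
  by move=> _; rewrite big_nil addr0 mulrC newman.
move=> /andP[t0 E1_ge0].
have E_ge0 : nng (E1 ++ E0) by rewrite nng_cat E1_ge0.
set E := E1 ++ E0 in IH E_ge0 *.
rewrite big_cons /=.
have h1 := IH A E1_ge0; have h2 := IH [:: x, y & A] E1_ge0.
have e1 : moment E [:: x, y, v & A] = moment E [:: v, x, y & A] by apply: eq_parity_moment; eq_parity_tac.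
have e2 : moment E [:: x, x, y & A] = moment E (y :: A) by apply: eq_parity_moment; eq_parity_tac.
have e3 : moment E [:: y, x, y & A] = moment E (x :: A) by apply: eq_parity_moment; eq_parity_tac.
have e4 a : moment E [:: a, x, y & A] = moment E [:: x, y, a & A] by apply: eq_parity_moment; eq_parity_tac.
move: h2; rewrite !big_cons e2 e3.
under eq_bigr do rewrite e4.
under [X in _ <= _ + X -> _]eq_bigr do rewrite !e4.
rewrite e1 => h2.
have c0 := ltW (ch_gt0 t); have s0 := sh_ge0 t0; have st := sh_le_mul_ch t0.
have idn (p q r s z w w' : R) :
    p * (q * (ch t * r + sh t * s) + z * (ch t * w + sh t * w')) =
    ch t * (p * (q * r + z * w)) + sh t * (p * (q * s + z * w')) by ring.
under eq_bigr do rewrite mulrDr (mulrCA _ (ch t)) (mulrCA _ (sh t)).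
under [X in _ <= _ + (_ + X)]eq_bigr do rewrite idn.
rewrite !big_split /= -!mulr_sumr.
have g0 B : 0 <= moment E0 B by exact: moment_ge0.
have g1 B : 0 <= moment E B by exact: moment_ge0.
set p := moment E0 [:: v; x] in h2 *; set q := moment E0 [:: v; y] in h2 *.
have p0 : 0 <= p := g0 _; have q0 : 0 <= q := g0 _.
(* The terms with a repeated source have no factor t; they are absorbed by the
   new boundary terms through sh t <= t * ch t. *)
have k1 : sh t * (p * moment E (y :: A)) <= t * (p * (ch t * moment E (y :: A) + sh t * moment E [:: x, y, y & A])).
  have : sh t * (p * moment E (y :: A)) <= t * ch t * (p * moment E (y :: A)) by exact: (ler_wpM2r (mulr_ge0 p0 (g1 _))).
  have : 0 <= t * (p * (sh t * moment E [:: x, y, y & A])) := mulr_ge0 t0 (mulr_ge0 p0 (mulr_ge0 s0 (g1 _))).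
  by rewrite !mulrDr; lra.
have k2 : sh t * (q * moment E (x :: A)) <= t * (q * (ch t * moment E (x :: A) + sh t * moment E [:: x, y, x & A])).
  have : sh t * (q * moment E (x :: A)) <= t * ch t * (q * moment E (x :: A)) by exact: (ler_wpM2r (mulr_ge0 q0 (g1 _))).
  have : 0 <= t * (q * (sh t * moment E [:: x, y, x & A])) := mulr_ge0 t0 (mulr_ge0 q0 (mulr_ge0 s0 (g1 _))).
  by rewrite !mulrDr; lra.
have {}h1 := ler_wpM2l c0 h1; have {}h2 := ler_wpM2l s0 h2.
move: h1 h2; rewrite !mulrDr; lra.
Qed.

Definition cor E A : R := moment E A / moment E [::].

Lemma cor_ge0 E A : nng E -> 0 <= cor E A.
Proof. by move=> h; rewrite divr_ge0 ?moment_ge0. Qed.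

Lemma eq_parity_cor E A B : eq_parity A B -> cor E A = cor E B.
Proof. by move=> AB; rewrite /cor (eq_parity_moment _ AB). Qed.

Lemma cor_perm E E' A : perm_eq E E' -> cor E A = cor E' A.
Proof. by move=> EE; rewrite /cor !(moment_perm EE). Qed.

Lemma cor_nil E : nng E -> cor E [::] = 1.
Proof. by move=> h; rewrite /cor divff// gt_eqF ?moment_gt0. Qed.

Lemma cor_xx E x : nng E -> cor E [:: x; x] = 1.
Proof. by move=> h; rewrite (@eq_parity_cor _ _ [::]) ?cor_nil//; eq_parity_tac. Qed.

Lemma cor_gks2 E A B : nng E -> cor E A * cor E B <= cor E (A ++ B).
Proof.
move=> h; have p := moment_gt0 h; rewrite /cor mulrACA -invfM ler_pdivrMr ?mulr_gt0//.
by rewrite mulrA divfK ?gt_eqF// gks2.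
Qed.

Lemma cor_le1 E A : nng E -> cor E A <= 1.
Proof.
move=> h; have := cor_gks2 A A h; rewrite (@eq_parity_cor _ (A ++ A) [::]) ?cor_nil//.
  by have := cor_ge0 A h; nra.
by move=> z; rewrite count_cat addnn odd_double.
Qed.

Lemma le_cor_cat E1 E A : nng E1 -> nng E -> cor E A <= cor (E1 ++ E) A.
Proof.
elim: E1 => //= -[[x y] t] E1 IH /andP[/= t0 E1_ge0] E_ge0.
apply: le_trans (IH E1_ge0 E_ge0) _.
have {IH}h : nng (E1 ++ E) by rewrite nng_cat E1_ge0.
have p := moment_gt0 h; have c0 := ch_gt0 t; have s0 := sh_ge0 t0.
have p' : 0 < moment ((x, y, t) :: E1 ++ E) [::] by apply: moment_gt0; rewrite /= t0.
rewrite /cor ler_pdivlMr// mulrAC ler_pdivrMr//=.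
have := ler_wpM2l s0 (@gks2 _ [:: x; y] A h).
by nra.
Qed.

Lemma moment_addw (T : Type) (f : T -> W * W) (a b : T -> R) (s : seq T) E A :
  moment ([seq (f i, a i + b i) | i <- s] ++ E) A =
  moment ([seq (f i, a i) | i <- s] ++ [seq (f i, b i) | i <- s] ++ E) A.
Proof.
elim: s A => [//|i s IH] A.
transitivity (moment ((f i, a i) :: (f i, b i) :: [seq (f i, a i) | i <- s] ++ [seq (f i, b i) | i <- s] ++ E) A).
  rewrite !cat_cons; case: (f i) => x y /=; rewrite !IH.
  set E' := _ ++ _; rewrite (@eq_parity_moment _ _ E' [:: x, y, x, y & A] A); last by eq_parity_tac.
  by rewrite /ch /sh !opprD !expRD; field.
apply: moment_perm; rewrite /= perm_cons perm_sym.
by apply/permPl; exact: (perm_catCA _ [:: (f i, b i)]).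
Qed.
End ListInequalities.

(** * Expansion around the cluster of the ghost *)

Section GhostExpansion.
Import boot.finset.
Context {R : realType} {I : finType}.
Implicit Types (A B C D X Y : seq I) (S T W : {set I}).
Variable E : seq (I * I * R).
Hypothesis E_ge0 : nng E.
Variable k : I -> seq I -> {set I} -> R.
Hypothesis kE : cluster_weight (dbl E) k.

Local Notation U := (dmoment (dbl E)).

Definition self_conv C T := \sum_(S : {set I} | S \subset T) U C S * U C (T :\: S).

Lemma self_convE C T : {subset C <= T} -> self_conv C T = 2 ^+ #|T| * (rmoment E T C * rmoment E T [::]).
Proof.
move=> CT; rewrite duplication ?cats0//.
by apply: eq_bigr => S _; rewrite /sgn /= expr0 mul1r.
Qed.

Lemma self_conv_local C D T :
  (forall x, x \in T -> odd (count_mem x C) = odd (count_mem x D)) ->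
  self_conv C T = self_conv D T.
Proof.
move=> CD; apply: eq_bigr => S ST; congr (_ * _); apply: dmoment_local => x.
  by move=> xS; apply: CD; apply: (fintype.subsetP ST).
by rewrite inE => /andP[_ xT]; apply: CD.
Qed.

Definition all_in X S := all (fun x => x \in S) X.
Definition all_out Y S := all (fun x => x \notin S) Y.

(** Expand the side of [r] over the cluster [W] of [r]. By the first hypothesis
    [W] contains [X] as soon as it avoids [Y], so the constraint on [X] no
    longer concerns the remaining sites; by the second, exactly one of the two
    sides of the remaining sites avoids [Y], whence the factor 1/2. *)
Lemma sum_root r C X Y :
  (forall W, r \in W -> all_out Y W -> ~~ odd (count (mem W) C) -> all_in X W) ->
  (forall S, r \notin S -> all_out X S -> ~~ odd (count (mem S) C) ->
     all_in Y S || all_out Y S) ->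
  Y != [::] ->
  \sum_(S : {set I} | S \subset [set: I])
    [&& r \in S, all_in X S & all_out Y S]%:R * (U C S * U C ([set: I] :\: S)) =
  2^-1 * \sum_(W : {set I} | W \subset [set: I])
    [&& r \in W, all_in X W & all_out Y W]%:R * (k r C W * self_conv C ([set: I] :\: W)).
Proof.
move=> hX hY Y0; have [k_ge0 k_root k_odd k_loc k_dec] := kE.
set T := [set: I].
(* The indicator of the event for the side S, written on the cluster W and the
   rest of the side. *)
pose ind W S : R := [&& (r \in W), all (fun x => (x \in W) || (x \in S)) X
                     & all (fun x => (x \notin W) && (x \notin S)) Y]%:R.
rewrite (eq_bigr (fun S => \sum_(W : {set I} | W \subset S)
  ind W (S :\: W) * (k r C W * (U C (S :\: W) * U C (T :\: S))))); last first.
  move=> S ST; have [rS|rS] := boolP (r \in S); last first.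
    rewrite mul0r big1// => W WS; rewrite k_root ?mul0r ?mulr0//.
    by apply: contra rS; apply: (fintype.subsetP WS).
  rewrite (k_dec r)// mulr_suml mulr_sumr; apply: eq_bigr => W WS.
  have [rW|rW] := boolP (r \in W); last by rewrite k_root// !(mul0r,mulr0).
  rewrite !mulrA; do 3 congr (_ * _); rewrite /ind rW /=.
  congr ((_ && _)%:R); apply: eq_all => x; rewrite inE;
    by have := fintype.subsetP WS x; case: (x \in W) => //= ->.
rewrite (sum_subsetA (fun W S S' => ind W S * (k r C W * (U C S * U C S')))).
rewrite mulr_sumr; apply: eq_bigr => W _.
have [rW|rW] := boolP (r \in W); last first.
  by rewrite k_root// !(mul0r,mulr0) big1// => S _; rewrite !(mul0r,mulr0).
have [oW|eW] := boolP (odd (count (mem W) C)).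
  by rewrite k_odd// !(mul0r,mulr0) big1// => S _; rewrite !(mul0r,mulr0).
have [YW|YW] := boolP (all_out Y W); last first.
  rewrite !andbF mul0r mulr0 big1// => S _; rewrite /ind.
  have [h|] := boolP (all _ Y); last by rewrite !andbF mul0r.
  by case/negP: YW; apply: sub_all h => x /andP[].
have XW := hX W rW YW eW; rewrite XW mul1r.
have pI S : S \subset T :\: W -> ind W S = (all_out Y S)%:R.
  move=> SW; rewrite /ind rW /=.
  have -> : all (fun x => (x \in W) || (x \in S)) X.
    by apply: sub_all XW => x ->.
  congr ((nat_of_bool _)%:R); apply/idP/idP => [|h]; first by apply: sub_all => x /andP[].
  apply/allP => x xY; by rewrite (allP YW x xY) (allP h x xY).
have Fs S S' : U C S * U C S' = U C S' * U C S by rewrite mulrC.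
have Fp S : S \subset T :\: W -> all_out Y S = all_out Y (T :\: W :\: S) ->
    U C S * U C (T :\: W :\: S) = 0.
  move=> SW ee; have [oS|eS] := boolP (odd (count (mem S) C)).
    by rewrite dmoment_odd// mul0r.
  exfalso; have hW x : x \in S -> x \notin W.
    by move=> /(fintype.subsetP SW); rewrite inE => /andP[].
  have rS : r \notin S by apply: contraL rW; apply: hW.
  have XS : all_out X S by apply: sub_all XW => x; apply: contraL; apply: hW.
  have := hY S rS XS eS; case/orP => h; move: ee.
    have -> : all_out Y S = false.
      by case: (Y) Y0 h => //= y Y' _ /andP[-> _].
    move/esym/negbT; rewrite -has_predC => /hasP[x xY /=].
    by rewrite !inE (allP h x xY).
  rewrite h => /esym; case: (Y) Y0 YW h => //= y Y' _ /andP[yW _] /andP[yS _].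
  by rewrite /all_out /= !inE yW yS.
rewrite mulrCA -(sum_subset_half (p := all_out Y) Fs Fp) mulr_sumr.
by apply: eq_bigr => S SW; rewrite pI// mulrCA.
Qed.

Variables o g : I.
Local Notation T := [set: I].

Lemma UU_odd C S : odd (count (mem S) C) -> U C S * U C (T :\: S) = 0.
Proof. by move=> h; rewrite dmoment_odd ?mul0r. Qed.

(** Weight of the event that [o] and [x] lie on the side opposite to the ghost
    [g]; up to a factor it is the truncated correlation of [o] and [x]. *)
Definition trunc_sum x := \sum_(S : {set I} | S \subset T)
  [&& o \in S, all_in [:: x] S & all_out [:: g] S]%:R *
    (U [:: o; x] S * U [:: o; x] (T :\: S)).

(** Weight of the event that [o] and [x] lie on one side, [g] and [y] on the
    other. Then opening the bond [(x, y)] joins [o] to the ghost. *)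
Definition pivot_sum x y := \sum_(S : {set I} | S \subset T)
  [&& o \in S, all_in [:: x] S & all_out [:: g; y] S]%:R *
    (U [:: o; g; x; y] S * U [:: o; g; x; y] (T :\: S)).

Lemma trunc_sumE x :
  2 ^+ #|I| * (moment E [:: o; x] * moment E [::] - moment E [:: o; g] * moment E [:: x; g]) =
  4 * trunc_sum x.
Proof.
rewrite mulrBr (@duplicationT _ _ E [:: o; x] [::] [:: o; x])//.
rewrite (@duplicationT _ _ E [:: o; g] [:: x; g] [:: o; x]); last by eq_parity_tac.
pose p S := [&& o \in S, all_in [:: x] S & all_out [:: g] S].
rewrite -sumrB (_ : 4 * trunc_sum x = 2 * trunc_sum x + 2 * trunc_sum x); last by ring.
rewrite {2}/trunc_sum (sum_subsetC (fun S S' => (p S)%:R * (U [:: o; x] S * U [:: o; x] S'))).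
rewrite !mulr_sumr -big_split /=; apply: eq_bigr => S _.
have := @UU_odd [:: o; x] S; rewrite [X in _ = _ + 2 * (_ * X)]mulrC /p /sgn /= !inE.
move: (_ * _) => q; rewrite !(andbT, addn0, expr0).
case: (o \in S); case: (x \in S); case: (g \in S) => /= h; try rewrite (h isT); rewrite ?exprD ?expr1 ?expr0; ring.
Qed.

Lemma pivot_sumE x y :
  2 ^+ #|I| * (moment E [:: o; g; x; y] * moment E [::] - moment E [:: o; g] * moment E [:: x; y]) =
  4 * (pivot_sum x y + pivot_sum y x).
Proof.
set C := [:: o; g; x; y].
rewrite mulrBr (@duplicationT _ _ E C [::] C)// (@duplicationT _ _ E [:: o; g] [:: x; y] C)//.
have yx : pivot_sum y x = \sum_(S : {set I} | S \subset T)
    [&& o \in S, all_in [:: y] S & all_out [:: g; x] S]%:R * (U C S * U C (T :\: S)).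
  by apply: eq_bigr => S _; rewrite !(@eq_parity_dmoment _ _ _ [:: o; g; y; x] C)//; eq_parity_tac.
pose p a b S := [&& o \in S, all_in [:: a] S & all_out [:: g; b] S].
rewrite -sumrB (_ : 4 * (pivot_sum x y + pivot_sum y x) =
  2 * pivot_sum x y + 2 * pivot_sum x y + (2 * pivot_sum y x + 2 * pivot_sum y x)); last by ring.
rewrite yx {2}/pivot_sum (sum_subsetC (fun S S' => (p x y S)%:R * (U C S * U C S'))).
rewrite [X in _ = _ + (_ + 2 * X)](sum_subsetC (fun S S' => (p y x S)%:R * (U C S * U C S'))).
rewrite !mulr_sumr -!big_split /=; apply: eq_bigr => S _.
have := @UU_odd C S; rewrite (mulrC (U C (T :\: S)) (U C S)) /p /sgn /= !inE.
move: (_ * _) => q; rewrite !(andbT, addn0, expr0).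
by case: (o \in S); case: (x \in S); case: (g \in S); case: (y \in S) => /= h; try rewrite (h isT);
  rewrite ?exprD ?expr1 ?expr0; ring.
Qed.

Lemma trunc_sum_root x : trunc_sum x =
  2^-1 * \sum_(W : {set I} | W \subset T)
    [&& o \in W, all_in [:: x] W & all_out [:: g] W]%:R *
      (k o [:: o; x] W * self_conv [:: o; x] (T :\: W)).
Proof.
apply: sum_root => // [W|S]; rewrite /all_in /all_out /=.
  by case: (o \in W); case: (x \in W); case: (g \in W).
by case: (o \in S); case: (x \in S); case: (g \in S).
Qed.

Lemma pivot_sum_root x y : pivot_sum x y =
  2^-1 * \sum_(W : {set I} | W \subset T)
    [&& o \in W, all_in [:: x] W & all_out [:: g; y] W]%:R *
      (k o [:: o; g; x; y] W * self_conv [:: o; g; x; y] (T :\: W)).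
Proof.
apply: sum_root => // [W|S]; rewrite /all_in /all_out /=.
  by case: (o \in W); case: (x \in W); case: (g \in W); case: (y \in W).
by case: (o \in S); case: (x \in S); case: (g \in S); case: (y \in S).
Qed.

(** Here the expansion is over the cluster of the ghost, and [o] and [x] are
    correlated in its complement, where there is no field. *)
Lemma trunc_sum_ghost x : trunc_sum x =
  2^-1 * \sum_(W : {set I} | W \subset T)
    [&& g \in W, o \notin W & x \notin W]%:R *
      (k g [::] W * self_conv [:: o; x] (T :\: W)).
Proof.
have [_ _ _ k_loc _] := kE.
pose p S := [&& o \in S, all_in [:: x] S & all_out [:: g] S].
rewrite /trunc_sum (sum_subsetC (fun S S' => (p S)%:R * (U [:: o; x] S * U [:: o; x] S'))).
transitivity (\sum_(S : {set I} | S \subset T)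
    [&& g \in S, all_in [::] S & all_out [:: o; x] S]%:R *
      (U [:: o; x] S * U [:: o; x] (T :\: S))).
  apply: eq_bigr => S _; rewrite [U _ _ * _]mulrC; congr ((nat_of_bool _)%:R * _).
  rewrite /p /all_in /all_out /= !inE !andbT negbK.
  by case: (o \in S); case: (x \in S); case: (g \in S).
rewrite (@sum_root g [:: o; x] [::] [:: o; x])//; last first.
  move=> S; rewrite /all_in /all_out /=.
  by case: (o \in S); case: (x \in S); case: (g \in S).
congr (_ * _); apply: eq_bigr => W _; rewrite /all_in /all_out /= andbT.
case: (boolP (g \in W)) => gW; last by rewrite !mul0r.
case: (boolP (o \in W)) => oW; first by rewrite !mul0r.
case: (boolP (x \in W)) => xW; first by rewrite !mul0r.
rewrite (k_loc g [:: o; x] [::])// => z zW /=.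
have /negbTE -> : o != z by apply: contraNneq oW => ->.
by have /negbTE -> : x != z by apply: contraNneq xW => ->.
Qed.

Lemma mem_setD_nat S W z : W \subset S ->
  (z \in S)%:R = (z \in W)%:R + (z \in S :\: W)%:R :> R.
Proof.
move=> WS; rewrite inE; have := fintype.subsetP WS z.
by case: (z \in W) => /= [->//|_]; rewrite ?addr0 ?add0r.
Qed.

(** Once the cluster of [o] is removed, no source remains on either side. *)
Lemma self_conv_root T' x : o \in T' -> x \in T' ->
  \sum_(W : {set I} | W \subset T') [&& o \in W & x \in W]%:R *
     (k o [:: o; x] W * self_conv [::] (T' :\: W)) = 2^-1 * self_conv [:: o; x] T'.
Proof.
move=> oT xT; have [_ k_root k_odd _ k_dec] := kE.
pose F S S' := U [:: o; x] S * U [:: o; x] S'.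
have Fs S S' : F S S' = F S' S by rewrite /F mulrC.
have Fp S : S \subset T' -> (o \in S) = (o \in T' :\: S) -> F S (T' :\: S) = 0.
  by rewrite inE oT andbT; case: (o \in S).
rewrite {2}/self_conv -(sum_subset_half Fs Fp).
rewrite [RHS](eq_bigr (fun S => \sum_(W : {set I} | W \subset S)
  k o [:: o; x] W * (U [:: o; x] (S :\: W) * U [:: o; x] (T' :\: S)))) => [|S _]; last first.
  have [oS|oS] := boolP (o \in S); last first.
    rewrite mul0r big1// => W WS; rewrite k_root ?mul0r//.
    by apply: contra oS; apply: (fintype.subsetP WS).
  by rewrite mul1r /F {1}(k_dec o)// mulr_suml; apply: eq_bigr => W WS; rewrite mulrA.
rewrite [RHS](sum_subsetA (fun W S S' => k o [:: o; x] W * (U [:: o; x] S * U [:: o; x] S'))).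
apply: eq_bigr => W _; rewrite -mulr_sumr -/(self_conv [:: o; x] _).
have [oW|oW] := boolP (o \in W); last by rewrite k_root// !(mul0r,mulr0).
have [xW|xW] := boolP (x \in W); last first.
  by rewrite k_odd ?(mul0r,mulr0)//= oW (negbTE xW).
rewrite mul1r; congr (_ * _); apply: self_conv_local => z; rewrite inE => /andP[zW _] /=.
have /negbTE -> : o != z by apply: contraNneq zW => <-.
by have /negbTE -> : x != z by apply: contraNneq zW => <-.
Qed.

(** The square of the correlation, unlike the correlation itself, is the weight
    of the event that [y] belongs to the cluster of [g]: after duplication all
    four sources cancel in pairs. *)
Lemma ghost_sq T' y : g \in T' -> y \in T' ->
  2 ^+ #|T'| * (rmoment E T' [:: g; y] * rmoment E T' [:: g; y]) =
  2 * \sum_(W : {set I} | W \subset T') [&& g \in W & y \in W]%:R *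
     (k g [::] W * self_conv [::] (T' :\: W)).
Proof.
move=> gT yT; have [_ k_root _ _ k_dec] := kE.
have sT : {subset [:: g; y] <= T'} by move=> z; rewrite !inE => /orP[]/eqP->.
rewrite duplication//.
pose F S S' := ((g \in S)%:R - (g \in S')%:R) * (((y \in S)%:R - (y \in S')%:R) *
  (U [::] S * U [::] S')).
have Fs S S' : F S S' = F S' S by rewrite /F; ring.
have Fp S : S \subset T' -> (g \in S) = (g \in T' :\: S) -> F S (T' :\: S) = 0.
  by rewrite inE gT andbT; case: (g \in S).
rewrite (eq_bigr (fun S => F S (T' :\: S))) => [|S ST]; last first.
  rewrite !(@eq_parity_dmoment _ _ _ _ [::])//; [|by eq_parity_tac..].
  rewrite /F /sgn /= addn0 !inE gT yT !andbT [RHS]mulrA; congr (_ * _).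
  by case: (g \in S); case: (y \in S); rewrite /= ?exprD ?expr0 ?expr1; ring.
rewrite -[LHS](@mulVKf _ 2)//; congr (_ * _).
rewrite -(sum_subset_half Fs Fp).
pose m z S : R := (z \in S)%:R.
rewrite [LHS](eq_bigr (fun S => \sum_(W : {set I} | W \subset S)
  (k g [::] W * (m y W + m y (S :\: W) - m y (T' :\: S)) *
    (U [::] (S :\: W) * U [::] (T' :\: S))))) => [|S ST]; last first.
  have [gS|gS] := boolP (g \in S); last first.
    rewrite mul0r big1// => W WS; rewrite k_root ?mul0r//.
    by apply: contra gS; apply: (fintype.subsetP WS).
  rewrite mul1r /F {1}(k_dec g)// mulr_suml !mulr_sumr; apply: eq_bigr => W WS.
  by rewrite inE gS /= (mem_setD_nat y WS) -/(m _ _) -/(m _ _) -/(m _ _); ring.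
rewrite (sum_subsetA (fun W S' S'' => k g [::] W * (m y W + m y S' - m y S'') * (U [::] S' * U [::] S''))).
apply: eq_bigr => W _.
rewrite (eq_bigr (fun S' => k g [::] W * m y W * (U [::] S' * U [::] (T' :\: W :\: S')) +
    (m y S' - m y (T' :\: W :\: S')) * (k g [::] W * (U [::] S' * U [::] (T' :\: W :\: S'))))); last first.
  by move=> S' _; ring.
rewrite big_split /= (@sum_subset_antisym _ _ (fun S' S'' => (m y S' - m y S'') * (k g [::] W * (U [::] S' * U [::] S'')))) ?addr0; last first.
  by move=> S S'; ring.
rewrite -mulr_sumr -/(self_conv [::] _).
have [gW|gW] := boolP (g \in W); last by rewrite k_root// !(mul0r,mulr0).
by rewrite /m /=; ring.
Qed.

Lemma rmoment_le T' A : rmoment E T' A * moment E [::] <= moment E A * rmoment E T' [::].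
Proof.
pose E2 := [seq e <- E | ~~ ((e.1.1 \in T') && (e.1.2 \in T'))].
have pE : perm_eq E (E2 ++ restr (mem T') E).
  by rewrite perm_sym perm_catC perm_filterC.
have h := le_cor_cat A (nng_filter _ E_ge0 : nng E2) (nng_restr (mem T') E_ge0).
move: h; rewrite -(cor_perm _ pE) /cor ler_pdivrMr ?moment_gt0 ?nng_restr// mulrAC.
by rewrite ler_pdivlMr ?moment_gt0.
Qed.

Lemma pivot_sum_rootE x y : pivot_sum x y =
  2^-1 * \sum_(W : {set I} | W \subset T)
    [&& o \in W, all_in [:: x] W & all_out [:: g; y] W]%:R * (k o [:: o; x] W *
     (2 ^+ #|T :\: W| * (rmoment E (T :\: W) [:: g; y] * rmoment E (T :\: W) [::]))).
Proof.
have [_ _ _ k_loc _] := kE.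
rewrite pivot_sum_root; congr (_ * _); apply: eq_bigr => W _.
have [oW|] := boolP (o \in W); last by rewrite !mul0r.
have [xW|] := boolP (all_in [:: x] W); last by rewrite !mul0r.
have [gyW|] := boolP (all_out [:: g; y] W); last by rewrite !mul0r.
move: xW gyW; rewrite /all_in /all_out /= !andbT => xW /andP[gW yW].
rewrite (k_loc o _ [:: o; x]) => [|z zW]; last first.
  have /negbTE hg : g != z by apply: contraNneq gW => ->.
  have /negbTE hy : y != z by apply: contraNneq yW => ->.
  by rewrite /= hg hy !add0n !addn0.
rewrite (@self_conv_local _ [:: g; y]) => [|z]; last first.
  rewrite inE => /andP[zW _].
  have /negbTE ho : o != z by apply: contraNneq zW => <-.
  have /negbTE hx : x != z by apply: contraNneq zW => <-.
  by rewrite /= ho hx !add0n.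
by rewrite self_convE// => z; rewrite !inE => /orP[]/eqP->; rewrite ?gW ?yW.
Qed.

(** In [pivot_sum_rootE] the correlation of [g] and [y] in a region is at most
    the one in the full system. *)
Lemma pivot_sum_le x y :
  moment E [::] * pivot_sum x y <= moment E [:: y; g] * trunc_sum x.
Proof.
have [k_ge0 _ _ _ _] := kE.
rewrite pivot_sum_rootE trunc_sum_root !(mulrCA _ (2^-1)) ler_pM2l//.
rewrite !mulr_sumr; apply: ler_sum => W _.
have [oW|] := boolP (o \in W); last by rewrite !(mul0r, mulr0).
have [xW|] := boolP (all_in [:: x] W); last by rewrite !(mul0r, mulr0).
rewrite /all_out /= andbT; have [gW|] := boolP (g \in W); first by rewrite !(mul0r, mulr0).
rewrite (@self_conv_local _ [::]) => [|z]; last first.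
  move: xW; rewrite /all_in /= andbT => xW; rewrite inE => /andP[zW _].
  have /negbTE ho : o != z by apply: contraNneq zW => <-.
  have /negbTE hx : x != z by apply: contraNneq zW => <-.
  by rewrite /= ho hx.
rewrite self_convE// mul1r (@eq_parity_moment _ _ E [:: y; g] [:: g; y]); last by eq_parity_tac.
set c := 2 ^+ _; have c0 : 0 <= c by rewrite exprn_ge0.
have := rmoment_le (T :\: W) [:: g; y].
set z0 := rmoment E _ [::]; set z1 := rmoment E _ _ => h.
have z00 : 0 <= z0 by rewrite moment_ge0 ?nng_restr.
have k0 := k_ge0 o [:: o; x] W; set kk := k _ _ _ in k0 *.
have gg : 0 <= moment E [:: g; y] by rewrite moment_ge0.
have kc : 0 <= kk * c * z0 by rewrite !mulr_ge0.
case: (y \in W) => /=; last by rewrite mul1r; have := ler_wpM2l kc h; lra.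
by rewrite !(mul0r,mulr0) !mulr_ge0.
Qed.

(** In [pivot_sum_rootE] the correlation of [g] and [y] in a region, multiplied
    by the one in the full system, is at least its own square, which [ghost_sq]
    expands over the cluster of the ghost. Summing first over the cluster of [o]
    gives the left-hand side. *)
Lemma pivot_sum_ge x y :
  moment E [::] * (2^-1 * \sum_(W : {set I} | W \subset T)
    [&& g \in W, y \in W, o \notin W & x \notin W]%:R *
      (k g [::] W * self_conv [:: o; x] (T :\: W))) <=
  moment E [:: y; g] * pivot_sum x y.
Proof.
have [k_ge0 _ _ _ _] := kE.
pose a W1 : R := [&& o \in W1 & x \in W1]%:R.
pose b W2 : R := [&& g \in W2 & y \in W2]%:R.
pose F W1 W2 S := (a W1 * k o [:: o; x] W1) * (b W2 * (k g [::] W2 * self_conv [::] S)).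
have -> : 2^-1 * \sum_(W : {set I} | W \subset T)
    [&& g \in W, y \in W, o \notin W & x \notin W]%:R *
      (k g [::] W * self_conv [:: o; x] (T :\: W)) =
    \sum_(W2 : {set I} | W2 \subset T) \sum_(W1 : {set I} | W1 \subset T :\: W2)
      F W1 W2 (T :\: W2 :\: W1).
  rewrite mulr_sumr; apply: eq_bigr => W2 _; rewrite /F.
  have [oW|oW] := boolP (o \in W2).
    rewrite !andbF mul0r mulr0 big1// => W1 W1W.
    have -> : a W1 = 0; last by rewrite !mul0r.
    rewrite /a; have [oW1|] := boolP (o \in W1) => //.
    by have := fintype.subsetP W1W _ oW1; rewrite inE oW.
  have [xW|xW] := boolP (x \in W2).
    rewrite !andbF mul0r mulr0 big1// => W1 W1W.
    have -> : a W1 = 0; last by rewrite !mul0r.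
    rewrite /a; have [xW1|] := boolP (x \in W1); last by rewrite andbF.
    by have := fintype.subsetP W1W _ xW1; rewrite inE xW.
  rewrite !andbT -/(b W2).
  rewrite (eq_bigr (fun W1 => (b W2 * k g [::] W2) * (a W1 * (k o [:: o; x] W1 *
    self_conv [::] (T :\: W2 :\: W1))))) => [|W1 _]; last by ring.
  by rewrite -mulr_sumr self_conv_root ?inE ?oW ?xW//; ring.
rewrite -sum_subsetAC pivot_sum_rootE mulrCA !mulr_sumr.
apply: ler_sum => W _.
rewrite (_ : [&& o \in W, all_in [:: x] W & all_out [:: g; y] W]%:R = a W * [&& g \notin W & y \notin W]%:R); last first.
  by rewrite /a /all_in /all_out /= !andbT -natrM mulnb andbA.
have [/andP[gW yW]|gyW] := boolP ((g \notin W) && (y \notin W)); last first.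
  rewrite !(mulr0, mul0r) big1 ?mulr0// => W2 W2W; rewrite /F.
  have -> : b W2 = 0; last by rewrite !(mul0r, mulr0).
  rewrite /b; case: (boolP (_ && _)) => // /andP[gW2 yW2].
  move: gyW; have := fintype.subsetP W2W _ gW2; have := fintype.subsetP W2W _ yW2.
  by rewrite !inE !andbT => -> ->.
have := ghost_sq (T' := T :\: W) (y := y).
rewrite !inE gW yW => /(_ isT isT) sq.
rewrite /F -mulr_sumr.
have e : \sum_(W2 : {set I} | W2 \subset T :\: W) b W2 * (k g [::] W2 * self_conv [::] (T :\: W :\: W2)) =
   2^-1 * (2 ^+ #|T :\: W| * (rmoment E (T :\: W) [:: g; y] * rmoment E (T :\: W) [:: g; y])).
  by rewrite sq mulKf.
rewrite e (@eq_parity_moment _ _ E [:: y; g] [:: g; y]); last by eq_parity_tac.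
set c := 2 ^+ _; have c0 : 0 <= c by rewrite exprn_ge0.
have := rmoment_le (T :\: W) [:: g; y].
set z0 := rmoment E _ [::]; set z1 := rmoment E _ _ => h.
have z10 : 0 <= z1 by rewrite moment_ge0 ?nng_restr.
have k0 := k_ge0 o [:: o; x] W; set kk := k _ _ _ in k0 *.
have a0 : 0 <= a W by rewrite /a ler0n.
have kc : 0 <= a W * kk * c * z1 by rewrite !mulr_ge0.
rewrite mulr1n; have := ler_wpM2l kc h; lra.
Qed.
End GhostExpansion.

Section GhostTheorem.
Import boot.finset.
Context {R : realType} {I : finType}.
Variable E : seq (I * I * R).
Hypothesis E_ge0 : nng E.

(** [p T] is the normalized weight of the event that the complement of the
    cluster of the ghost is [T], and [P x y] that of the event described at
    [pivot_sum]. For [x = o] the third property gives the total mass of [p]; the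
    fourth one expresses the derivative of the magnetization in the bond [(x,
    y)], and the last one compares it with the bonds that leave [T]. *)
Lemma ghost_expansion (o g : I) : exists (p : {set I} -> R) (P : I -> I -> R),
  [/\ forall T, 0 <= p T,
      forall x y, 0 <= P x y,
      forall x, cor E [:: o; x] - cor E [:: o; g] * cor E [:: x; g] =
        \sum_(T : {set I} | [&& g \notin T, o \in T & x \in T])
          p T * cor (restr (mem T) E) [:: o; x],
      forall x y, cor E [:: o; g; x; y] - cor E [:: o; g] * cor E [:: x; y] =
        P x y + P y x &
      forall x y, \sum_(T : {set I} | [&& g \notin T, y \notin T, o \in T & x \in T])
          p T * cor (restr (mem T) E) [:: o; x] <= cor E [:: y; g] * P x y /\
        P x y <= cor E [:: y; g] *
          (cor E [:: o; x] - cor E [:: o; g] * cor E [:: x; g])].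
Proof.
have [k kE] := cluster_weight_exists (nng_dbl E_ge0).
have [k_ge0 _ _ _ _] := kE.
pose Z := moment E [::]; have Z0 : 0 < Z by exact: moment_gt0.
pose N : R := 2 ^+ #|I|; have N0 : 0 < N by rewrite exprn_gt0.
pose c := 4 / (N * Z ^+ 2); have c0 : 0 < c by rewrite divr_gt0// mulr_gt0// exprn_gt0.
pose p T := c * (2^-1 * (k g [::] (~: T) * (2 ^+ #|T| * rmoment E T [::] ^+ 2))).
have Zn := lt0r_neq0 Z0; have Nn := lt0r_neq0 N0.
have dp x (T : {set I}) : o \in T -> x \in T ->
    k g [::] (~: T) * self_conv E [:: o; x] ([set: I] :\: ~: T) * (2^-1 * c) =
    p T * cor (restr (mem T) E) [:: o; x].
  move=> oT xT; rewrite setTD setCK self_convE => [|z]; last by rewrite !inE => /orP[]/eqP->.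
  rewrite /p /cor -!/(rmoment E T _); have : rmoment E T [::] != 0.
    by rewrite gt_eqF// moment_gt0// nng_restr.
  move: (rmoment E T [::]) => z z0; by field.
have corE A B : cor E A * cor E B = moment E A * moment E B / Z ^+ 2.
  by rewrite /cor -/Z; field; rewrite ?Zn ?Nn.
have cor1 A : cor E A = moment E A * Z / Z ^+ 2.
  by rewrite /cor -/Z; field; rewrite ?Zn ?Nn.
have tE (x : I) : cor E [:: o; x] - cor E [:: o; g] * cor E [:: x; g] = c * trunc_sum E o g x.
  have h := trunc_sumE E o g x; rewrite corE cor1 -mulrBl -(mulKf (lt0r_neq0 N0) (_ - _)).
  by rewrite -/N in h; rewrite h /c -/Z; field; rewrite ?Zn ?Nn.
have pE (x y : I) : cor E [:: o; g; x; y] - cor E [:: o; g] * cor E [:: x; y] =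
    c * pivot_sum E o g x y + c * pivot_sum E o g y x.
  have h := pivot_sumE E o g x y; rewrite corE cor1 -mulrBl -(mulKf (lt0r_neq0 N0) (_ - _)).
  by rewrite -/N in h; rewrite h /c -/Z; field; rewrite ?Zn ?Nn.
have u0 C S : 0 <= dmoment (dbl E) C S by rewrite dmoment_ge0// nng_dbl.
exists p, (fun x y => c * pivot_sum E o g x y); split.
- move=> T; have z0 : 0 <= rmoment E T [::] by rewrite moment_ge0// nng_restr.
  apply: mulr_ge0; first exact: ltW.
  by do 2!apply: mulr_ge0 => //; apply: mulr_ge0; exact: exprn_ge0.
- move=> x y; apply: mulr_ge0; first exact: ltW.
  by apply: sumr_ge0 => S _; apply: mulr_ge0 => //; exact: mulr_ge0.
- move=> x; rewrite tE (trunc_sum_ghost kE) mulrA mulr_sumr.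
  rewrite (reindex_inj (inv_inj (@setCK I))) /= [RHS]big_mkcond /=.
  apply: eq_big => [T|T _]; first exact: subsetT.
  rewrite !inE !negbK; case: ifP => [/and3P[_ oT xT]|_]; last by rewrite mul0r mulr0.
  by rewrite mul1r -(dp _ _ oT xT); ring.
- exact: pE.
- move=> x y; split.
    have h := pivot_sum_ge E_ge0 kE o g x y.
    have -> : cor E [:: y; g] * (c * pivot_sum E o g x y) =
        c * (Z^-1 * (moment E [:: y; g] * pivot_sum E o g x y)).
      by rewrite /cor -/Z; ring.
    apply: le_trans (ler_wpM2l (ltW c0) (ler_wpM2l _ h)); last by rewrite invr_ge0 ltW.
    rewrite mulKf ?lt0r_neq0// mulrA mulr_sumr.
    rewrite [leRHS](reindex_inj (inv_inj (@setCK I))) /= [leLHS]big_mkcond /=.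
    rewrite le_eqVlt; apply/orP; left; apply/eqP.
    apply: eq_big => [T|T _]; first by rewrite subsetT.
    rewrite !inE !negbK; case: ifP => [/and4P[_ _ oT xT]|_]; last by rewrite mul0r mulr0.
    by rewrite mul1r -(dp _ _ oT xT); ring.
  rewrite tE mulrCA ler_pM2l// (_ : cor E [:: y; g] = moment E [:: y; g] / Z)//.
  by rewrite mulrAC ler_pdivlMr// mulrC (pivot_sum_le E_ge0 kE).
Qed.
End GhostTheorem.

(** * The Ising model as a list of bonds *)

Section IsingList.
Context {R : realType} {V : choiceType}.
Variable J : V -> V -> R.
Implicit Types (s : seq V) (A B : seq (option V)) (b h : R) (x y : V).

(** A volume is described by its ordered pairs of points, so that each bond
    occurs twice, with half of its coupling. *)
Definition halfJ (p : V * V) : R := if p.1 == p.2 then 0 else 2^-1 * J p.1 p.2.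

Definition pairs s : seq (V * V) := [seq (x, y) | x <- s, y <- s].

Definition bonds s b : seq (option V * option V * R) :=
  [seq (Some p.1, Some p.2, b * halfJ p) | p <- pairs s].

Definition fields s h : seq (option V * option V * R) :=
  [seq (Some x, None, h) | x <- s].

Definition ising s b h := bonds s b ++ fields s h.

Hypothesis J_ge0 : forall x y, 0 <= J x y.

Lemma halfJ_ge0 p : 0 <= halfJ p.
Proof. by rewrite /halfJ; case: ifP => // _; rewrite mulr_ge0. Qed.

Lemma nng_bonds s b : 0 <= b -> nng (bonds s b).
Proof.
by move=> b0; rewrite /nng all_map; apply/allP => p _ /=; rewrite mulr_ge0 ?halfJ_ge0.
Qed.

Lemma nng_fields s h : 0 <= h -> nng (fields s h).
Proof. by move=> h0; rewrite /nng all_map; apply/allP. Qed.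

Lemma nng_ising s b h : 0 <= b -> 0 <= h -> nng (ising s b h).
Proof. by move=> b0 h0; rewrite nng_cat nng_bonds// nng_fields. Qed.

Lemma filter_pairs (q : pred V) s :
  [seq p <- pairs s | q p.1 && q p.2] = pairs [seq x <- s | q x].
Proof.
suff h t : [seq p <- [seq (x, y) | x <- s, y <- t] | q p.1 && q p.2] =
    [seq (x, y) | x <- [seq x <- s | q x], y <- [seq x <- t | q x]] by exact: h.
elim: s => // x s IH; rewrite /= filter_cat IH filter_map /=.
case qx: (q x) => /=; first by congr (map _ _ ++ _);
  apply: eq_filter => y /=; rewrite qx.
by rewrite (@eq_filter _ _ pred0) ?filter_pred0// => y /=; rewrite qx.
Qed.

Lemma restr_ising (P : pred (option V)) s b h : restr P (ising s b h) =
  bonds [seq x <- s | P (Some x)] b ++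
  (if P None then fields [seq x <- s | P (Some x)] h else [::]).
Proof.
rewrite /restr /ising filter_cat !filter_map /bonds.
rewrite -(filter_pairs (fun x => P (Some x)) s).
congr (_ ++ _); case: ifP => PN.
  by rewrite /fields; congr map; apply: eq_filter => x /=; rewrite PN andbT.
by rewrite (@eq_filter _ _ pred0) ?filter_pred0// => x /=; rewrite PN andbF.
Qed.

Lemma perm_ising s t b h : perm_eq s t -> perm_eq (ising s b h) (ising t b h).
Proof.
move=> st; rewrite perm_cat// perm_map//.
exact: perm_allpairs.
Qed.

Definition icor s b h A := cor (ising s b h) A.

Lemma icor_perm s t b h A : perm_eq s t -> icor s b h A = icor t b h A.
Proof. by move=> st; apply/cor_perm/perm_ising. Qed.

Lemma icor_filter (q : pred V) s b h A : 0 <= b -> 0 <= h ->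
  icor [seq x <- s | q x] b h A <= icor s b h A.
Proof.
move=> b0 h0; pose P a := if a is Some x then q x else true.
have -> : icor [seq x <- s | q x] b h A = cor (restr P (ising s b h)) A.
  by rewrite restr_ising.
have n0 := nng_ising s b0 h0.
pose Q (e : option V * option V * R) := P e.1.1 && P e.1.2.
have n1 : nng [seq e <- ising s b h | ~~ Q e] by exact: nng_filter.
have n2 : nng (restr P (ising s b h)) by exact: nng_filter.
have pE : perm_eq (ising s b h) ([seq e <- ising s b h | ~~ Q e] ++ restr P (ising s b h)).
  by rewrite perm_sym perm_catC (perm_filterC Q).
by rewrite /icor (cor_perm _ pE) le_cor_cat.
Qed.

Lemma icor_sub s t b h A : 0 <= b -> 0 <= h -> uniq s -> uniq t ->
  {subset s <= t} -> icor s b h A <= icor t b h A.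
Proof.
move=> b0 h0 us ut st; rewrite (@icor_perm _ [seq x <- t | x \in s]) ?icor_filter//.
apply: uniq_perm => //; first exact: filter_uniq.
by move=> x; rewrite mem_filter; case: (boolP (x \in s)) => // /st ->.
Qed.

Lemma icor_le s b b' h h' A : 0 <= b -> b <= b' -> 0 <= h -> h <= h' ->
  icor s b h A <= icor s b' h' A.
Proof.
move=> b0 bb h0 hh; rewrite /icor.
have e B : moment (ising s b' h') B = moment (ising s (b' - b) (h' - h) ++ ising s b h) B.
  rewrite /ising -[in LHS](subrK b b') -[in LHS](subrK h h').
  transitivity (moment ([seq (Some p.1, Some p.2, (b' - b) * halfJ p + b * halfJ p) | p <- pairs s]
      ++ fields s (h' - h + h)) B).
    by congr (moment (_ ++ _) _); apply: eq_map => p; rewrite mulrDl.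
  rewrite (@moment_addw _ _ _ (fun p => (Some p.1, Some p.2)) (fun p => (b' - b) * halfJ p) (fun p => b * halfJ p)).
  set E1 := map _ _; set E2 := map _ _.
  transitivity (moment ((E1 ++ E2) ++ fields s (h' - h + h)) B); first by rewrite catA.
  rewrite moment_catC.
  rewrite (@moment_addw _ _ _ (fun x => (Some x, None)) (fun=> h' - h) (fun=> h)).
  apply: moment_perm; rewrite -/(fields s h) -/(fields s (h' - h)) -/E1 -/E2.
  rewrite /bonds -/E1 -/E2.
  apply/permP => z; rewrite !count_cat; lia.
rewrite /cor !e; apply: le_cor_cat; last exact: nng_ising.
by apply: nng_ising; rewrite subr_ge0.
Qed.
End IsingList.

Section Relabel.
Context {R : realType} {V1 V2 : choiceType}.
Variables (J1 : V1 -> V1 -> R) (J2 : V2 -> V2 -> R) (f : V1 -> V2).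
Hypothesis f_inj : injective f.
Hypothesis fJ : forall x y, J2 (f x) (f y) = J1 x y.

Lemma omap_inj : injective (omap f).
Proof. by move=> [x|] [y|]//= [/f_inj->]. Qed.

Lemma ising_map s b h : ising J2 (map f s) b h =
  [seq (omap f e.1.1, omap f e.1.2, e.2) | e <- ising J1 s b h].
Proof.
rewrite /ising map_cat /fields -!map_comp; congr (_ ++ _).
rewrite /bonds /pairs allpairs_mapl allpairs_mapr !map_allpairs /=.
by apply: eq_allpairs => x y; rewrite /halfJ /= inj_eq// fJ.
Qed.

Lemma icor_map s b h A :
  icor J2 (map f s) b h (map (omap f) A) = icor J1 s b h A.
Proof.
rewrite /icor ising_map /cor -[[::] in LHS]/(map (omap f) [::]).
by rewrite !(moment_map _ _ omap_inj).
Qed.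
End Relabel.

(** * Gibbs expectations *)

Section Configurations.
Context {R : realType} {L : finType}.
Implicit Types (s : {ffun L -> bool}) (A : seq (option L)).

Definition gspin s (a : option L) : R := if a is Some x then Defs.spin (s x) else 1.

Lemma spin_sqr (c : bool) : Defs.spin c ^+ 2 = 1 :> R.
Proof. by case: c; rewrite /Defs.spin ?sqrrN expr1n. Qed.

Lemma gspin_sqr s a : gspin s a ^+ 2 = 1.
Proof. by case: a => [x|] /=; rewrite ?spin_sqr ?expr1n. Qed.

Lemma prod_gspin_all_even s A : all_even A -> \prod_(a <- A) gspin s a = 1.
Proof.
have [n] := ubnP (size A); elim: n A => // n IH [|a A]; first by rewrite big_nil.
move=> /= /ltnSE An /[dup] ev /all_evenP/(_ a); rewrite /= eqxx/= negbK => aA.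
have {}aA : a \in A by apply: contraTT aA => /count_memPn->.
have pA := perm_to_rem aA.
rewrite big_cons (perm_big _ pA) /= big_cons mulrA -expr2 gspin_sqr mul1r.
apply: IH; first by rewrite size_rem//; case: (A) aA An => //= *; apply: ltnW.
rewrite -(eq_parity_all_even _ : all_even (a :: A) = _)// => y /=.
by move/permP: pA => ->/=; rewrite addnA oddD addnn odd_double.
Qed.

Lemma sum_prod_gspin A : ~~ odd (size A) ->
  \sum_s \prod_(a <- A) gspin s a = 2 ^+ #|L| * (all_even A)%:R.
Proof.
move=> sA; have [ev|nev] := boolP (all_even A).
  rewrite (eq_bigr (fun=> 1)) => [|s _]; last exact: prod_gspin_all_even.
  by rewrite sumr_const mulr1 card_ffun card_bool -natrX.
have [x ox] : exists x, odd (count_mem (Some x) A).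
  apply: contrapT => h; case/negP: nev.
  have {}h z : ~~ odd (count_mem (Some z) A) by apply/negP => oz; apply: h; exists z.
  apply/all_evenP => -[z|]; first exact: h.
  apply/negP => oN; have /(all_even_count predT) : all_even (None :: A).
    by apply/all_evenP => -[z|] /=; rewrite ?oddD ?oN// h.
  by rewrite count_predT /= sA.
rewrite mulr0.
pose f s : {ffun L -> bool} := [ffun y => (y == x) (+) s y].
have fK : involutive f by move=> s; apply/ffunP => y; rewrite !ffunE addKb.
suff h : \sum_s \prod_(a <- A) gspin s a = - \sum_s \prod_(a <- A) gspin s a.
  by lra.
rewrite [LHS](reindex_inj (inv_inj fK)) -sumrN; apply: eq_bigr => s _.
suff -> : \prod_(a <- A) gspin (f s) a =
   (-1) ^+ (count_mem (Some x) A) * \prod_(a <- A) gspin s a.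
  by rewrite -signr_odd ox expr1 mulN1r.
elim: (A) => [|a A' IH]; first by rewrite !big_nil expr0 mulr1.
rewrite !big_cons IH /= exprD.
suff -> : gspin (f s) a = (-1) ^+ (a == Some x) * gspin s a by ring.
case: a => [y|] /=; last by rewrite mulr1.
rewrite ffunE (inj_eq Some_inj); case: eqP => [->|_] /=; last by rewrite expr0 mul1r.
by rewrite expr1 /Defs.spin; case: (s x); rewrite /= mulN1r ?opprK.
Qed.

(** The ghost spin is fixed to 1. As [A] has an even number of points, the
    global flip shows that summing over the ghost spin as well would not change
    the average. *)
Lemma sum_weight_moment (E : seq (option L * option L * R)) A : ~~ odd (size A) ->
  \sum_s (\prod_(a <- A) gspin s a) *
     expR (\sum_(e <- E) e.2 * (gspin s e.1.1 * gspin s e.1.2)) =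
  2 ^+ #|L| * moment E A.
Proof.
elim: E A => [|[[x y] t] E IH] A sA.
  under eq_bigr do rewrite big_nil expR0 mulr1.
  by rewrite sum_prod_gspin.
rewrite moment_cons mulrDr (mulrCA _ (ch t)) (mulrCA _ (sh t)) -!IH//=; last by rewrite negbK.
rewrite !mulr_sumr -big_split /=; apply: eq_bigr => s _.
rewrite big_cons expRD expR_spin; last by rewrite exprMn !gspin_sqr mulr1.
by rewrite !big_cons; ring.
Qed.
End Configurations.

Section GibbsCorrelation.
Context {R : realType} {V : choiceType}.
Variable J : V -> V -> R.
Implicit Types (L : {fset V}) (b h : R).

Lemma hamiltonianE L b h (s : {ffun L -> bool}) :
  - hamiltonian J b h s =
  \sum_(e <- ising (fun x y : L => J (val x) (val y)) (enum {: L}) b h)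
     e.2 * (gspin s e.1.1 * gspin s e.1.2) :> R.
Proof.
rewrite /ising big_cat /= !big_map big_allpairs /hamiltonian opprD -!mulNr !opprK.
rewrite !big_enum /=; congr (_ + _).
  rewrite !mulr_sumr; apply: eq_bigr => x _.
  rewrite big_enum /= big_mkcond !mulr_sumr; apply: eq_bigr => y _.
  rewrite /halfJ /= eq_sym; case: eqP => _ /=; first by rewrite !(mulr0, mul0r).
  by ring.
by rewrite mulr_sumr; apply: eq_bigr => x _; rewrite mulr1.
Qed.

(** A product of an odd number of spins is completed by the ghost spin. *)
Lemma gibbs_icor L b h (A : seq L) (f : {ffun L -> bool} -> R) :
  0 <= b -> 0 <= h -> (forall x y, 0 <= J x y) ->
  (forall s, f s = \prod_(a <- A) Defs.spin (s a)) ->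
  gibbs J b h f =
  icor J (enum_fset L) b h (map Some (map val A) ++ nseq (odd (size A)) None).
Proof.
move=> b0 h0 J0 fA; rewrite /gibbs; set JL := fun x y : L => J (val x) (val y).
set A' := map Some A ++ nseq (odd (size A)) None.
have fE s : f s = \prod_(a <- A') gspin s a.
  rewrite fA /A' big_cat /= big_map [X in _ * X]big1_seq ?mulr1// => a.
  by rewrite mem_nseq => /andP[_ /andP[_ /eqP->]].
set E := ising JL (enum {: L}) b h.
have -> : \sum_(s : {ffun L -> bool}) expR (- hamiltonian J b h s) = 2 ^+ #|{: L}| * moment E [::].
  by rewrite -sum_weight_moment//; apply: eq_bigr => s _; rewrite big_nil mul1r hamiltonianE.
have -> : \sum_(s : {ffun L -> bool}) f s * expR (- hamiltonian J b h s) = 2 ^+ #|{: L}| * moment E A'.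
  rewrite -sum_weight_moment; last by rewrite /A' size_cat size_map size_nseq oddD oddb addbb.
  by apply: eq_bigr => s _; rewrite fE hamiltonianE.
rewrite -mulf_div divff ?mul1r; last by rewrite expf_neq0.
transitivity (icor JL (enum {: L}) b h A'); first by [].
rewrite -(@icor_map R L V JL J val val_inj (fun _ _ => erefl)) /icor.
congr cor; last first.
  by rewrite /A' map_cat -!map_comp map_nseq.
by rewrite enum_fsetE.
Qed.

Lemma extend_in L (s : {ffun L -> bool}) (x : L) : extend s (val x) = s x.
Proof. by rewrite /extend valK. Qed.

Lemma gibbs_spin L b h v : 0 <= b -> 0 <= h -> (forall x y, 0 <= J x y) ->
  v \in L ->
  gibbs J b h (fun s : {ffun L -> bool} => Defs.spin (extend s v)) =
  icor J (enum_fset L) b h [:: Some v; None].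
Proof.
move=> b0 h0 J0 vL; rewrite (@gibbs_icor L b h [:: [` vL]%fset])// => s.
by rewrite big_seq1 -extend_in.
Qed.

Lemma gibbs_spin2 L b h x y : 0 <= b -> 0 <= h -> (forall x y, 0 <= J x y) ->
  x \in L -> y \in L ->
  gibbs J b h (fun s : {ffun L -> bool} =>
    Defs.spin (extend s x) * Defs.spin (extend s y)) =
  icor J (enum_fset L) b h [:: Some x; Some y].
Proof.
move=> b0 h0 J0 xL yL.
rewrite (@gibbs_icor L b h [:: [` xL]%fset; [` yL]%fset])// => s.
by rewrite big_cons big_seq1 -!extend_in.
Qed.
End GibbsCorrelation.

(** * Derivatives and truncated correlations *)

Section Derivative.
Context {R : realType}.

Lemma is_derive_moment (I : eqType) (T : Type) (f : T -> I * I) (w : T -> R)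
    (l : seq T) (E : seq (I * I * R)) A (b : R) :
  is_derive b 1 (fun b => moment ([seq (f i, b * w i) | i <- l] ++ E) A)
   (\sum_(i <- l) w i *
      moment ([seq (f i, b * w i) | i <- l] ++ E) [:: (f i).1, (f i).2 & A]).
Proof.
elim: l A => [|i l IH] A; first by rewrite big_nil; exact: is_derive_cst.
rewrite big_cons; case fi : (f i) => [x y].
pose F (B : seq I) (b : R) := moment ([seq (f i, b * w i) | i <- l] ++ E) B.
pose dF (B : seq I) := \sum_(i <- l) w i * F [:: (f i).1, (f i).2 & B] b.
have dFP B : is_derive b 1 (F B) (dF B) by exact: IH.
have hx : is_derive b 1 (fun b : R => b * w i) (w i).
  by apply: is_derive_eq; rewrite /GRing.scale /=; ring.
have hc : is_derive b 1 (fun b : R => ch (b * w i)) (w i * sh (b * w i)).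
  have := @is_derive1_comp _ ch (fun b : R => b * w i) b _ _ (is_derive_ch _) hx.
  by rewrite /GRing.scale /= mulrC.
have hs : is_derive b 1 (fun b : R => sh (b * w i)) (w i * ch (b * w i)).
  have := @is_derive1_comp _ sh (fun b : R => b * w i) b _ _ (is_derive_sh _) hx.
  by rewrite /GRing.scale /= mulrC.
have h1 := dFP A; have h2 := dFP [:: x, y & A].
have -> : (fun b0 : R => moment ([seq (f i0, b0 * w i0) | i0 <- i :: l] ++ E) A) =
   (fun b => ch (b * w i)) * F A + (fun b => sh (b * w i)) * F [:: x, y & A].
  by apply/funext => b' /=; rewrite fi.
apply: is_derive_eq; rewrite /GRing.scale /= fi /=.
set c := ch _; set s := sh _.
have e1 : F [:: x, y, x, y & A] b = F A b by apply: eq_parity_moment; eq_parity_tac.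
have e2 j : F [:: (f j).1, (f j).2, x, y & A] b = F [:: x, y, (f j).1, (f j).2 & A] b.
  by apply: eq_parity_moment; eq_parity_tac.
rewrite -!/(F _ b) e1 /dF.
rewrite [X in _ = _ + X](eq_bigr (fun j => c * (w j * F [:: (f j).1, (f j).2 & A] b) +
   s * (w j * F [:: x, y, (f j).1, (f j).2 & A] b))) => [|j _]; last first.
  by rewrite -!/(F _ b); ring.
rewrite [X in _ + (s * X + _) = _](eq_bigr (fun j => w j * F [:: x, y, (f j).1, (f j).2 & A] b)) => [|j _]; last by rewrite e2.
rewrite big_split /= -!mulr_sumr; ring.
Qed.
End Derivative.

Section GHS.
Context {R : realType} {W : choiceType}.
Implicit Types (E : seq (W * W * R)) (o g x y : W).

Definition trunc E o g x := cor E [:: o; x] - cor E [:: o; g] * cor E [:: x; g].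

(** By [ghost_expansion] the left-hand side is the sum of two weights [P], each
    bounded by a truncated correlation. *)
Lemma ghs E o g x y : nng E ->
  cor E [:: o; g; x; y] - cor E [:: o; g] * cor E [:: x; y] <=
  cor E [:: y; g] * trunc E o g x + cor E [:: x; g] * trunc E o g y.
Proof.
have [I [f [E' [A' [fI -> e]]]]] := fintype_lift E [:: o; g; x; y] => E0.
have {}E0 : nng E' by move: E0; rewrite /nng all_map.
case: A' e => [//|o' [//|g' [//|x' [//|y' [|//]]]]] [-> -> -> ->].
have [p [P [_ _ _ hP hPP]]] := ghost_expansion E0 o' g'.
have h A : cor [seq (f e.1.1, f e.1.2, e.2) | e <- E'] (map f A) = cor E' A.
  by rewrite /cor -[[::] in LHS]/(map f [::]) !moment_map.
have h2 a b : cor [seq (f e.1.1, f e.1.2, e.2) | e <- E'] [:: f a; f b] = cor E' [:: a; b].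
  exact: (h [:: a; b]).
rewrite /trunc !h2 (h [:: o'; g'; x'; y']) hP.
by apply: lerD; [have [] := hPP x' y'|have [] := hPP y' x'].
Qed.

Lemma trunc_ge0 E o g x : nng E -> 0 <= trunc E o g x.
Proof.
move=> E0; rewrite subr_ge0 (le_trans (cor_gks2 _ _ E0))//.
by rewrite (@eq_parity_cor _ _ _ _ [:: o; x])//; eq_parity_tac.
Qed.

Lemma cor_cons x y t E A : nng E ->
  cor ((x, y, t) :: E) A =
  (ch t * cor E A + sh t * cor E [:: x, y & A]) / (ch t + sh t * cor E [:: x; y]).
Proof.
move=> E0; have := moment_gt0 E0; rewrite /cor /=; set z := moment E [::] => z0.
have -> : ch t + sh t * (moment E [:: x; y] / z) = (ch t * z + sh t * moment E [:: x; y]) / z.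
  by field; rewrite gt_eqF.
have -> : ch t * (moment E A / z) + sh t * (moment E [:: x, y & A] / z) =
   (ch t * moment E A + sh t * moment E [:: x, y & A]) / z by ring.
by rewrite -mulf_div divff ?mulr1// invr_eq0 gt_eqF.
Qed.

(** A discrete form of the concavity of the magnetization in the field: [ghs]
    bounds the part that is linear in [sh t], and the quadratic part has a sign
    by the second Griffiths inequality. *)
Lemma trunc_cons o g x y t E : nng E -> 0 <= t ->
  trunc ((y, g, t) :: E) o g x <= trunc E o g x.
Proof.
move=> E0 t0; have c0 := ch_gt0 t; have s0 := sh_ge0 t0.
have hg := ghs o g x y E0.
have k1 : cor E [:: y; g] * cor E [:: o; g] <= cor E [:: o; y].
  by rewrite (le_trans (cor_gks2 _ _ E0))// (@eq_parity_cor _ _ _ _ [:: o; y])//; eq_parity_tac.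
have k2 : cor E [:: y; g] * cor E [:: x; g] <= cor E [:: x; y].
  by rewrite (le_trans (cor_gks2 _ _ E0))// (@eq_parity_cor _ _ _ _ [:: x; y])//; eq_parity_tac.
have z0 := cor_ge0 [:: y; g] E0.
move: hg; rewrite /trunc !cor_cons//.
rewrite (@eq_parity_cor _ _ E [:: y; g; o; x] [:: o; g; x; y]); last by eq_parity_tac.
rewrite (@eq_parity_cor _ _ E [:: y; g; o; g] [:: o; y]); last by eq_parity_tac.
rewrite (@eq_parity_cor _ _ E [:: y; g; x; g] [:: x; y]); last by eq_parity_tac.
set X := cor E [:: o; x]; set a := cor E [:: o; g] in k1 *.
set b := cor E [:: x; g] in k2 *; set p := cor E [:: o; y] in k1 *.
set q := cor E [:: x; y] in k2 *; set z := cor E [:: y; g] in k1 k2 z0 *.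
set F := cor E [:: o; g; x; y]; set c := ch t in c0 *; set s := sh t in s0 *.
move=> hg; have d0 : 0 < c + s * z by apply: ltr_wpDr => //; exact: mulr_ge0.
have -> : (c * X + s * F) / (c + s * z) - (c * a + s * p) / (c + s * z) * ((c * b + s * q) / (c + s * z)) =
  ((c * X + s * F) * (c + s * z) - (c * a + s * p) * (c * b + s * q)) / (c + s * z) ^+ 2.
  by field; rewrite gt_eqF.
rewrite ler_pdivrMr ?exprn_gt0//.
have h1 := ler_wpM2l (mulr_ge0 s0 (ltW d0)) hg.
have h2 : 0 <= s ^+ 2 * ((p - z * a) * (q - z * b)).
  by rewrite mulr_ge0 ?exprn_ge0// mulr_ge0// subr_ge0.
move: h1 h2; nra.
Qed.

(** The truncated correlation is the derivative of the magnetization of [o] in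
    the field at [x], and it decreases with this field. *)
Lemma trunc_field_le o g x t E : nng E -> 0 <= t ->
  t * trunc ((x, g, t) :: E) o g x <= cor ((x, g, t) :: E) [:: o; g] - cor E [:: o; g].
Proof.
move=> E0 t0; have c0 := ch_gt0 t; have s0 := sh_ge0 t0; have c1 := ch_ge1 t.
have ts := sh_ge t0; have cs := ch2_sh2 t.
have tr0 := trunc_ge0 o g x E0; have y0 := cor_ge0 [:: x; g] E0.
move: tr0; rewrite /trunc !cor_cons//.
rewrite (@eq_parity_cor _ _ E [:: x; g; o; x] [:: o; g]); last by eq_parity_tac.
rewrite (@eq_parity_cor _ _ E [:: x; g; o; g] [:: o; x]); last by eq_parity_tac.
rewrite (@eq_parity_cor _ _ E [:: x; g; x; g] [::]); last by eq_parity_tac.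
rewrite cor_nil//.
set X := cor E [:: o; x]; set m := cor E [:: o; g]; set z := cor E [:: x; g] in y0 *.
set c := ch t in c0 c1 cs *; set s := sh t in s0 ts cs *.
move=> tr0; have d0 : 0 < c + s * z by apply: ltr_wpDr => //; exact: mulr_ge0.
have -> : (c * X + s * m) / (c + s * z) - (c * m + s * X) / (c + s * z) * ((c * z + s * 1) / (c + s * z)) =
  ((c ^+ 2 - s ^+ 2) * (X - m * z)) / (c + s * z) ^+ 2.
  by field; rewrite gt_eqF.
have -> : (c * m + s * X) / (c + s * z) - m = (s * (c + s * z) * (X - m * z)) / (c + s * z) ^+ 2.
  by field; rewrite gt_eqF.
rewrite cs mul1r mulrA ler_pM2r ?invr_gt0 ?exprn_gt0// ler_wpM2r//.
have : 0 <= s * z by exact: mulr_ge0.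
by nra.
Qed.

(** Switch on the fields one after the other. By [trunc_cons] the later fields
    only decrease the truncated correlation at a point, and the increments of
    the magnetization telescope. *)
Lemma sum_trunc_fields o g t (r : seq W) E : nng E -> 0 <= t ->
  t * \sum_(x <- r) trunc ([seq (x, g, t) | x <- r] ++ E) o g x <=
  cor ([seq (x, g, t) | x <- r] ++ E) [:: o; g] - cor E [:: o; g].
Proof.
move=> E0 t0; elim: r => [|y r IH]; first by rewrite big_nil subrr mulr0.
set E1 := _ ++ E in IH; rewrite big_cons /= -/E1.
have E10 : nng E1 by rewrite nng_cat E0 andbT /nng all_map; apply/allP.
have := trunc_field_le o g y E10 t0.
have : t * \sum_(x <- r) trunc ((y, g, t) :: E1) o g x <= t * \sum_(x <- r) trunc E1 o g x.
  by apply: ler_wpM2l => //; apply: ler_sum => x _; exact: trunc_cons.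
by rewrite [t * (_ + \sum_(_ <- _) _)]mulrDr; lra.
Qed.
End GHS.

(** * Inequalities in a finite volume *)

Section ZeroField.
Context {R : realType} {V : choiceType}.
Variable J : V -> V -> R.

Lemma moment_fields0 (s : seq V) (b : R) A : moment (ising J s b 0) A = moment (bonds J s b) A.
Proof.
rewrite /ising moment_catC; elim: {1}s A => [//|x s' IH] A.
by rewrite /= ch0 sh0 mul1r mul0r addr0 IH.
Qed.

Lemma icor_bonds (s : seq V) (b : R) A : cor (bonds J s b) A = icor J s b 0 A.
Proof. by rewrite /icor /cor !moment_fields0. Qed.
End ZeroField.

Section IsingVolume.
Context {R : realType} {V : choiceType}.
Variable J : V -> V -> R.
Hypothesis J_ge0 : forall x y, 0 <= J x y.
Hypothesis J_sym : forall x y, J x y = J y x.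
Implicit Types (L S Y : {fset V}) (b h : R) (o v x y z : V).

Local Notation ic := (icor J).

Lemma sum_pairs (F : V * V -> R) (s : seq V) :
  \sum_(p <- pairs s) F p = \sum_(x <- s) \sum_(y <- s) F (x, y).
Proof. by rewrite /pairs big_allpairs. Qed.

Lemma icor_out (s : seq V) b v x : x != v -> x \notin s -> ic s b 0 [:: Some v; Some x] = 0.
Proof.
move=> xv xs; rewrite -icor_bonds /cor (@moment_odd _ _ (pred1 (Some x))) ?mul0r//=.
  apply/allP => e /mapP[p /allpairsP[q [q1 q2 ->]] ->] /=.
  have /negbTE -> : Some q.1 != Some x by apply: contraNneq xs => -[<-].
  by have /negbTE -> : Some q.2 != Some x by apply: contraNneq xs => -[<-].
have /negbTE -> : Some v != Some x :> option V.
  by apply: contraNneq xv => -[->].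
by rewrite eqxx.
Qed.

Lemma icor_ghost0 (s : seq V) b v : ic s b 0 [:: Some v; None] = 0.
Proof.
rewrite -icor_bonds /cor (@moment_odd _ _ (pred1 None)) ?mul0r//=.
by apply/allP => e /mapP[p _ ->].
Qed.

(** The regions of [ghost_expansion] avoid the ghost, so that the correlations
    inside them are those of finite volumes without field. *)
Lemma ghost_expansion_ising L b h o (oL : o \in L) : 0 <= b -> 0 <= h ->
  exists (K : finType) (S : K -> {fset V}) (p : K -> R) (P : L -> L -> R),
  [/\ forall t, 0 <= p t,
      forall t, (S t `<=` L)%fset,
      forall t, o \notin S t -> p t = 0,
      forall x y : L, 0 <= P x y &
  [/\ forall x, x \in L -> trunc (ising J L b h) (Some o) None (Some x) =
        \sum_t (x \in S t)%:R * p t * ic (S t) b 0 [:: Some o; Some x],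
      forall x y : L, ic L b h [:: Some o; None; Some (val x); Some (val y)] -
        ic L b h [:: Some o; None] * ic L b h [:: Some (val x); Some (val y)] =
        P x y + P y x &
      forall x y : L, \sum_t (val x \in S t)%:R * (val y \notin S t)%:R * p t *
          ic (S t) b 0 [:: Some o; Some (val x)] <=
        ic L b h [:: Some (val y); None] * P x y]].
Proof.
move=> b0 h0; pose JL (x y : L) := J (val x) (val y).
pose E0 := ising JL (enum {: L}) b h.
have E00 : nng E0 by apply: nng_ising => // x y; exact: J_ge0.
pose o' : L := [` oL]%fset.
have [p [P [p_ge0 P_ge0 hQ hP hPP]]] := ghost_expansion E00 (Some o') None.
(* The region t, as a set of points of V; q t says that it avoids the ghost and
   contains o. *)
pose S (t : {set option L}) : {fset V} := [fset val x | x in {: L} & Some x \in t]%fset.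
pose q (t : {set option L}) := (None \notin t) && (Some o' \in t).
have memS (t : {set option L}) (x : L) : (val x \in S t) = (Some x \in t).
  apply/imfsetP/idP => [[y /=]|xt]; first by rewrite inE => yt /val_inj->.
  by exists x; rewrite ?inE.
have corE A : cor E0 A = ic L b h (map (omap val) A).
  rewrite -[LHS]/(icor JL (enum {: L}) b h A).
  by rewrite -(@icor_map R L V JL J val val_inj (fun _ _ => erefl)) -enum_fsetE.
have corS (t : {set option L}) (x : L) : None \notin t ->
    cor (restr (mem t) E0) [:: Some o'; Some x] = ic (S t) b 0 [:: Some o; Some (val x)].
  move=> /negbTE Nt; rewrite restr_ising /= Nt cats0.
  rewrite (icor_bonds JL).
  rewrite -(@icor_map R L V JL J val val_inj (fun _ _ => erefl)).
  apply: icor_perm; apply: uniq_perm; rewrite ?fset_uniq//.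
    rewrite map_inj_uniq; last by move=> ? ? /val_inj.
    by apply: filter_uniq; exact: enum_uniq.
  move=> z; apply/mapP/idP => [[y]|zS].
    by rewrite mem_filter => /andP[yt _] ->; have := memS t y; rewrite yt.
  case/imfsetP: zS => y /=; rewrite inE => yt ->.
  by exists y => //; rewrite mem_filter yt mem_enum.
exists {set option L}, S, (fun t : {set option L} => if q t then p t else 0), (fun x y : L => P (Some x) (Some y)); split.
- by move=> t; case: ifP.
- by move=> t; apply/fsubsetP => z /imfsetP[y _ ->]; exact: valP.
- move=> t; have -> : (o \in S t) = (Some o' \in t) by exact: (memS t o').
  by rewrite /q => /negbTE ->; rewrite andbF.
- by move=> x y.
split.
- move=> x xL; pose x' : L := [` xL]%fset.
  rewrite /trunc -!/(icor _ _ _ _ _).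
  have := hQ (Some x'); rewrite !corE /= => ->.
  rewrite big_mkcond /=; apply: eq_bigr => t _; rewrite (memS t x' : (x \in S t) = _) /q.
  case: (boolP (None \in t)) => Nt /=; first by rewrite mulr0 mul0r.
  case: (Some o' \in t) => /=; last by rewrite mulr0 mul0r.
  by case: (Some x' \in t); rewrite ?mul0r// mul1r corS.
- by move=> x y; have := hP (Some x) (Some y); rewrite !corE.
- move=> x y; have [h1 _] := hPP (Some x) (Some y); move: h1; rewrite !corE /=.
  apply: le_trans; rewrite le_eqVlt; apply/orP; left; apply/eqP.
  rewrite [RHS]big_mkcond /=; apply: eq_bigr => t _; rewrite !memS /q.
  case: (boolP (None \in t)) => Nt /=; first by rewrite mulr0 mul0r.
  case: (Some y \in t) => /=; first by rewrite mulr0 !mul0r.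
  case: (Some o' \in t) => /=; last by rewrite mulr0 mul0r.
  by case: (Some x \in t); rewrite /= ?mul0r// !mul1r corS.
Qed.
End IsingVolume.

Section VolumeInequalities.
Context {R : realType} {V : choiceType}.
Variable J : V -> V -> R.
Hypothesis J_ge0 : forall x y, 0 <= J x y.
Hypothesis J_sym : forall x y, J x y = J y x.
Implicit Types (L S Y : {fset V}) (b h : R) (o v x y z : V).

Local Notation ic := (icor J).

Lemma halfJ_sym x y : halfJ J (x, y) = halfJ J (y, x).
Proof. by rewrite /halfJ /= eq_sym J_sym. Qed.

Lemma icor_ge0 (s : seq V) b h A : 0 <= b -> 0 <= h -> 0 <= ic s b h A.
Proof. by move=> b0 h0; apply: cor_ge0; exact: nng_ising. Qed.

Lemma icor_le1 (s : seq V) b h A : 0 <= b -> 0 <= h -> ic s b h A <= 1.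
Proof. by move=> b0 h0; apply: cor_le1; exact: nng_ising. Qed.

Definition dmag L b h o := \sum_(p <- pairs L) halfJ J p *
  (ic L b h [:: Some o; None; Some p.1; Some p.2] -
   ic L b h [:: Some o; None] * ic L b h [:: Some p.1; Some p.2]).

Lemma is_derive_mag L b h o : 0 <= b -> 0 <= h ->
  is_derive b 1 (fun b => ic L b h [:: Some o; None]) (dmag L b h o).
Proof.
move=> b0 h0; pose f (p : V * V) : option V * option V := (Some p.1, Some p.2).
pose D A := \sum_(p <- pairs L) halfJ J p *
   moment (ising J L b h) [:: Some p.1, Some p.2 & A].
have dG A : is_derive b 1 (fun b => moment (ising J L b h) A) (D A).
  exact: (is_derive_moment f (halfJ J) (pairs L) (fields L h) A b).
have z0 : 0 < moment (ising J L b h) [::] by apply: moment_gt0; exact: nng_ising.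
have h1 := dG [:: Some o; None]; have h2 := dG [::].
have h3 : is_derive b 1 (fun b => (moment (ising J L b h) [::])^-1)
    (- (moment (ising J L b h) [::]) ^- 2 *: D [::]).
  by apply: is_deriveV; rewrite gt_eqF.
have -> : (fun b => ic L b h [:: Some o; None]) =
  (fun b => moment (ising J L b h) [:: Some o; None]) * (fun b => (moment (ising J L b h) [::])^-1).
  by apply/funext.
set A := [:: Some o; None] in h1 *; set z := moment _ [::] in z0 *.
apply: is_derive_eq; rewrite /GRing.scale /=.
transitivity ((D A - moment (ising J L b h) A / z * D [::]) / z).
  by rewrite -/z; field; rewrite gt_eqF.
rewrite /D mulr_sumr -sumrB mulr_suml; apply: eq_bigr => p _.
rewrite /icor /cor -/z (@eq_parity_moment _ _ _ [:: Some o; None; Some p.1; Some p.2]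
  [:: Some p.1, Some p.2 & A]); last by eq_parity_tac.
by field; rewrite gt_eqF.
Qed.

Lemma trunc_ising_ge0 L b h o x : 0 <= b -> 0 <= h ->
  0 <= trunc (ising J L b h) (Some o) None (Some x).
Proof. by move=> b0 h0; apply: trunc_ge0; exact: nng_ising. Qed.

(** The right-hand side exceeds the gain in magnetization due to the fields
    outside of [S]. *)
Lemma boundary_trunc L S b h o : (S `<=` L)%fset -> 0 <= b -> 0 <= h ->
  h * \sum_(x <- L | x \notin S) trunc (ising J L b h) (Some o) None (Some x) <=
  ic L b h [:: Some o; None] - ic S b h [:: Some o; None].
Proof.
move=> SL b0 h0; set r := [seq x <- L | x \notin S].
have pS : perm_eq S [seq x <- L | x \in S].
  apply: uniq_perm; rewrite ?filter_uniq ?fset_uniq// => x.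
  rewrite mem_filter; apply/idP/andP => [xS|[]//].
  by split => //; exact: (fsubsetP SL).
have pL : perm_eq L (r ++ S).
  rewrite perm_sym perm_catC; apply: (@perm_trans _ ([seq x <- L | x \in S] ++ r)).
    by rewrite perm_cat2r.
  by rewrite (perm_filterC (fun x => x \in S)).
pose E := bonds J L b ++ fields S h.
have pE : perm_eq (ising J L b h) ([seq (a, None, h) | a <- map Some r] ++ E).
  rewrite /ising /E perm_sym perm_catCA perm_cat2l -map_comp -[map _ r]/(fields r h).
  by rewrite /fields -map_cat perm_map// perm_sym.
have E0 : nng E by rewrite nng_cat nng_bonds// nng_fields.
have := sum_trunc_fields (Some o) None (map Some r) E0 h0.
rewrite -(cor_perm _ pE) big_map big_filter.
under eq_bigr do rewrite /trunc -!(cor_perm _ pE) -/(trunc _ _ _ _).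
move=> h1; apply: le_trans h1 _; rewrite lerD2l lerN2.
pose P (a : option V) := if a is Some x then x \in S else false.
pose Q (e : option V * option V * R) := P e.1.1 && P e.1.2.
have pE' : perm_eq (bonds J L b ++ fields S h)
    ([seq e <- bonds J L b | ~~ Q e] ++ (restr P (bonds J L b) ++ fields S h)).
  by rewrite catA perm_cat2r perm_sym perm_catC (perm_filterC Q).
have rE : restr P (bonds J L b) = bonds J [seq x <- L | x \in S] b.
  have := restr_ising J P L b 0.
  rewrite /= cats0 => <-; rewrite /restr /ising filter_cat [X in _ = _ ++ X](_ : _ = [::]) ?cats0//.
  by rewrite /fields filter_map (@eq_filter _ _ pred0) ?filter_pred0// => x /=; rewrite andbF.
rewrite (cor_perm _ pE') rE /icor (@cor_perm _ _ (ising J S b h) (bonds J [seq x <- L | x \in S] b ++ fields S h)).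
  apply: le_cor_cat; last by rewrite nng_cat nng_bonds// nng_fields.
  by apply: nng_filter; exact: nng_bonds.
by rewrite perm_cat2r; apply: perm_map; apply: perm_allpairs.
Qed.
End VolumeInequalities.

Section DifferentialInequality.
Context {R : realType} {V : choiceType}.
Variable J : V -> V -> R.
Hypothesis J_ge0 : forall x y, 0 <= J x y.
Hypothesis J_sym : forall x y, J x y = J y x.
Implicit Types (L S Y : {fset V}) (b h : R) (o v x y z : V).

Local Notation ic := (icor J).

Lemma sum_fset_restr L S (F : V -> R) : (S `<=` L)%fset ->
  \sum_(x <- L | x \in S) F x = \sum_(x <- S) F x.
Proof.
move=> SL; rewrite -big_filter; apply: perm_big.
apply: uniq_perm; rewrite ?filter_uniq ?fset_uniq// => x.
by rewrite mem_filter; apply/andP/idP => [[]//|xS]; split => //; exact: (fsubsetP SL).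
Qed.

Lemma ler_sum_fset_in Y S (F : V -> R) : (forall x, 0 <= F x) ->
  \sum_(x <- Y | x \in S) F x <= \sum_(x <- S) F x.
Proof.
move=> F0; rewrite -big_filter (perm_big [seq x <- S | x \in Y]) /=; last first.
  apply: uniq_perm; rewrite ?filter_uniq ?fset_uniq// => x.
  by rewrite !mem_filter andbC.
by rewrite big_filter big_mkcond /=; apply: ler_sum => x _; case: ifP.
Qed.

(** The right-hand side is [M] times the derivative of the magnetization in [b].
    It bounds the average of the outflow from the random region [S t], by the
    last property of [ghost_expansion] summed over the bonds. *)
Lemma differential_inequality L b h o M : o \in L -> 0 <= b -> 0 <= h ->
  (forall y, y \in L -> ic L b h [:: Some y; None] <= M) ->
  exists (K : finType) (S : K -> {fset V}) (p : K -> R),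
  [/\ forall t, 0 <= p t,
      forall t, (S t `<=` L)%fset,
      forall t, o \notin S t -> p t = 0,
      forall x, x \in L -> trunc (ising J L b h) (Some o) None (Some x) =
        \sum_t (x \in S t)%:R * p t * ic (S t) b 0 [:: Some o; Some x] &
      \sum_t p t * (\sum_(x <- S t) \sum_(y <- L | y \notin S t)
         J x y * ic (S t) b 0 [:: Some o; Some x]) <= M * dmag J L b h o].
Proof.
move=> oL b0 h0 hM.
have [K [S [p [P [p0 SL pS P0 [h1 h2 h3]]]]]] := ghost_expansion_ising J_ge0 oL b0 h0.
exists K, S, p; split => //.
pose w (x y : L) := 2 * halfJ J (val x, val y).
have w0 (x y : L) : 0 <= w x y by rewrite mulr_ge0 ?halfJ_ge0.
have -> : dmag J L b h o = \sum_(x : L) \sum_(y : L) w x y * P x y.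
  rewrite /dmag sum_pairs big_seq_fsetE /=.
  under eq_bigr do rewrite big_seq_fsetE /=.
  under eq_bigr do under eq_bigr do rewrite h2 mulrDr.
  under eq_bigr do rewrite big_split /=.
  rewrite big_split /= [X in _ + X]exchange_big /= -big_split /=.
  apply: eq_bigr => x _; rewrite -big_split /=; apply: eq_bigr => y _.
  by rewrite /w (halfJ_sym J_sym (val y)); ring.
apply: (@le_trans _ _ (\sum_(x : L) \sum_(y : L) w x y * (ic L b h [:: Some (val y); None] * P x y))); last first.
  rewrite mulr_sumr; apply: ler_sum => x _; rewrite mulr_sumr; apply: ler_sum => y _.
  by rewrite mulrCA; apply: ler_wpM2r; [exact: mulr_ge0|exact/hM/valP].
apply: (@le_trans _ _ (\sum_(x : L) \sum_(y : L) w x y * \sum_t (val x \in S t)%:R * (val y \notin S t)%:R * p t *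
          ic (S t) b 0 [:: Some o; Some (val x)])); last first.
  by apply: ler_sum => x _; apply: ler_sum => y _; rewrite ler_wpM2l.
rewrite le_eqVlt; apply/orP; left; apply/eqP.
transitivity (\sum_t \sum_(x : L) \sum_(y : L) w x y * ((val x \in S t)%:R * (val y \notin S t)%:R * p t *
          ic (S t) b 0 [:: Some o; Some (val x)])); last first.
  rewrite exchange_big /=; apply: eq_bigr => x _; rewrite exchange_big /=.
  by apply: eq_bigr => y _; rewrite mulr_sumr.
apply: eq_bigr => t _; rewrite -(sum_fset_restr _ (SL t)) big_mkcond big_seq_fsetE /=.
rewrite mulr_sumr; apply: eq_bigr => x _; case: ifPn => xS; last first.
  by rewrite mulr0 big1// => y _; rewrite !mul0r mulr0.
rewrite big_mkcond big_seq_fsetE /= mulr_sumr; apply: eq_bigr => y _.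
case: ifPn => yS; last by rewrite !(mulr0,mul0r).
rewrite /w /halfJ /=; have /negbTE -> : val x != val y by apply: contraNneq yS => <-.
by rewrite mul1r; field.
Qed.

(** The bonds to be opened in [lieb] are those leaving [S] and the fields on
    [S]; bonds and fields without end in [S] do not contribute, as [v] is
    uncorrelated with the outside in the model on [S]. *)
Lemma lieb_ising L S b h v (a : option V) : 0 <= b -> 0 <= h ->
  v \in L -> v \in S -> (if a is Some z then z \notin S else true) ->
  ic L b h [:: Some v; a] <=
  \sum_(x <- S) \sum_(y <- L | y \notin S)
     b * J x y * ic S b 0 [:: Some v; Some x] * ic L b h [:: Some y; a] +
  h * \sum_(x <- S) ic S b 0 [:: Some v; Some x] * ic L b h [:: None; a].
Proof.
move=> b0 h0 vL vS aS.
pose P (c : option V) := if c is Some x then x \in S else false.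
pose Q (e : option V * option V * R) := P e.1.1 && P e.1.2.
pose S0 := [seq x <- L | x \in S].
set E := ising J L b h; pose E0 := bonds J S0 b; pose E1 := [seq e <- E | ~~ Q e].
have E_ge0 : nng E by exact: nng_ising.
have E0_ge0 : nng E0 by exact: nng_bonds.
have E1_ge0 : nng E1 by exact: nng_filter.
have pE : perm_eq E (E1 ++ E0).
  rewrite perm_sym perm_catC -[E0]cats0 -[E0 ++ _](restr_ising J P L b h).
  by rewrite (perm_filterC Q).
have := lieb (Some v) [:: a] E0_ge0 E1_ge0.
rewrite big_seq1 -!(moment_perm pE); under eq_bigr do rewrite -!(moment_perm pE).
have z0 := moment_gt0 E0_ge0; have z := moment_gt0 E_ge0.
pose c0 (c : option V) := ic S0 b 0 [:: Some v; c].
have cE0 c : moment E0 [:: Some v; c] = c0 c * moment E0 [::].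
  by rewrite /c0 -icor_bonds /cor divfK// gt_eqF.
have cE A : moment E A = ic L b h A * moment E [::] by rewrite /icor /cor divfK// gt_eqF.
have vS0 : v \in S0 by rewrite mem_filter vS.
have c0_out x : x \notin S -> c0 (Some x) = 0.
  move=> xS; apply: icor_out; last by rewrite mem_filter (negbTE xS).
  by apply: contraNneq xS => ->.
have c0_ghost : c0 None = 0 by exact: icor_ghost0.
have -> : moment E0 [:: Some v; a] = 0.
  by rewrite cE0; case: a aS => [y /c0_out->|_]; rewrite ?c0_ghost mul0r.
rewrite mul0r add0r (cE [:: Some v; a]).
have -> : \sum_(e <- E1) e.2 * (moment E0 [:: Some v; e.1.1] * moment E [:: e.1.2; a] +
            moment E0 [:: Some v; e.1.2] * moment E [:: e.1.1; a]) =
  (\sum_(e <- E1) e.2 * (c0 e.1.1 * ic L b h [:: e.1.2; a] + c0 e.1.2 * ic L b h [:: e.1.1; a])) *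
   (moment E0 [::] * moment E [::]).
  rewrite mulr_suml; apply: eq_bigr => e _.
  by rewrite !cE0 (cE [:: e.1.2; a]) (cE [:: e.1.1; a]); ring.
rewrite mulrCA ler_pM2r ?mulr_gt0// => /le_trans; apply.
pose F y := ic L b h [:: Some y; a].
have F0 y : 0 <= F y by exact: icor_ge0.
have c00 c : 0 <= c0 c by exact: icor_ge0.
have hc x : c0 (Some x) <= ic S b 0 [:: Some v; Some x].
  apply: icor_sub => //; rewrite ?filter_uniq ?fset_uniq//.
  by move=> y; rewrite mem_filter => /andP[].
rewrite /E1 big_filter /E /ising big_cat /= !big_map /=.
apply: lerD.
- rewrite big_mkcond /= sum_pairs /= /Q /=.
  pose k x y := (~~ ((x \in S) && (y \in S)))%:R * (b * halfJ J (x, y)) * (c0 (Some x) * F y).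
  rewrite (eq_bigr (fun x => \sum_(y <- L) k x y + \sum_(y <- L) k y x)); last first.
    move=> x _; rewrite -big_split /=; apply: eq_bigr => y _.
    rewrite /k (halfJ_sym J_sym y) [(y \in S) && _]andbC.
    by case: ifP => _; rewrite ?mul0r ?addr0// !mul1r /F mulrDr.
  rewrite big_split /= [X in _ + X]exchange_big /= -big_split /=.
  apply: (@le_trans _ _ (\sum_(x <- L | x \in S) \sum_(y <- L | y \notin S)
     b * J x y * ic S b 0 [:: Some v; Some x] * ic L b h [:: Some y; a])).
    rewrite [leRHS]big_mkcond /=; apply: ler_sum => x _.
    case: ifPn => xS; last first.
      by rewrite big1 ?addr0// => y _; rewrite /k c0_out// mul0r mulr0.
    rewrite -big_split /= [leRHS]big_mkcond /=; apply: ler_sum => y _.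
    rewrite /k xS /=; case: ifPn => yS; last by rewrite !mul0r addr0.
    rewrite mul1r /halfJ /=; have /negbTE -> : x != y by apply: contraNneq yS => <-.
    rewrite -/(F y); have bJ : 0 <= b * J x y by rewrite mulr_ge0.
    rewrite (_ : _ + _ = b * J x y * c0 (Some x) * F y); last by field.
    by rewrite ler_wpM2r// ler_wpM2l.
  apply: ler_sum_fset_in => x; apply: sumr_ge0 => y _.
  by rewrite mulr_ge0 ?icor_ge0// mulr_ge0 ?icor_ge0// mulr_ge0.
- rewrite mulr_sumr; apply: (@le_trans _ _ (\sum_(x <- L | x \in S) h * (ic S b 0 [:: Some v; Some x] * ic L b h [:: None; a]))).
    rewrite big_mkcond [leRHS]big_mkcond /=; apply: ler_sum => x _.
    rewrite /Q /P /= andbF /= c0_ghost mul0r addr0; case: ifPn => xS; last by rewrite c0_out// mul0r mulr0.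
    by rewrite ler_wpM2l// ler_wpM2r// icor_ge0.
  by apply: ler_sum_fset_in => x; rewrite mulr_ge0// mulr_ge0 ?icor_ge0.
Qed.
End DifferentialInequality.

(** * Infinite volume *)

Section Limits.
Context {R : realType} {V : choiceType}.
Local Open Scope classical_set_scope.

Lemma lim_totally_sup (f g : {fset V} -> R) (c : R) (A : {fset V}) :
  (forall B C : {fset V}, (B `<=` C)%fset -> g B <= g C) ->
  (forall B, g B <= c) ->
  (forall B, (A `<=` B)%fset -> f B = g B) ->
  lim (f @ totally) = sup (range g).
Proof.
move=> gmono gc fg; have FF := @totally_filter V; apply: cvg_lim => //.
have ub : has_ubound (range g) by exists c => _ [B _ <-].
have hs : has_sup (range g) by split => //; exists (g fset0), fset0.
apply/cvgrPdist_le => e e0.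
have [_ [B _ <-] hB] := sup_adherent e0 hs.
exists (A `|` B)%fset => // C /= ABC.
have [AC BC] : (A `<=` C)%fset /\ (B `<=` C)%fset.
  by move: ABC; rewrite fsubUset => /andP[].
rewrite fg// ger0_norm; last by rewrite subr_ge0 ub_le_sup//; exists C.
by have := gmono _ _ BC; lra.
Qed.

Lemma le_sup_totally (g : {fset V} -> R) c B : (forall B, g B <= c) ->
  g B <= sup (range g).
Proof. by move=> gc; apply: ub_le_sup; [exists c => _ [C _ <-]|exists B]. Qed.

Lemma sup_totally_le (g : {fset V} -> R) c : (forall B, g B <= c) ->
  sup (range g) <= c.
Proof. by move=> gc; apply: ge_sup => [|_ [B _ <-]//]; exists (g fset0), fset0. Qed.

Lemma lim_right_inf (F g : R -> R) :
  (forall h, 0 < h -> F h = g h) ->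
  (forall h k, 0 < h -> h <= k -> g h <= g k) -> (forall h, 0 < h -> 0 <= g h) ->
  (forall h, 0 < h -> lim (F h @[h --> 0^'+]) <= g h) /\
  (forall c, (forall h, 0 < h -> c <= g h) -> c <= lim (F h @[h --> 0^'+])).
Proof.
move=> Fg gmono g0.
set I := Interval (BRight (0:R)) +oo%O.
have inI h : (h \in I) = (0 < h) by rewrite in_itv/= andbT.
have hl : has_lbound (F @` [set` I]).
  by exists 0 => _ [h /= hI <-]; rewrite inI in hI; rewrite Fg// g0.
have := @nondecreasing_at_right_cvgr R F 0 +oo%O isT.
rewrite -/I => /(_ _ hl) h.
have -> : lim (F h @[h --> 0^'+]) = inf (F @` [set` I]).
  apply: cvg_lim => //; apply: h => x y; rewrite !inI => x0 y0 xy.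
  by rewrite !Fg// gmono.
split => [k k0|c hc].
  by rewrite -Fg//; apply: ge_inf => //; exists k => //=; rewrite inI.
apply: lb_le_inf; first by exists (F 1), 1 => //=; rewrite inI.
by move=> _ [k /= kI <-]; rewrite inI in kI; rewrite Fg// hc.
Qed.
End Limits.

Section InfiniteVolume.
Context {R : realType} {V : choiceType}.
Variable J : V -> V -> R.
Hypothesis J_ge0 : forall x y, 0 <= J x y.
Implicit Types (L S Y : {fset V}) (b h : R) (o v x y z : V).
Local Open Scope classical_set_scope.

Local Notation ic := (icor J).

(** By the Griffiths inequalities correlations increase with the volume, and the
    limit along all finite volumes is a supremum. *)
Definition vcor b h A := sup (range (fun L : {fset V} => ic L b h A)).

Lemma icor_fsub L S b h A : 0 <= b -> 0 <= h -> (L `<=` S)%fset ->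
  ic L b h A <= ic S b h A.
Proof.
by move=> b0 h0 LS; apply: icor_sub; rewrite ?fset_uniq//; exact: (fsubsetP LS).
Qed.

Lemma icor_vcor L b h A : 0 <= b -> 0 <= h -> ic L b h A <= vcor b h A.
Proof.
by move=> b0 h0; apply: (@le_sup_totally _ _ _ 1) => S; exact: icor_le1.
Qed.

Lemma vcor_le b h A c : (forall L, ic L b h A <= c) -> vcor b h A <= c.
Proof. exact: sup_totally_le. Qed.

Lemma vcor_le_in b h A c S : 0 <= b -> 0 <= h ->
  (forall L, (S `<=` L)%fset -> ic L b h A <= c) -> vcor b h A <= c.
Proof.
move=> b0 h0 hL; apply: vcor_le => L.
apply: le_trans (icor_fsub A b0 h0 (fsubsetUl L S)) _; apply: hL; exact: fsubsetUr.
Qed.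

Lemma vcor_approx b h A e : 0 < e -> 0 <= b -> 0 <= h ->
  exists L, vcor b h A - e < ic L b h A.
Proof.
move=> e0 b0 h0; have [] := @sup_adherent R (range (fun L : {fset V} => ic L b h A)) e e0.
  split; first by exists (ic fset0 b h A), fset0.
  by exists 1 => _ [L _ <-]; exact: icor_le1.
by move=> _ [L _ <-] hL; exists L.
Qed.

Lemma vcor_ge0 b h A : 0 <= b -> 0 <= h -> 0 <= vcor b h A.
Proof.
by move=> b0 h0; apply: le_trans (icor_vcor fset0 A b0 h0); exact: icor_ge0.
Qed.

Lemma vcor_le1 b h A : 0 <= b -> 0 <= h -> vcor b h A <= 1.
Proof. by move=> b0 h0; apply: vcor_le => L; exact: icor_le1. Qed.

Lemma vcor_mono b b' h h' A : 0 <= b -> b <= b' -> 0 <= h -> h <= h' ->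
  vcor b h A <= vcor b' h' A.
Proof.
move=> b0 bb h0 hh; apply: vcor_le => L.
apply: le_trans (icor_le J_ge0 L A b0 bb h0 hh) _.
by apply: icor_vcor; [exact: le_trans bb|exact: le_trans hh].
Qed.

Lemma infinite_volume_spin b h v : 0 <= b -> 0 <= h ->
  infinite_volume J b h (fun s => Defs.spin (s v)) = vcor b h [:: Some v; None].
Proof.
move=> b0 h0; apply: (@lim_totally_sup _ _ _ _ 1 [fset v]%fset).
- by move=> B C; exact: icor_fsub.
- by move=> B; exact: icor_le1.
- by move=> B; rewrite fsub1set => vB; exact: gibbs_spin.
Qed.

Lemma infinite_volume_spin2 b h x y : 0 <= b -> 0 <= h ->
  infinite_volume J b h (fun s => Defs.spin (s x) * Defs.spin (s y)) =
  vcor b h [:: Some x; Some y].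
Proof.
move=> b0 h0; apply: (@lim_totally_sup _ _ _ _ 1 [fset x; y]%fset).
- by move=> B C; exact: icor_fsub.
- by move=> B; exact: icor_le1.
- by move=> B; rewrite fsubUset !fsub1set => /andP[xB yB]; exact: gibbs_spin2.
Qed.

Lemma magnetization_inf b v : 0 <= b ->
  (forall h, 0 < h -> magnetization J b v <= vcor b h [:: Some v; None]) /\
  (forall c, (forall h, 0 < h -> c <= vcor b h [:: Some v; None]) ->
     c <= magnetization J b v).
Proof.
move=> b0; apply: lim_right_inf => [h h0|h k h0 hk|h h0].
- by apply: infinite_volume_spin => //; exact: ltW.
- by apply: vcor_mono => //; exact: ltW.
- by apply: vcor_ge0 => //; exact: ltW.
Qed.

Lemma two_point_inf b x y : 0 <= b ->
  (forall h, 0 < h -> two_point J b x y <= vcor b h [:: Some x; Some y]) /\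
  (forall c, (forall h, 0 < h -> c <= vcor b h [:: Some x; Some y]) ->
     c <= two_point J b x y).
Proof.
move=> b0; apply: lim_right_inf => [h h0|h k h0 hk|h h0].
- by apply: infinite_volume_spin2 => //; exact: ltW.
- by apply: vcor_mono => //; exact: ltW.
- by apply: vcor_ge0 => //; exact: ltW.
Qed.

Lemma magnetization_ge0 b v : 0 <= b -> 0 <= magnetization J b v.
Proof.
move=> b0; have [_] := magnetization_inf v b0; apply => h h0.
by apply: vcor_ge0 => //; exact: ltW.
Qed.
End InfiniteVolume.

(** * The contracting regime *)

Lemma le_linear_error (R : realType) (x y k : R) : 0 <= k ->
  (forall h, 0 < h -> x <= y + h * k) -> x <= y.
Proof.
move=> k0 xy; apply/ler_addgt0Pr => e e0.
have k1 : 0 < k + 1 by rewrite ltr_wpDl.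
apply: le_trans (xy (e / (k + 1)) _) _; first by rewrite divr_gt0.
by rewrite lerD2l mulrAC ler_pdivrMr// ler_pM2l// lerDl.
Qed.

Section Subcritical.
Context {R : realType} {V : choiceType}.
Variable J : V -> V -> R.
Hypothesis J_ge0 : forall x y, 0 <= J x y.
Hypothesis J_sym : forall x y, J x y = J y x.
Implicit Types (L S Y Z : {fset V}) (b h c : R) (o v x y z : V).

Local Notation ic := (icor J).

Definition J_auto (g : V -> V) := bijective g /\ forall x y, J (g x) (g y) = J x y.

Lemma perm_imfset (g : V -> V) S : injective g ->
  perm_eq [fset g x | x in S]%fset (map g S).
Proof.
move=> gI; apply: uniq_perm; rewrite ?fset_uniq ?map_inj_uniq ?fset_uniq//.
move=> x; apply/imfsetP/mapP => [[y /= yS ->]|[y yS ->]]; by exists y.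
Qed.

Lemma icor_image (g : V -> V) L b h A : J_auto g ->
  ic [fset g x | x in L]%fset b h (map (omap g) A) = ic L b h A.
Proof.
move=> [/bij_inj gI gJ]; rewrite (icor_perm _ _ _ _ (perm_imfset L gI)).
exact: icor_map.
Qed.

Lemma vcor_image (g : V -> V) b h A : J_auto g -> 0 <= b -> 0 <= h ->
  vcor J b h A <= vcor J b h (map (omap g) A).
Proof.
move=> gJ b0 h0; apply: vcor_le => L; rewrite -(icor_image L b h A gJ).
exact: icor_vcor.
Qed.

Hypothesis J_hom : forall x y, exists2 g, J_auto g & g x = y.

Lemma vcor_spin_const b h x y : 0 <= b -> 0 <= h ->
  vcor J b h [:: Some x; None] = vcor J b h [:: Some y; None].
Proof.
move=> b0 h0; apply/le_anti/andP; split.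
  by have [g gJ <-] := J_hom x y; exact: (vcor_image [:: Some x; None] gJ).
by have [g gJ <-] := J_hom y x; exact: (vcor_image [:: Some y; None] gJ).
Qed.

(** The quantity phi(S) of Duminil-Copin and Tassion, limited to the bonds that
    end in the finite set [Y] since the sum of all bonds may diverge. *)
Definition outflow b S o Y := \sum_(x <- S) \sum_(y <- Y | y \notin S)
  b * J x y * ic S b 0 [:: Some o; Some x].

Definition contracting b o S c :=
  [/\ o \in S, c < 1 & forall Y, outflow b S o Y <= c].

Lemma outflow_image (g : V -> V) b S o Y : J_auto g ->
  outflow b [fset g x | x in S]%fset (g o) [fset g x | x in Y]%fset = outflow b S o Y.
Proof.
move=> gJ; have [/bij_inj gI gJ'] := gJ; rewrite /outflow.
rewrite (perm_big _ (perm_imfset S gI)) /= big_map; apply: eq_bigr => x _.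
rewrite (perm_big _ (perm_imfset Y gI)) /= big_map; apply: eq_big => y.
  congr (~~ _); apply/imfsetP/idP => [[z /= zS /gI->]//|yS]; by exists y.
by move=> _; rewrite gJ' -(icor_image S b 0 [:: Some o; Some x] gJ).
Qed.

Lemma contracting_image (g : V -> V) b o S c : J_auto g ->
  contracting b o S c -> contracting b (g o) [fset g x | x in S]%fset c.
Proof.
move=> gJ [oS c1 hc]; split => // [|Y]; first by apply/imfsetP; exists o.
have [[f fK gK] _] := gJ.
have -> : Y = [fset g x | x in [fset f y | y in Y]]%fset.
  apply/fsetP => y; apply/idP/imfsetP => [yY|[x /= /imfsetP[z /= zY ->] ->]].
    by exists (f y); rewrite ?gK//; apply/imfsetP; exists y.
  by rewrite gK.
by rewrite outflow_image.
Qed.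

Lemma contracting_ge0 b o S c : contracting b o S c -> 0 <= c.
Proof.
move=> [_ _ /(_ fset0)]; apply: le_trans.
by rewrite /outflow big1// => x _; rewrite big1_seq// => y /andP[_].
Qed.

Lemma sum_icor_le S b o : 0 <= b ->
  \sum_(x <- S) ic S b 0 [:: Some o; Some x] <= #|` S|%:R.
Proof.
move=> b0; apply: (@le_trans _ _ (\sum_(x <- S) 1)).
  by apply: ler_sum => x _; exact: icor_le1.
by rewrite big_const_seq count_predT iter_addr_0.
Qed.

(** One step of the contraction: the outflow weights have total mass at most
    [c], so the correlation with [a] is at most [c] times a bound valid at all
    points reached by one bond leaving [S]. *)
Lemma contraction_step L S b h c v (a : option V) m w : 0 <= b -> 0 <= h ->
  v \in L -> contracting b v S c ->
  (if a is Some z then z \notin S else true) ->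
  (forall x y, x \in S -> y \in L -> y \notin S -> J x y != 0 ->
     ic L b h [:: Some y; a] <= m) -> 0 <= m ->
  ic L b h [:: None; a] <= w -> 0 <= w ->
  ic L b h [:: Some v; a] <= c * m + h * (#|` S|%:R * w).
Proof.
move=> b0 h0 vL [vS c1 hc] aS hm m0 hw w0.
apply: le_trans (lieb_ising J_ge0 J_sym b0 h0 vL vS aS) _.
apply: lerD.
  apply: (@le_trans _ _ (outflow b S v L * m)); last by rewrite ler_wpM2r.
  rewrite mulr_suml big_seq [leRHS]big_seq; apply: ler_sum => x xS.
  rewrite mulr_suml big_seq_cond [leRHS]big_seq_cond; apply: ler_sum => y /andP[yL yS].
  have [Jxy|Jxy] := eqVneq (J x y) 0; first by rewrite Jxy mulr0 !mul0r.
  by rewrite ler_wpM2l ?(hm x)// mulr_ge0 ?icor_ge0// mulr_ge0.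
rewrite ler_wpM2l// -mulr_suml.
apply: le_trans (ler_wpM2l _ hw) _; first by apply: sumr_ge0 => x _; exact: icor_ge0.
by rewrite ler_wpM2r// sum_icor_le.
Qed.

(** The contraction at every point gives M <= c M + h |S|. *)
Lemma magnetization_contracting b o S c : 0 < b -> contracting b o S c ->
  magnetization J b o = 0.
Proof.
move=> b0 hS; have b0' := ltW b0; have [oS c1 hc] := hS.
apply/le_anti; rewrite magnetization_ge0// andbT.
have hM h : 0 < h -> magnetization J b o <= h * (#|` S|%:R / (1 - c)).
  move=> h0; have h0' := ltW h0.
  have [h1 _] := magnetization_inf J_ge0 o b0'; apply: le_trans (h1 h h0) _.
  set M := vcor J b h [:: Some o; None].
  rewrite mulrA ler_pdivlMr ?subr_gt0// mulrBr mulr1 lerBlDr addrC [M * c]mulrC.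
  apply: (@vcor_le_in _ _ _ _ _ _ _ _ S) => // L SL.
  have := @contraction_step L S b h c o None M 1 b0' h0' (fsubsetP SL _ oS) hS isT.
  rewrite mulr1; apply => //.
  - move=> x y _ yL _ _; rewrite /M (vcor_spin_const o y)//; exact: icor_vcor.
  - exact: vcor_ge0.
  - exact: icor_le1.
apply: (@le_linear_error _ _ 0 (#|` S|%:R / (1 - c))) => [|h h0]; last by rewrite add0r hM.
by rewrite divr_ge0// subr_ge0 ltW.
Qed.

Lemma sum_vcor_le (A : V -> seq (option V)) b h c S Z : 0 <= b -> 0 <= h ->
  (forall L, (S `<=` L)%fset -> \sum_(z <- Z) ic L b h (A z) <= c) ->
  \sum_(z <- Z) vcor J b h (A z) <= c.
Proof.
move=> b0 h0 hL; apply/ler_addgt0Pr => e e0.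
pose e' := e / (#|` Z|%:R + 1).
have e'0 : 0 < e' by rewrite divr_gt0// ltr_wpDl.
have [L hZ] : exists L, forall z, z \in enum_fset Z -> vcor J b h (A z) - e' <= ic L b h (A z).
  elim: (enum_fset Z) => [|z s [L hs]]; first by exists fset0.
  have [L' hL'] := vcor_approx J_ge0 (A z) e'0 b0 h0.
  exists (L `|` L')%fset => y; rewrite inE => /orP[/eqP->|ys].
    by apply: le_trans (ltW hL') _; apply: icor_fsub => //; exact: fsubsetUr.
  by apply: le_trans (hs y ys) _; apply: icor_fsub => //; exact: fsubsetUl.
apply: (@le_trans _ _ (\sum_(z <- Z) (ic (L `|` S)%fset b h (A z) + e'))).
  rewrite big_seq [leRHS]big_seq; apply: ler_sum => z zZ.
  rewrite -lerBlDr; apply: le_trans (hZ z zZ) _.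
  by apply: icor_fsub => //; exact: fsubsetUl.
rewrite big_split /= lerD ?hL ?fsubsetUr//.
rewrite big_const_seq count_predT iter_addr_0 -mulr_natl /e' mulrA ler_pdivrMr ?ltr_wpDl//.
by rewrite mulrC ler_pM2l// -/(size _) lerDl.
Qed.

Lemma argmax_seq (s : seq V) (f : V -> R) x0 : x0 \in s ->
  exists2 x, x \in s & forall y, y \in s -> f y <= f x.
Proof.
elim: s x0 => // a [|a' s] IH x0 _; first by exists a; rewrite ?inE// => y; rewrite inE => /eqP->.
have [x xs hx] := IH a' (mem_head _ _).
have [ax|ax] := leP (f a) (f x).
  by exists x; [rewrite inE xs orbT|move=> y; rewrite inE => /orP[/eqP->//|/hx]].
exists a; first exact: mem_head.
by move=> y; rewrite inE => /orP[/eqP->//|/hx/le_trans]; apply; exact: ltW.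
Qed.

(** The contraction is applied to the sum over [z] of the correlations with [z],
    at the point of the volume where this sum is largest. The points [z] close
    to it, where the contraction is not available, number at most |S|. *)
Lemma sum_two_point_contracting b o S c Z : 0 < b -> contracting b o S c ->
  \sum_(z <- Z) two_point J b o z <= #|` S|%:R / (1 - c).
Proof.
move=> b0 hS; have b0' := ltW b0; have [oS c1 hc] := hS; have c0 := contracting_ge0 hS.
pose s : R := #|` S|%:R; pose n : R := #|` Z|%:R.
have s0 : 0 <= s by rewrite /s. have n0 : 0 <= n by rewrite /n.
have hh h : 0 < h -> \sum_(z <- Z) two_point J b o z <= (s + h * (s * n)) / (1 - c).
  move=> h0; have h0' := ltW h0.
  apply: (@le_trans _ _ (\sum_(z <- Z) vcor J b h [:: Some o; Some z])).
    apply: ler_sum => z _; have [h1 _] := two_point_inf J_ge0 o z b0'; exact: h1.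
  apply: (@sum_vcor_le _ _ _ _ [fset o]%fset) => // L; rewrite fsub1set => oL.
  pose chi v := \sum_(z <- Z) ic L b h [:: Some v; Some z].
  have [v vL hv] := argmax_seq chi oL.
  apply: le_trans (hv o oL) _; rewrite ler_pdivlMr ?subr_gt0// mulrBr mulr1 lerBlDr.
  have [g gJ gov] := J_hom o v.
  have hSv := contracting_image gJ hS; rewrite gov in hSv.
  set Sv := [fset g x | x in S]%fset in hSv; have [vS _ hcv] := hSv.
  have sSv : #|` Sv|%:R = s :> R.
    by rewrite /Sv card_imfset//; have [/bij_inj] := gJ.
  apply: (@le_trans _ _ (\sum_(z <- Z) ((z \in Sv)%:R +
     (\sum_(x <- Sv) \sum_(y <- L | y \notin Sv) b * J x y * ic Sv b 0 [:: Some v; Some x] *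
         ic L b h [:: Some y; Some z] + h * s)))).
    apply: ler_sum => z _; have [zS|zS] := boolP (z \in Sv).
      rewrite -[leLHS]addr0; apply: lerD; first exact: icor_le1.
      apply: addr_ge0; last by rewrite mulr_ge0.
      apply: sumr_ge0 => x _; apply: sumr_ge0 => y _.
      by rewrite mulr_ge0 ?icor_ge0// mulr_ge0 ?icor_ge0// mulr_ge0.
    rewrite add0r; apply: le_trans (@lieb_ising _ _ _ J_ge0 J_sym L Sv b h v (Some z) b0' h0' vL vS zS) _.
    rewrite lerD2l ler_wpM2l// -sSv.
    apply: (le_trans _ (sum_icor_le Sv v b0')); apply: ler_sum => x _.
    rewrite -[leRHS]mulr1 ler_wpM2l ?icor_ge0//; exact: icor_le1.
  rewrite big_split /= big_split /= -addrA; apply: lerD.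
    rewrite -sSv; have -> : \sum_(z <- Z) (z \in Sv)%:R = (count (mem Sv) Z)%:R :> R.
      elim: (enum_fset Z) => [|z r IH]; first by rewrite big_nil.
      by rewrite big_cons IH -natrD.
    rewrite ler_nat -size_filter; apply: uniq_leq_size; first by rewrite filter_uniq ?fset_uniq.
    by move=> z; rewrite mem_filter => /andP[].
  rewrite addrC; apply: lerD.
    by rewrite big_const_seq count_predT iter_addr_0 -mulr_natr -mulrA.
  apply: (@le_trans _ _ (outflow b Sv v L * chi v)); last first.
    by rewrite mulrC ler_wpM2l ?hcv// sumr_ge0// => z _; exact: icor_ge0.
  rewrite exchange_big /= mulr_suml; apply: ler_sum => x _.
  rewrite exchange_big /= mulr_suml big_seq_cond [leRHS]big_seq_cond.
  apply: ler_sum => y /andP[yL _]; rewrite -mulr_sumr ler_wpM2l ?hv//.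
  by rewrite mulr_ge0 ?icor_ge0// mulr_ge0.
have c1' : 0 < 1 - c by rewrite subr_gt0.
apply: (@le_linear_error _ _ _ (s * n / (1 - c))) => [|h h0].
  by rewrite divr_ge0 ?mulr_ge0// ltW.
by rewrite mulrA -mulrDl hh.
Qed.
End Subcritical.

(** * Exponential decay at finite range *)

Section GraphDistance.
Context {V : choiceType}.
Variable E : rel V.
Hypothesis E_conn : connected_graph E.
Implicit Types (x y z : V) (p : seq V).

Lemma gdistP x y : (exists2 p, walk E x y p & size p = gdist E x y) /\
  forall p, walk E x y p -> (gdist E x y <= size p)%N.
Proof.
suff [n hn] : exists n, (exists2 p, walk E x y p & size p = n) /\
    (forall p, walk E x y p -> (n <= size p)%N).
  exact: (@xgetPex _ 0%N [set n | (exists2 p, walk E x y p & size p = n) /\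
    (forall p, walk E x y p -> (n <= size p)%N)]%classic (ex_intro _ n hn)).
have ex : exists n, `[< exists2 p, walk E x y p & size p = n >].
  by have [p hp] := E_conn x y; exists (size p); apply/asboolP; exists p.
have [n /asboolP hn nmin] := ex_minnP ex; exists n; split => // p hp.
by apply: nmin; apply/asboolP; exists p.
Qed.

Lemma gdist_triangle x y z : (gdist E x z <= gdist E x y + gdist E y z)%N.
Proof.
have [[p [pp lp] <-] _] := gdistP x y; have [[q [pq lq] <-] _] := gdistP y z.
have [_ h] := gdistP x z; rewrite -size_cat; apply: h; split.
  by rewrite cat_path pp lp pq.
by rewrite last_cat lp lq.
Qed.

Lemma gdist_auto_le g x y : automorphism E g ->
  (gdist E (g x) (g y) <= gdist E x y)%N.
Proof.
move=> [_ gE]; have [[p [pp lp] <-] _] := gdistP x y.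
have [_ h] := gdistP (g x) (g y); rewrite -(size_map g); apply: h; split.
  by rewrite path_map; apply: sub_path pp => a b /=; rewrite gE.
by rewrite last_map lp.
Qed.

Lemma gdist_auto g x y : automorphism E g -> gdist E (g x) (g y) = gdist E x y.
Proof.
move=> gA; apply/eqP; rewrite eqn_leq gdist_auto_le//=.
have [[f fK gK] gE] := gA; rewrite -[X in (gdist E X _ <= _)%N]fK -[X in (gdist E _ X <= _)%N]fK.
apply: gdist_auto_le; split; first by exists g.
by move=> a b; rewrite -gE !gK.
Qed.

Lemma gdist_xx x : gdist E x x = 0%N.
Proof. by have [_ /(_ [::])] := gdistP x x; rewrite leqn0 => h; apply/eqP/h. Qed.
End GraphDistance.

Section FiniteEnergy.
Context {R : realType} {W : choiceType}.
Implicit Types (E : seq (W * W * R)) (o y z : W) (t : R).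

Lemma moment_flip x y t E A : moment ((x, y, t) :: E) A = moment ((y, x, t) :: E) A.
Proof.
by rewrite !moment_cons (@eq_parity_moment _ _ E [:: x, y & A] [:: y, x & A])//; eq_parity_tac.
Qed.

(** By the second Griffiths inequality one bond [(o, y)] moves a correlation
    [X] of [o] to at most [(X + tanh t) / (1 + X * tanh t)]. *)
Lemma finite_energy_cons o y z t E : nng E -> 0 <= t ->
  expR (- (2 * t)) * (1 - cor E [:: o; z]) <= 1 - cor ((o, y, t) :: E) [:: o; z].
Proof.
move=> E0 t0; have c0 := ch_gt0 t; have s0 := sh_ge0 t0.
rewrite cor_cons// (@eq_parity_cor _ _ E [:: o; y; o; z] [:: y; z]); last by eq_parity_tac.
have h1 : cor E [:: o; z] * cor E [:: y; z] <= cor E [:: o; y].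
  rewrite (le_trans (cor_gks2 _ _ E0))// (@eq_parity_cor _ _ _ _ [:: o; y])//; eq_parity_tac.
have h2 := cor_le1 [:: o; z] E0; have h3 := cor_le1 [:: y; z] E0.
have h4 := cor_ge0 [:: o; z] E0; have h5 := cor_ge0 [:: y; z] E0.
have h6 := cor_ge0 [:: o; y] E0; have h7 := cor_le1 [:: o; y] E0.
move: h1 h2 h3 h4 h5 h6 h7.
set X := cor E [:: o; z]; set w := cor E [:: y; z]; set v := cor E [:: o; y].
move=> h1 h2 h3 h4 h5 h6 h7.
have d0 : 0 < ch t + sh t * v by apply: ltr_wpDr => //; exact: mulr_ge0.
have -> : 1 - (ch t * X + sh t * w) / (ch t + sh t * v) =
    (ch t * (1 - X) + sh t * (v - w)) / (ch t + sh t * v).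
  by field; rewrite gt_eqF.
rewrite ler_pdivlMr// mulrAC.
have e1 : expR (- (2 * t)) * (ch t + sh t) = ch t - sh t.
  have -> : ch t + sh t = expR t by rewrite /ch /sh; field.
  have -> : ch t - sh t = expR (- t) by rewrite /ch /sh; field.
  by rewrite -expRD; congr expR; ring.
have k0 := expR_ge0 (- (2 * t)).
have e2 : expR (- (2 * t)) * (ch t + sh t * v) <= ch t - sh t.
  by rewrite -e1 ler_wpM2l// lerD2l ler_piMr.
have h8 : - (1 - X) <= v - w.
  have : 0 <= (1 - X) * (1 - w) by rewrite mulr_ge0// subr_ge0.
  lra.
have h9 : 0 <= sh t * (v - w + (1 - X)) by rewrite mulr_ge0//; lra.
have h10 : 0 <= (1 - X) * (ch t - sh t - expR (- (2 * t)) * (ch t + sh t * v)).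
  by rewrite mulr_ge0// subr_ge0.
lra.
Qed.

Lemma finite_energy o z E1 E : nng E1 -> nng E ->
  all (fun e => (e.1.1 == o) || (e.1.2 == o)) E1 ->
  expR (- (2 * \sum_(e <- E1) e.2)) * (1 - cor E [:: o; z]) <=
  1 - cor (E1 ++ E) [:: o; z].
Proof.
move=> E10 E0; elim: E1 E10 => [|[[x y] t] E1 IH] /=.
  by rewrite big_nil mulr0 oppr0 expR0 mul1r.
move=> /andP[t0 E10] /andP[xyo E1o]; rewrite big_cons /= [2 * _]mulrDr opprD expRD -mulrA.
apply: le_trans (ler_wpM2l (expR_ge0 _) (IH E10 E1o)) _.
have h : nng (E1 ++ E) by rewrite nng_cat E10.
case/orP: xyo => /eqP->; first exact: finite_energy_cons.
rewrite [X in _ <= 1 - X](_ : _ = cor ((o, x, t) :: E1 ++ E) [:: o; z]); last first.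
  by rewrite /cor !(moment_flip x o).
exact: finite_energy_cons.
Qed.
End FiniteEnergy.

Section ExponentialDecay.
Context {R : realType} {V : choiceType}.
Variable J : V -> V -> R.
Hypothesis J_ge0 : forall x y, 0 <= J x y.
Hypothesis J_sym : forall x y, J x y = J y x.
Implicit Types (L S Y Z : {fset V}) (b h c : R) (o v x y z : V).
Local Notation ic := (icor J).

(** Without the bonds at [o], whose total weight is at most [B + h], the spin at
    [o] would be uncorrelated with the others. *)
Lemma icor_finite_energy L b h o z B : 0 <= b -> 0 <= h -> o \in L -> z != o ->
  \sum_(y <- L | y != o) b * J o y <= B ->
  ic L b h [:: Some o; Some z] <= 1 - expR (- (2 * (B + h))).
Proof.
move=> b0 h0 oL zo hB; set E := ising J L b h.
pose q (e : option V * option V * R) := (e.1.1 == Some o) || (e.1.2 == Some o).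
have E0 : nng E by exact: nng_ising.
have pE : perm_eq E ([seq e <- E | q e] ++ [seq e <- E | ~~ q e]).
  by rewrite perm_sym (perm_filterC q).
have n1 : nng [seq e <- E | q e] by exact: nng_filter.
have n2 : nng [seq e <- E | ~~ q e] by exact: nng_filter.
have := @finite_energy _ _ (Some o) (Some z) _ _ n1 n2 (filter_all _ _).
rewrite -(cor_perm _ pE) -/(icor J L b h _).
have -> : cor [seq e <- E | ~~ q e] [:: Some o; Some z] = 0.
  rewrite /cor (@moment_odd _ _ (pred1 (Some o))) ?mul0r//=.
    by rewrite all_filter; apply/allP => e _ /=; apply/implyP; rewrite negb_or => /andP[/negbTE-> /negbTE->].
  by rewrite eqxx (inj_eq Some_inj) (negbTE zo).
rewrite subr0 mulr1 => h1; rewrite lerBrDl -lerBrDr; apply: le_trans h1.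
rewrite ler_expR lerN2 ler_pM2l// big_filter /E /ising big_cat /= !big_map /=.
apply: lerD; last first.
  rewrite big_mkcond /= (bigD1_seq o) ?fset_uniq//= /q /= eqxx /= big1 ?addr0// => x xo.
  by rewrite (inj_eq Some_inj) (negbTE xo).
apply: le_trans hB; rewrite /q /= big_mkcond /= sum_pairs.
apply: (@le_trans _ _ (\sum_(x <- L) \sum_(y <- L) ((x == o)%:R * (b * halfJ J (x, y)) + (y == o)%:R * (b * halfJ J (y, x))))).
  apply: ler_sum => x _; apply: ler_sum => y _ /=.
  rewrite !(inj_eq Some_inj) (halfJ_sym J_sym y).
  have k0 : 0 <= b * halfJ J (x, y) by rewrite mulr_ge0 ?halfJ_ge0.
  by case: (x == o); case: (y == o); rewrite /= ?mul1r ?mul0r ?addr0 ?add0r// lerDl.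
rewrite (eq_bigr (fun x => \sum_(y <- L) (x == o)%:R * (b * halfJ J (x, y)) +
    \sum_(y <- L) (y == o)%:R * (b * halfJ J (y, x)))) => [|x _]; last by rewrite big_split.
rewrite big_split /= [X in _ + X]exchange_big /=.
have -> : \sum_(x <- L) \sum_(y <- L) (x == o)%:R * (b * halfJ J (x, y)) =
    \sum_(y <- L) b * halfJ J (o, y).
  rewrite (bigD1_seq o) ?fset_uniq//= [X in _ + X]big1 ?addr0.
    by apply: eq_bigr => y _; rewrite eqxx mul1r.
  by move=> x /negbTE xo; rewrite big1// => y _; rewrite xo mul0r.
rewrite -big_split /= [leRHS]big_mkcond /=; apply: ler_sum => y _.
rewrite /halfJ /= eq_sym; case: eqP => _ /=; first by rewrite !mulr0 addr0.
by rewrite le_eqVlt; apply/orP; left; apply/eqP; field.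
Qed.
End ExponentialDecay.

Lemma nat_block (rho d : nat) : (0 < rho)%N -> (2 * rho < d)%N ->
  exists n, [/\ (0 < n)%N, (n * rho < d)%N & (d <= n * (2 * rho))%N].
Proof.
move=> rho0 dr; exists (d.-1 %/ rho)%N.
have h1 := leq_divM d.-1 rho; have h2 := ltn_ceil d.-1 rho0.
have n0 : (0 < d.-1 %/ rho)%N by rewrite divn_gt0//; lia.
by split => //; nia.
Qed.

Section FiniteRange.
Context {R : realType} {V : choiceType}.
Variables (J : V -> V -> R) (E : rel V).
Hypothesis J_ge0 : forall x y, 0 <= J x y.
Hypothesis J_sym : forall x y, J x y = J y x.
Hypothesis E_conn : connected_graph E.
Hypothesis J_hom : forall x y, exists g, [/\ J_auto J g, automorphism E g & g x = y].
Implicit Types (L S Y Z : {fset V}) (b h c : R) (o v x y z : V).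
Local Notation ic := (icor J).

(** Each contraction moves the starting point by at most [rho] and gains a
    factor [c], as long as [z] is out of reach. *)
Lemma icor_decay b o S c (rho : nat) : 0 <= b -> contracting J b o S c ->
  (forall x, x \in S -> (gdist E o x <= rho)%N) ->
  (forall x y, x \in S -> J x y != 0 -> (gdist E o y <= rho)%N) ->
  forall h L v z n, 0 <= h -> v \in L -> (n * rho < gdist E v z)%N ->
  ic L b h [:: Some v; Some z] <= c ^+ n + h * (#|` S|%:R / (1 - c)).
Proof.
move=> b0 hS S_rho J_rho h L v z n h0; have [oS c1 _] := hS; have c0 := contracting_ge0 hS.
set s : R := #|` S|%:R; have s0 : 0 <= s by rewrite /s.
have c1' : 0 < 1 - c by rewrite subr_gt0.
have k0 : 0 <= h * (s / (1 - c)) by rewrite mulr_ge0// divr_ge0// ltW.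
elim: n v => [|n IH] v vL dvz.
  by rewrite expr0 -[leLHS]addr0 lerD ?icor_le1.
have [g [gJ gE gov]] := J_hom o v.
have hSv := contracting_image gJ hS; rewrite gov in hSv.
set Sv := [fset g x | x in S]%fset in hSv.
have sSv : #|` Sv|%:R = s :> R by rewrite /Sv card_imfset//; have [/bij_inj] := gJ.
have Sv_rho x : x \in Sv -> (gdist E v x <= rho)%N.
  by move=> /imfsetP[x' /= x'S ->]; rewrite -gov gdist_auto// S_rho.
have zS : z \notin Sv.
  by apply/negP => /Sv_rho; rewrite leqNgt (leq_ltn_trans _ dvz)// mulSn leq_addr.
apply: (@le_trans _ _ (c * (c ^+ n + h * (s / (1 - c))) + h * (s * 1))).
  rewrite -sSv; apply: (@contraction_step _ _ _ J_ge0 J_sym L Sv b h c v (Some z)) => //.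
  - move=> x y /imfsetP[x' /= x'S ->] yL _ Jxy; rewrite sSv; apply: IH => //.
    have [[f fK gK] gJ'] := gJ.
    have dvy : (gdist E v y <= rho)%N.
      by rewrite -(gK y) -gov gdist_auto// (J_rho x')// -gJ' gK.
    rewrite -(ltn_add2l rho) -mulSn; apply: (leq_trans dvz).
    by apply: (leq_trans (gdist_triangle E_conn v y z)); rewrite leq_add2r.
  - by rewrite sSv addr_ge0// exprn_ge0.
  - exact: icor_le1.
rewrite le_eqVlt; apply/orP; left; apply/eqP; rewrite exprS; field.
by rewrite gt_eqF.
Qed.

(** Bonds from [o] to the outside of [S] are part of the outflow, since [o] is
    perfectly correlated with itself. *)
Lemma contracting_bond_sum b o S c Y : 0 <= b -> contracting J b o S c ->
  \sum_(y <- Y | y != o) b * J o y <= c + \sum_(y <- S) b * J o y.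
Proof.
move=> b0 hS; have [oS c1 hc] := hS.
have bJ y : 0 <= b * J o y by rewrite mulr_ge0.
rewrite (bigID (fun y => y \in S)) /= addrC; apply: lerD.
  apply: le_trans (hc Y); rewrite /outflow (bigD1_seq o) ?fset_uniq//=.
  rewrite (@le_trans _ _ (\sum_(y <- Y | y \notin S) b * J o y * ic S b 0 [:: Some o; Some o]))//.
    rewrite big_mkcond [leRHS]big_mkcond /=; apply: ler_sum => y _.
    have -> : ic S b 0 [:: Some o; Some o] = 1 by apply: cor_xx; exact: nng_ising.
    rewrite mulr1; case: (boolP (y \in S)) => yS /=; rewrite ?andbF// andbT.
    by case: ifP.
  rewrite lerDl; apply: sumr_ge0 => x _; apply: sumr_ge0 => y _.
  by rewrite mulr_ge0 ?icor_ge0// mulr_ge0.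
apply: (@le_trans _ _ (\sum_(y <- Y | y \in S) b * J o y)).
  by rewrite big_mkcond [leRHS]big_mkcond /=; apply: ler_sum => y _; case: (y != o); case: (y \in S); rewrite /= ?bJ.
exact: ler_sum_fset_in.
Qed.

(** Distant points are reached by a number of contractions proportional to the
    distance. The bound has no prefactor, so near points need a correlation
    bounded away from 1, which is [icor_finite_energy]. *)
Lemma two_point_decay b o S c : 0 < b -> contracting J b o S c ->
  finite_range E J -> exists2 k, 0 < k &
  forall x, two_point J b o x <= expR (- k * (gdist E o x)%:R).
Proof.
move=> b0 hS [r r0 Jr]; have b0' := ltW b0; have [oS c1 _] := hS.
have c0 := contracting_ge0 hS.
pose D := \max_(x <- S) gdist E o x.
have hD x : x \in S -> (gdist E o x <= D)%N.
  by move=> xS; rewrite /D (big_rem x)//= leq_maxl.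
pose rho := (D + Num.truncn r).+1.
have S_rho x : x \in S -> (gdist E o x <= rho)%N.
  by move=> /hD h; rewrite /rho; lia.
have J_rho x y : x \in S -> J x y != 0 -> (gdist E o y <= rho)%N.
  move=> /hD h Jxy; have := gdist_triangle E_conn o x y.
  suff : (gdist E x y <= Num.truncn r)%N by rewrite /rho; lia.
  rewrite leqNgt; apply: contraNN Jxy => hr; apply/eqP/Jr.
  by rewrite (lt_le_trans (truncnS_gt _))// ler_nat.
have [B hB] : exists B, forall Y, \sum_(y <- Y | y != o) b * J o y <= B.
  by eexists => Y; exact: (contracting_bond_sum Y b0' hS).
have tp_le x h : 0 < h -> two_point J b o x <= vcor J b h [:: Some o; Some x].
  by move=> h0; have [H _] := two_point_inf J_ge0 o x b0'; exact: H.
pose t := 1 - expR (- (2 * (B + 1))).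
have t1 : t < 1 by rewrite /t ltrBlDr ltrDl expR_gt0.
have near z : z != o -> two_point J b o z <= t.
  move=> zo; apply: le_trans (tp_le z 1 ltr01) _.
  apply: (@vcor_le_in _ _ _ J_ge0 _ _ _ _ [fset o]%fset) => // L; rewrite fsub1set => oL.
  exact: icor_finite_energy.
have far z n : (n * rho < gdist E o z)%N -> two_point J b o z <= c ^+ n.
  move=> dz; set k := #|` S|%:R / (1 - c).
  have k0 : 0 <= k by rewrite divr_ge0// subr_ge0 ltW.
  apply: (le_linear_error k0) => h h0; apply: le_trans (tp_le z h h0) _.
  apply: (@vcor_le_in _ _ _ J_ge0 _ _ _ _ [fset o]%fset) => //; first exact: ltW.
  move=> L; rewrite fsub1set => oL.
  exact: (icor_decay b0' hS S_rho J_rho (ltW h0) oL dz).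
(* Any rate in ]0, 1[ above t and c would do; 2^-1 keeps it positive. *)
pose q := Num.max t (Num.max c 2^-1).
have q0 : 0 < q by rewrite /q !lt_max invr_gt0 ltr0n !orbT.
have q1 : q < 1 by rewrite /q !gt_max t1 c1/= invf_lt1// ltr1n.
have lq : 0 < - ln q by rewrite oppr_gt0 ln_lt0// q0.
have rho0 : 0 < rho%:R :> R by rewrite ltr0n.
exists (- ln q / (2 * rho%:R)); first by rewrite divr_gt0// mulr_gt0.
move=> z; have [->|zo] := eqVneq z o.
  rewrite gdist_xx// mulr0 expR0.
  by apply: le_trans (tp_le o 1 ltr01) _; exact: vcor_le1.
have qE n : q ^+ n = expR (n%:R * ln q) by rewrite expRM_natl lnK.
set d := gdist E o z.
have key (n : nat) : (0 < n)%N -> (d <= n * (2 * rho))%N -> two_point J b o z <= q ^+ n ->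
    two_point J b o z <= expR (- (- ln q / (2 * rho%:R)) * d%:R).
  move=> n0 dn h; apply: le_trans h _; rewrite qE ler_expR.
  have -> : - (- ln q / (2 * rho%:R)) * d%:R = ln q * d%:R / (2 * rho%:R) by ring.
  rewrite ler_pdivlMr ?mulr_gt0//.
  have : d%:R <= n%:R * (2 * rho%:R) :> R by rewrite -!natrM ler_nat.
  nra.
have [dr|dr] := leqP d (2 * rho).
  apply: (key 1%N) => //; first (by rewrite mul1n); rewrite expr1; apply: le_trans (near z zo) _.
  by rewrite /q le_max lexx.
have [n [n0 nd dn]] := nat_block (isT : (0 < rho)%N) dr.
apply: (key n) => //; apply: le_trans (far z n nd) _.
have cq : c <= q by rewrite /q !le_max lexx orbT.
by apply: lerXn2r => //; rewrite nnegrE ltW.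
Qed.
End FiniteRange.

(** * Integration of the differential inequality *)

Section DiscreteODE.
Context {R : realType}.
Variables (M : R -> R) (b0 b1 C : R).
Hypothesis b0_gt0 : 0 < b0.
Hypothesis C_ge0 : 0 <= C.
Hypothesis M_gt0 : 0 < M b0.
Hypothesis M_le1 : forall s, b0 <= s -> M s <= 1.
Hypothesis M_mono : forall s t, b0 <= s -> s <= t -> M s <= M t.
Hypothesis M_step : forall s t, b0 <= s -> s < t -> t <= b1 ->
  (t - s) / t * (1 - M t ^+ 2) <= (M t + C * (t - s)) * (M t - M s).

(** Here [b] and [a] are the values of [M] after and before a step, [X] is [1 -
    b ^+ 2] and [r] the relative length of the step. For [a] close to [b] the
    increment of the square is nearly [2 * b * (b - a)]; otherwise the jump of
    [M] exceeds by far the length [r] of the step. *)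
Lemma square_increment (a b r X c e : R) : 0 < e -> e <= 2^-1 -> 0 <= a ->
  a <= b -> 0 <= X -> X <= 1 -> 0 <= r -> 2 * r <= b ^+ 2 * e ->
  0 <= c -> c <= e * b -> r * X <= (b + c) * (b - a) ->
  (2 - 3 * e) * (r * X) <= b ^+ 2 - a ^+ 2.
Proof.
move=> e0 e2 a0 ab X0 X1 r0 hr c0 hc h.
have rX0 : 0 <= r * X by rewrite mulr_ge0.
have b_ge0 : 0 <= b by exact: le_trans ab.
(* No jump, or a jump larger than e * b. *)
have [ae|ae] := leP ((1 - e) * b) a.
  have h1 : r * X <= (1 + e) * (b * (b - a)).
    apply: le_trans h _; rewrite mulrA ler_wpM2r ?subr_ge0//; lra.
  have h2 : (2 - e) * (b * (b - a)) <= b ^+ 2 - a ^+ 2.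
    rewrite subr_sqr [leRHS]mulrC mulrA ler_wpM2r ?subr_ge0//; lra.
  set u := b * (b - a) in h1 h2; have u0 : 0 <= u by rewrite mulr_ge0// subr_ge0.
  apply: le_trans h2.
  have k0 : 0 <= 2 - 3 * e by lra.
  apply: le_trans (ler_wpM2l k0 h1) _; rewrite mulrA ler_wpM2r//.
  have := sqr_ge0 e; rewrite expr2; lra.
have e1 : 0 <= 1 - e by lra.
have h3 : a ^+ 2 <= ((1 - e) * b) ^+ 2.
  by apply: lerXn2r; rewrite ?nnegrE ?mulr_ge0// ltW.
have h4 : r * X <= r by rewrite ler_piMr.
have h5 : (2 - 3 * e) * (r * X) <= 2 * r.
  apply: (@le_trans _ _ (2 * (r * X))); first by rewrite ler_wpM2r//; lra.
  by rewrite ler_wpM2l.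
have h6 : 0 <= b ^+ 2 * e * (1 - e) := mulr_ge0 (mulr_ge0 (sqr_ge0 b) (ltW e0)) e1.
have : ((1 - e) * b) ^+ 2 = b ^+ 2 - b ^+ 2 * e - b ^+ 2 * e * (1 - e) by ring.
lra.
Qed.

Let Phi s := (1 - M s ^+ 2) * s ^+ 2.

(** In the limit of small steps the hypothesis on [M] says that [M * M' >= (1 -
    M ^+ 2) / s], which makes [Phi] nonincreasing. *)
Lemma Phi_step e : 0 < e -> e <= 2^-1 -> exists2 eta, 0 < eta &
  forall s t, b0 <= s -> s < t -> t <= b1 -> t - s <= eta ->
  Phi t - Phi s <= 6 * e * b1 * (t - s).
Proof.
move=> e0 e2; pose m := M b0; have m0 : 0 < m := M_gt0.
(* The three bounds make the relative step small, then small against M ^ 2, and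
   the error C * (t - s) small against M. *)
pose eta := Num.min (e * b0) (Num.min (m ^+ 2 * e * b0 / 2) (e * m / (C + 1))).
have C1 : 0 < C + 1 by rewrite ltr_wpDl.
exists eta.
  rewrite /eta !lt_min; apply/and3P; split; rewrite ?divr_gt0 ?mulr_gt0 ?exprn_gt0//.
move=> s t b0s st tb1; rewrite /eta !le_min => /and3P[h1 h2 h3].
have s0 : 0 < s := lt_le_trans b0_gt0 b0s; have t0 : 0 < t := lt_trans s0 st.
have b0t : b0 <= t := le_trans b0s (ltW st).
set r := (t - s) / t; have r0 : 0 <= r by apply: divr_ge0; rewrite ?subr_ge0 ltW.
have rt : r * t = t - s by rewrite /r divfK// gt_eqF.
have ms : m <= M s by exact: M_mono.
have st' : M s <= M t by apply: M_mono => //; exact: ltW.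
have mt : m <= M t by exact: le_trans st'.
have mt0 : 0 < M t := lt_le_trans m0 mt.
have m2 : m ^+ 2 <= M t ^+ 2 by apply: lerXn2r => //; rewrite nnegrE ltW.
have re : r <= e.
  rewrite /r ler_pdivrMr// (le_trans h1)// ler_pM2l//.
have rm : 2 * r <= M t ^+ 2 * e.
  apply: (@le_trans _ _ (m ^+ 2 * e)); last by rewrite ler_pM2r.
  rewrite -ler_pdivlMl// /r ler_pdivrMr//.
  apply: le_trans h2 _.
  have : m ^+ 2 * e * b0 <= m ^+ 2 * e * t by rewrite ler_wpM2l// mulr_ge0 ?sqr_ge0// ltW.
  lra.
have cm : C * (t - s) <= e * M t.
  apply: (@le_trans _ _ ((C + 1) * (t - s))).
    by apply: ler_wpM2r; [rewrite subr_ge0 ltW|rewrite lerDl].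
  rewrite mulrC -ler_pdivlMr//; apply: le_trans h3 _.
  by rewrite ler_pM2r ?invr_gt0// ler_pM2l.
have X1 : M t <= 1 by exact: M_le1.
have X0 : 0 <= 1 - M t ^+ 2.
  by rewrite subr_ge0 expr_le1// ltW.
have hs := M_step b0s st tb1; rewrite -/r in hs.
have := @square_increment (M s) (M t) r (1 - M t ^+ 2) (C * (t - s)) e e0 e2
   (le_trans (ltW M_gt0) ms) st' X0.
rewrite lerBlDl lerDr sqr_ge0 => /(_ isT r0 rm _ cm hs).
rewrite mulr_ge0 ?subr_ge0 ?(ltW st)// => /(_ isT) h.
rewrite /Phi; have es : s = t * (1 - r) by rewrite mulrBr mulr1 [t * r]mulrC rt; lra.
set X := 1 - M t ^+ 2 in X0 h.
have hX : X * (1 + (2 - 3 * e) * r) <= 1 - M s ^+ 2.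
  have -> : X * (1 + (2 - 3 * e) * r) = X + (2 - 3 * e) * (r * X) by ring.
  by rewrite /X in h *; lra.
have h4 : X * (1 + (2 - 3 * e) * r) * s ^+ 2 <= (1 - M s ^+ 2) * s ^+ 2.
  by rewrite ler_wpM2r// sqr_ge0.
apply: (@le_trans _ _ (X * t ^+ 2 - X * (1 + (2 - 3 * e) * r) * s ^+ 2)); first by rewrite lerD2l lerN2.
have -> : X * t ^+ 2 - X * (1 + (2 - 3 * e) * r) * s ^+ 2 =
   X * t ^+ 2 * (r * (3 * e + (3 - 6 * e) * r - (2 - 3 * e) * r ^+ 2)).
  by rewrite es; ring.
have hXt : X * t ^+ 2 <= t ^+ 2.
  by rewrite ler_piMl ?sqr_ge0// /X lerBlDr lerDl sqr_ge0.
have h5 : 3 * e + (3 - 6 * e) * r - (2 - 3 * e) * r ^+ 2 <= 6 * e.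
  have : 0 <= (2 - 3 * e) * r ^+ 2 by rewrite mulr_ge0 ?sqr_ge0//; lra.
  have : 0 <= e * r by rewrite mulr_ge0// ltW.
  lra.
apply: (@le_trans _ _ (X * t ^+ 2 * (r * (6 * e)))).
  by apply: ler_wpM2l; [exact: mulr_ge0 X0 (sqr_ge0 t)|exact: ler_wpM2l].
apply: (@le_trans _ _ (t ^+ 2 * (r * (6 * e)))).
  by apply: ler_wpM2r => //; apply: mulr_ge0 => //; apply: mulr_ge0 => //; exact: ltW.
have -> : t ^+ 2 * (r * (6 * e)) = 6 * e * t * (t - s) by rewrite -rt; ring.
apply: ler_wpM2r; first by rewrite subr_ge0 ltW.
by apply: ler_wpM2l => //; apply: mulr_ge0 => //; exact: ltW.
Qed.

(** [M] may jump, so the differential inequality is used in the form of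
    increments along a subdivision of the interval from [b0] to [b1], whose mesh
    tends to 0. *)
Lemma discrete_ode : b0 <= b1 -> (1 - M b1 ^+ 2) * b1 ^+ 2 <= b0 ^+ 2.
Proof.
rewrite le_eqVlt => /predU1P[<-|b01].
  by rewrite ler_piMl ?sqr_ge0// lerBlDr lerDl sqr_ge0.
have b1_gt0 := lt_trans b0_gt0 b01.
have small e : 0 < e -> e <= 2^-1 -> Phi b1 - Phi b0 <= 6 * e * b1 * (b1 - b0).
  move=> e0 e2; have [eta eta0 step] := Phi_step e0 e2.
  pose n := (Num.truncn ((b1 - b0) / eta)).+1.
  pose dl := (b1 - b0) / n%:R.
  have n0 : 0 < n%:R :> R by rewrite ltr0n.
  have dl0 : 0 < dl by rewrite divr_gt0// subr_gt0.
  have dle : dl <= eta.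
    rewrite /dl ler_pdivrMr// mulrC -ler_pdivrMr// ltW// truncnS_gt//.
  have ndl : n%:R * dl = b1 - b0 by rewrite /dl mulrC divfK// gt_eqF.
  suff h k : (k <= n)%N -> Phi (b0 + k%:R * dl) - Phi b0 <= 6 * e * b1 * (k%:R * dl).
    by have := h n (leqnn n); rewrite ndl (_ : b0 + (b1 - b0) = b1)//; ring.
  elim: k => [|k IH] kn; first by rewrite mul0r addr0 subrr mulr0.
  have ek : k.+1%:R * dl = k%:R * dl + dl by rewrite -natr1 mulrDl mul1r.
  have kd : 0 <= k%:R * dl by rewrite mulr_ge0// ltW.
  have := step (b0 + k%:R * dl) (b0 + k.+1%:R * dl).
  rewrite lerDl kd ek ltrD2l ltrDl dl0 => /(_ isT isT).
  have -> : b0 + (k%:R * dl + dl) <= b1.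
    rewrite -ek -lerBrDl -ndl ler_pM2r// ler_nat//.
  rewrite (_ : b0 + (k%:R * dl + dl) - (b0 + k%:R * dl) = dl); last by ring.
  move=> /(_ isT dle); have := IH (ltnW kn).
  have -> : 6 * e * b1 * (k%:R * dl + dl) = 6 * e * b1 * (k%:R * dl) + 6 * e * b1 * dl by ring.
  lra.
have h : Phi b1 <= Phi b0.
  apply/ler_addgt0Pl => e e0.
  pose k := 6 * b1 * (b1 - b0).
  have k0 : 0 < k by rewrite !mulr_gt0// subr_gt0.
  (* The total error of a subdivision with parameter e is k * e. *)
  pose e' := Num.min 2^-1 (e / k).
  have e'0 : 0 < e' by rewrite lt_min invr_gt0 ltr0n divr_gt0.
  have e'2 : e' <= 2^-1 by rewrite ge_min lexx.
  have := small e' e'0 e'2; have : k * e' <= e.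
    by rewrite mulrC -ler_pdivlMr// ge_min lexx orbT.
  rewrite /k; lra.
apply: le_trans h _; rewrite /Phi ler_piMl ?sqr_ge0//.
by rewrite lerBlDr lerDl sqr_ge0.
Qed.
End DiscreteODE.

(** * Infinite bond sums *)

Lemma perm_shuffle (T : eqType) (A B D F : seq T) (e f : T) :
  perm_eq ((A ++ ((e :: D) ++ B)) ++ (f :: F)) ((A ++ D) ++ (e :: f :: (B ++ F))).
Proof.
apply/permP => q; rewrite !count_cat /= !count_cat.
move: (count q A) (count q B) (count q D) (count q F) (q e : nat) (q f : nat).
by clear; lia.
Qed.

Section Star.
Context {R : realType}.

Lemma tanh_ge (K : R) : 0 <= K -> K / (1 + K) <= sh K / ch K.
Proof.
move=> K0; have c0 := ch_gt0 K; have k1 : 0 < 1 + K by rewrite ltr_wpDr.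
rewrite ler_pdivrMr// mulrAC ler_pdivlMr//.
have e1 := ch_sub_sh K.
have e2 : expR (- K) <= 1 by rewrite -expR0 ler_expR oppr_le0.
have := ler_wpM2l K0 e2; have := sh_ge K0; rewrite -e1; lra.
Qed.

(** A spin [y] with no other bond transmits the magnetic field to [o] through the
    two bonds [(o, y)] and [(y, g)] in series. *)
Lemma series_bonds (W : choiceType) (E : seq (W * W * R)) (o g y : W) (K h : R) :
  nng E -> 0 <= K -> 0 <= h -> y != o -> y != g ->
  all (fun e => (e.1.1 != y) && (e.1.2 != y)) E ->
  1 - cor [:: (o, y, K), (y, g, h) & E] [:: o; g] <=
  (1 - cor E [:: o; g]) * (1 - K / (1 + K) * (sh h / ch h)).
Proof.
move=> E0 K0 h0 yo yg Ey; have c0 := ch_gt0 K; have c0' := ch_gt0 h.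
have s0 := sh_ge0 K0; have s0' := sh_ge0 h0.
have Ey0 A : odd (count_mem y A) -> cor E A = 0.
  move=> oA; rewrite /cor (@moment_odd _ _ (pred1 y))// ?mul0r//.
  by apply: sub_all Ey => e /andP[/negbTE /= -> /negbTE ->].
set E1 := (y, g, h) :: E; have E10 : nng E1 by rewrite /= h0.
have oy : (o == y) = false by rewrite eq_sym (negbTE yo).
have gy : (g == y) = false by rewrite eq_sym (negbTE yg).
set m := cor E [:: o; g]; set th := sh h / ch h.
have m_ge0 : 0 <= m by exact: cor_ge0.
have m_le1 : m <= 1 by exact: cor_le1.
have th0 : 0 <= th by rewrite divr_ge0// ltW.
have z1 : cor E [:: y; g] = 0 by apply: Ey0; rewrite /= eqxx gy.
have c1 : cor E1 [:: o; g] = m.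
  rewrite cor_cons// (Ey0 [:: y; g; o; g]) ?z1; last by rewrite /= eqxx gy oy.
  by rewrite !mulr0 !addr0 -/m mulrC mulKf// gt_eqF.
have c2 : cor E1 [:: o; y; o; g] = th.
  rewrite (@eq_parity_cor _ _ E1 _ [:: y; g]); last by eq_parity_tac.
  rewrite cor_cons// z1 (@eq_parity_cor _ _ E [:: y; g; y; g] [::]); last by eq_parity_tac.
  by rewrite cor_nil// !mulr0 !mulr1 addr0 add0r.
have c3 : cor E1 [:: o; y] = th * m.
  rewrite cor_cons// z1 Ey0 ?mulr0 ?add0r ?addr0; last by rewrite /= eqxx oy.
  rewrite (@eq_parity_cor _ _ E [:: y; g; o; y] [:: o; g]) -/m; last by eq_parity_tac.
  by rewrite mulrAC.
rewrite cor_cons// c1 c2 c3.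
have d0 : 0 < ch K + sh K * (th * m) by apply: ltr_wpDr => //; apply: mulr_ge0 => //; exact: mulr_ge0.
have -> : 1 - (ch K * m + sh K * th) / (ch K + sh K * (th * m)) =
   (1 - m) * ((ch K - sh K * th) / (ch K + sh K * (th * m))).
  by field; rewrite gt_eqF.
rewrite ler_wpM2l ?subr_ge0//; apply: (@le_trans _ _ (1 - sh K / ch K * th)).
  have k0 : 0 <= sh K * (th * m) by apply: mulr_ge0 => //; exact: mulr_ge0.
  have t1 : th <= 1 := tanh_le1 h.
  rewrite ler_pdivrMr// [leRHS](_ : _ = ch K - sh K * th + (1 - sh K / ch K * th) * (sh K * (th * m))); last first.
    by field; rewrite gt_eqF.
  have q0 : 0 <= sh K / ch K by apply: divr_ge0 => //; exact: ltW.
  have q1 := tanh_le1 K.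
  by rewrite lerDl mulr_ge0// subr_ge0 mulr_ile1.
by rewrite lerD2l lerN2 ler_wpM2r// tanh_ge.
Qed.

Context {V : choiceType}.
Variable J : V -> V -> R.
Hypothesis J_ge0 : forall x y, 0 <= J x y.
Implicit Types (L S Y Z : {fset V}) (b h : R) (o v x y z : V).

(** Of all bonds at the new point, keep its field and one of the two halves of
    its bond with [o]; the others only increase the magnetization. *)
Lemma icor_add_vertex (s : seq V) b h o y : 0 <= b -> 0 <= h ->
  o \in s -> y \notin s ->
  1 - icor J (y :: s) b h [:: Some o; None] <=
  (1 - icor J s b h [:: Some o; None]) *
    (1 - (b / 2 * J o y) / (1 + b / 2 * J o y) * (sh h / ch h)).
Proof.
move=> b0 h0 os ys; set K := b / 2 * J o y.
have oy : o != y by apply: contraNneq ys => <-.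
pose E := ising J s b h.
have E0 : nng E by exact: nng_ising.
have K0 : 0 <= K by rewrite mulr_ge0// divr_ge0.
pose E2 := [:: (Some o, Some y, K), (Some y, None, h) & E].
apply: le_trans (series_bonds (o := Some o) (y := Some y) (g := None) E0 K0 h0 _ _ _); rewrite ?(inj_eq Some_inj) 1?eq_sym//; last first.
  apply/allP => e; rewrite mem_cat => /orP[/mapP[p /allpairsP[q [q1 q2 ->]] ->]|/mapP[x xs ->]] /=.
    by rewrite !(inj_eq Some_inj); apply/andP; split; apply: contraNneq ys => <-.
  by rewrite (inj_eq Some_inj) andbT; apply: contraNneq ys => <-.
rewrite lerD2l lerN2.
have pE : exists2 r, nng r & perm_eq (ising J (y :: s) b h) (r ++ E2).
  have hp : perm_eq (pairs (y :: s)) ([seq (y, x) | x <- y :: s] ++ ([seq (x, y) | x <- s] ++ pairs s)).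
    rewrite /pairs /= perm_cons perm_cat2l.
    exact/permPl/(perm_allpairs_consr pair).
  have os' : perm_eq s (o :: rem o s) by exact: perm_to_rem.
  pose bd (p : V * V) := (Some p.1, Some p.2, b * halfJ J p).
  exists ([seq bd (y, x) | x <- y :: s] ++ [seq bd (x, y) | x <- rem o s]).
    rewrite nng_cat; apply/andP; split; apply/allP => e /mapP[x _ ->] /=;
    by rewrite mulr_ge0 ?halfJ_ge0.
  have eK : (Some o, Some y, K) = bd (o, y).
    by rewrite /bd /halfJ /= (negbTE oy) /K; congr (_, _, _); ring.
  rewrite /ising /E2 eK /E /ising.
  apply: (@perm_trans _ (([seq bd (y, x) | x <- y :: s] ++ ([seq bd (x, y) | x <- o :: rem o s] ++ bonds J s b)) ++ fields (y :: s) h)).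
    rewrite perm_cat2r; apply: (perm_trans (perm_map bd hp)).
    rewrite !map_cat -!map_comp perm_cat2l perm_cat2r.
    exact: perm_map.
  rewrite -[fields (y :: s) h]/((Some y, None, h) :: fields s h).
  by rewrite map_cons; exact: perm_shuffle.
have [r r0 pr] := pE; rewrite /icor (cor_perm _ pr); apply: le_cor_cat => //.
by rewrite /= K0 h0.
Qed.
End Star.

Section BondSums.
Context {R : realType} {V : choiceType}.
Variable J : V -> V -> R.
Hypothesis J_ge0 : forall x y, 0 <= J x y.
Implicit Types (L S Y Z : {fset V}) (b h : R) (o v x y z : V).

(** A rational lower bound for tanh (b / 2 * J o y). It stays bounded when a
    single coupling is large, as the bond alone cannot transmit more than the
    spin [y]. *)
Definition satbond b o y : R := (b / 2 * J o y) / (1 + b / 2 * J o y).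

Lemma satbond_ge0 b o y : 0 <= b -> 0 <= satbond b o y.
Proof. by move=> b0; rewrite divr_ge0 ?addr_ge0 ?mulr_ge0// divr_ge0. Qed.

Lemma star_magnetization (r : seq V) b h o : 0 <= b -> 0 <= h ->
  uniq r -> o \notin r ->
  1 - icor J (r ++ [:: o]) b h [:: Some o; None] <=
  expR (- (sh h / ch h * \sum_(y <- r) satbond b o y)).
Proof.
move=> b0 h0; elim: r => [_ _|y r IH].
  by rewrite big_nil mulr0 oppr0 expR0 lerBlDr lerDl icor_ge0.
rewrite /= inE negb_or => /andP[yr ur] /andP[oy orr].
have ys : y \notin r ++ [:: o] by rewrite mem_cat negb_or yr inE eq_sym.
have os : o \in r ++ [:: o] by rewrite mem_cat inE eqxx orbT.
apply: le_trans (icor_add_vertex J_ge0 b0 h0 os ys) _.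
rewrite -/(satbond b o y) big_cons [sh h / ch h * _]mulrDr opprD expRD mulrC.
have hc := ch_gt0 h; have hs := sh_ge0 h0.
have k1 : satbond b o y * (sh h / ch h) <= 1.
  have t1 := tanh_le1 h.
  have K0 : 0 <= b / 2 * J o y by rewrite mulr_ge0// divr_ge0.
  have t0 : 0 <= sh h / ch h by apply: divr_ge0 => //; exact: ltW.
  rewrite mulr_ile1 ?satbond_ge0//.
  by rewrite /satbond ler_pdivrMr ?mul1r ?lerDr// ltr_wpDr.
apply: ler_pM; first by rewrite subr_ge0.
- by rewrite subr_ge0 icor_le1.
- by have := expR_ge1Dx (- (sh h / ch h * satbond b o y)); rewrite mulrC.
- exact: IH.
Qed.

(** Each leaf of the star around [o] multiplies [1 - M] by a factor at most [1 -
    tanh h * satbond b o y], and the product vanishes when the sum of the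
    [satbond] diverges. *)
Lemma vcor_star b h o : 0 < b -> 0 < h ->
  (forall B, exists Y, B < \sum_(y <- Y | y != o) satbond b o y) ->
  1 <= vcor J b h [:: Some o; None].
Proof.
move=> b0 h0 hB; apply/ler_addgt0Pr => e e0.
set tau := sh h / ch h; have tau0 : 0 < tau.
  by rewrite divr_gt0 ?ch_gt0// (lt_le_trans h0)// sh_ge// ltW.
have [Y hY] := hB (e^-1 / tau); pose r := [seq y <- Y | y != o].
have ur : uniq r by rewrite filter_uniq ?fset_uniq.
have orr : o \notin r by rewrite mem_filter eqxx.
have := star_magnetization (ltW b0) (ltW h0) ur orr.
rewrite /r big_filter -/r -/tau.
set s := \sum_(_ <- _ | _) _ in hY *; set x := tau * s.
have hx : e^-1 < x by rewrite /x mulrC -ltr_pdivrMr.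
have x0 : 0 < x by rewrite (lt_trans _ hx)// invr_gt0.
have he : expR (- x) <= e.
  rewrite expRN -[leRHS]invrK lef_pV2 ?posrE ?invr_gt0 ?expR_gt0//.
  by apply: le_trans (expR_ge1Dx x); rewrite (le_trans (ltW hx))// lerDr.
suff : icor J (r ++ [:: o]) b h [:: Some o; None] <= vcor J b h [:: Some o; None] by lra.
have pF : perm_eq (r ++ [:: o]) [fset y | y in r ++ [:: o]]%fset.
  apply: uniq_perm; rewrite ?fset_uniq//.
    by rewrite cat_uniq ur /= orbF orr.
  by move=> y; apply/idP/imfsetP => [yr|[z /= zr ->]//]; exists y.
by rewrite (icor_perm _ _ _ _ pF) icor_vcor// ltW.
Qed.

(** All but finitely many [satbond] are at most 1/2, and then comparable with
    the coupling itself. *)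
Lemma bond_sum_bounded b o : 0 < b ->
  ~ (forall B, exists Y, B < \sum_(y <- Y | y != o) satbond b o y) ->
  exists B, forall Y, \sum_(y <- Y | y != o) J o y <= B.
Proof.
move=> b0 /existsNP[B hB0].
pose f Y := \sum_(y <- Y | y != o) satbond b o y.
have hB Y : f Y <= B by rewrite leNgt; apply/negP => h; apply: hB0; exists Y.
have s0 y := satbond_ge0 o y (ltW b0).
have [Y0 hY0] : exists Y0, forall Y, f Y - 2^-1 < f Y0.
  have hs : has_sup [set f Y | Y in [set: {fset V}]]%classic.
    by split; [exists (f fset0), fset0|exists B => _ [Y _ <-]].
  have h2 : 0 < 2^-1 :> R by rewrite invr_gt0.
  have [_ [Y0 _ <-] hY0] := sup_adherent h2 hs; exists Y0 => Y.
  apply: le_lt_trans hY0; rewrite lerD2r; apply: ub_le_sup; first by case: hs.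
  by exists Y.
have small y : y \notin Y0 -> y != o -> J o y <= 4 / b * satbond b o y.
  move=> yY yo; have := hY0 (y |` Y0)%fset.
  have -> : f (y |` Y0)%fset = satbond b o y + f Y0.
    by rewrite /f [LHS]big_mkcond big_fsetU1//= yo [X in _ = _ + X]big_mkcond.
  rewrite /satbond; set K := b / 2 * J o y.
  have K0 : 0 <= K by rewrite mulr_ge0// divr_ge0// ltW.
  have k1 : 0 < 1 + K by rewrite ltr_wpDr.
  have JK : J o y = 2 / b * K by rewrite /K; field; rewrite gt_eqF.
  set q := K / (1 + K) => hq.
  have q2 : q < 2^-1 by lra.
  have : K < 1 by move: q2; rewrite /q ltr_pdivrMr//; lra.
  have qK : q * (1 + K) = K by rewrite /q divfK// gt_eqF.
  rewrite JK => K1; have : K <= 2 * q by nra.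
  have bb : 0 < 2 / b by rewrite divr_gt0.
  move=> /(ler_wpM2l (ltW bb)); suff -> : 4 / b * q = 2 / b * (2 * q) by [].
  by ring.
exists (\sum_(y <- Y0) J o y + 4 / b * B) => Y.
rewrite (bigID (fun y => y \in Y0)) /=; apply: lerD.
  apply: (@le_trans _ _ (\sum_(y <- Y | y \in Y0) J o y)).
    by rewrite big_mkcond [leRHS]big_mkcond /=; apply: ler_sum => y _; case: (y != o); case: (y \in Y0); rewrite /=.
  exact: ler_sum_fset_in.
have b4 : 0 <= 4 / b by rewrite divr_ge0// ltW.
apply: le_trans (ler_wpM2l b4 (hB Y)); rewrite /f mulr_sumr.
rewrite big_mkcond [leRHS]big_mkcond /=; apply: ler_sum => y _.
case: ifPn => [/andP[yo yY]|_]; first by rewrite yo small.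
by case: ifP => // _; rewrite mulr_ge0.
Qed.
End BondSums.

(** * The non-contracting regime *)

Section Supercritical.
Context {R : realType} {V : choiceType}.
Variable J : V -> V -> R.
Hypothesis J_ge0 : forall x y, 0 <= J x y.
Hypothesis J_sym : forall x y, J x y = J y x.
Hypothesis J_hom : forall x y, exists2 g, J_auto J g & g x = y.
Implicit Types (L S Y Z : {fset V}) (b h c e : R) (o v x y z : V).
Local Notation ic := (icor J).

Lemma bond_sum_const o B : (forall Y, \sum_(y <- Y | y != o) J o y <= B) ->
  forall x Y, \sum_(y <- Y | y != x) J x y <= B.
Proof.
move=> hB x Y; have [g [[f fK gK] gJ] <-] := J_hom o x.
have fI := can_inj gK.
apply: le_trans (hB [fset f y | y in Y]%fset).
rewrite le_eqVlt; apply/orP; left; apply/eqP.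
rewrite (perm_big _ (perm_imfset Y fI)) /= big_map; apply: eq_big => y.
  by rewrite -{1}[y]gK (inj_eq (can_inj fK)).
by move=> _; rewrite -[in RHS](gJ o) gK.
Qed.

Lemma bond_tail x e B : 0 < e -> (forall Y, \sum_(y <- Y | y != x) J x y <= B) ->
  exists L, forall Y, [disjoint L & Y]%fset -> \sum_(y <- Y | y != x) J x y <= e.
Proof.
move=> e0 hB; pose f Y := \sum_(y <- Y | y != x) J x y.
have hs : has_sup [set f Y | Y in [set: {fset V}]]%classic.
  by split; [exists (f fset0), fset0|exists B => _ [Y _ <-]; exact: hB].
have [_ [L _ <-] hL] := sup_adherent e0 hs; exists L => Y LY.
have : f (L `|` Y)%fset <= sup [set f Y | Y in [set: {fset V}]]%classic.
  by apply: ub_le_sup; [case: hs|exists (L `|` Y)%fset].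
have -> : f (L `|` Y)%fset = f L + f Y.
  rewrite /f (perm_big (enum_fset L ++ enum_fset Y)) ?big_cat//=.
  apply: uniq_perm; rewrite ?fset_uniq//; last by move=> y; rewrite mem_cat inE.
  rewrite cat_uniq !fset_uniq andbT/=; apply/hasPn => y yY.
  by move/fdisjointP: LY => LY; apply: contraL yY; exact: LY.
rewrite -/(f Y); lra.
Qed.

Lemma bond_tail_unif S e B : 0 < e -> (forall x Y, \sum_(y <- Y | y != x) J x y <= B) ->
  exists2 L, (S `<=` L)%fset & forall x Y, x \in S -> [disjoint L & Y]%fset ->
    \sum_(y <- Y | y != x) J x y <= e.
Proof.
move=> e0 hB.
have [L hL] : exists L, forall x Y, x \in enum_fset S -> [disjoint L & Y]%fset ->
    \sum_(y <- Y | y != x) J x y <= e.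
  elim: (enum_fset S) => [|a s [L hL]]; first by exists fset0.
  have [L' hL'] := bond_tail e0 (hB a).
  exists (L `|` L')%fset => x Y; rewrite inE fdisjointUX => /orP[/eqP->|xs] /andP[LY L'Y].
    exact: hL'.
  exact: hL.
exists (L `|` S)%fset; first exact: fsubsetUr.
by move=> x Y xS; rewrite fdisjointUX => /andP[LY _]; exact: hL.
Qed.

Variables (o : V) (b0 h B : R).
Hypothesis b0_gt0 : 0 < b0.
Hypothesis h_gt0 : 0 < h.
Hypothesis bond_le : forall x Y, \sum_(y <- Y | y != x) J x y <= B.
Hypothesis not_contracting : forall S c, ~ contracting J b0 o S c.

Let h_ge0 := ltW h_gt0.
Let B_ge0 : 0 <= B.
Proof.
by apply: le_trans (bond_le o fset0); rewrite big1_seq// => y /andP[_]; rewrite inE.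
Qed.

(** The outflow from [S] at [b0] comes arbitrarily close to 1, and so does the
    one at [s]. Its bonds inside [L] are kept, those leaving [L] are estimated
    by [r]. *)
Lemma outflow_split s S L e (r : V -> R) : b0 <= s -> (S `<=` L)%fset -> o \in S ->
  0 < e -> (forall x Y, x \in S -> [disjoint L & Y]%fset -> \sum_(y <- Y) J x y <= r x) ->
  1 - e <= s * ((\sum_(x <- S) \sum_(y <- L | y \notin S)
      J x y * ic S s 0 [:: Some o; Some x]) +
    \sum_(x <- S) r x * ic S s 0 [:: Some o; Some x]).
Proof.
move=> bs SL oS e0 hr.
have s0 : 0 <= s := le_trans (ltW b0_gt0) bs.
have [Y hY] : exists Y, 1 - e <= outflow J b0 S o Y.
  apply: contrapT => hY; apply: (not_contracting (S := S) (c := 1 - e)); split => //.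
    by rewrite ltrBlDr ltrDl.
  by move=> Y; rewrite leNgt; apply/negP => /ltW h1; apply: hY; exists Y.
apply: le_trans hY _.
pose G x := ic S s 0 [:: Some o; Some x].
have G0 x : 0 <= G x by exact: icor_ge0.
apply: (@le_trans _ _ (outflow J s S o Y)).
  apply: ler_sum => x _; apply: ler_sum => y _.
  apply: ler_pM; [|apply: icor_ge0 => //; exact: ltW|exact: ler_wpM2r|].
    by apply: mulr_ge0 => //; exact: ltW.
  by apply: icor_le => //; exact: ltW.
rewrite /outflow -big_split /= mulr_sumr big_seq [leRHS]big_seq.
apply: ler_sum => x xS.
rewrite (bigID (fun y => y \in L)) /= mulrDr; apply: lerD.
  rewrite mulr_sumr -[leLHS]big_filter -[leRHS]big_filter.
  rewrite (perm_big [seq y <- [seq y <- L | y \notin S] | y \in Y]) /=; last first.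
    apply: uniq_perm; rewrite ?filter_uniq ?fset_uniq// => y.
    by rewrite !mem_filter; case: (y \in S); case: (y \in L); case: (y \in Y).
  rewrite big_filter big_mkcond /=; apply: ler_sum => y _.
  by case: ifP => _; [rewrite -(mulrA s)|apply: mulr_ge0 => //; apply: (mulr_ge0 _ (G0 x))].
pose Y' := [fset y in Y | y \notin L]%fset.
have hY' : \sum_(y <- Y') J x y <= r x.
  by apply: hr => //; apply/fdisjointP => y yL; rewrite !inE yL andbF.
rewrite -/(G x) -[leLHS]big_filter (perm_big (enum_fset Y')) /=; last first.
  apply: uniq_perm; rewrite ?filter_uniq ?fset_uniq// => y.
  rewrite mem_filter !inE; case: (boolP (y \in S)) => [yS|_] /=.
    by rewrite (fsubsetP SL _ yS) andbF.
  by rewrite andbC.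
under eq_bigr do rewrite -mulrA.
by rewrite -mulr_sumr ler_wpM2l// -mulr_suml ler_wpM2r.
Qed.

(** In a finite volume [L] the inequality M dM/ds >= (1 - M ^ 2) / s holds up to
    the bonds leaving [L]. From a point of a smaller volume [L0] they have small
    total weight; for the other points [boundary_trunc] applies, and as [L0]
    already has nearly the full magnetization, the error is of order [B / h]
    times the increment of M. The mean value theorem turns the derivative into
    increments. *)
Lemma magnetization_increment s t : b0 <= s -> s < t ->
  (t - s) / t * (1 - vcor J t h [:: Some o; None] ^+ 2) <=
  (vcor J t h [:: Some o; None] + B / h * (t - s)) *
  (vcor J t h [:: Some o; None] - vcor J s h [:: Some o; None]).
Proof.
move=> bs st; set b := vcor J t h _; set a := vcor J s h _.
have s_gt0 : 0 < s := lt_le_trans b0_gt0 bs.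
have t_gt0 : 0 < t := lt_trans s_gt0 st.
have dl0 : 0 < t - s by rewrite subr_gt0.
have b_ge0 : 0 <= b by apply: vcor_ge0 => //; exact: ltW.
have b_le1 : b <= 1 by apply: vcor_le1 => //; exact: ltW.
have b2 : 0 <= 1 - b ^+ 2 by rewrite subr_ge0 expr_le1.
have ab : a <= b by apply: vcor_mono => //; exact: ltW.
have C0 : 0 <= B / h by rewrite divr_ge0.
apply/ler_addgt0Pr => eta eta0.
(* All approximations below cost together at most e * k. *)
pose k := b + (t - s) / t * (1 - b ^+ 2) + (t - s) + (t - s) * (B / h).
have k0 : 0 <= k.
  have q0 : 0 <= (t - s) / t by apply: divr_ge0; exact: ltW.
  have d0 := ltW dl0; rewrite /k; apply: addr_ge0; last exact: mulr_ge0.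
  by apply: addr_ge0 => //; apply: addr_ge0 => //; exact: mulr_ge0.
pose e := Num.min 1 (eta / (k + 1)).
have k1 : 0 < k + 1 by apply: (le_lt_trans k0); rewrite ltrDl.
have e0 : 0 < e by rewrite lt_min ltr01 divr_gt0.
have e1 : e <= 1 by rewrite ge_min lexx.
have ek : e * k <= eta.
  apply: (@le_trans _ _ (e * (k + 1))); first by rewrite ler_pM2l// lerDl.
  by rewrite -ler_pdivlMr// ge_min lexx orbT.
have [L00 hL00] := vcor_approx J_ge0 [:: Some o; None] e0 (ltW s_gt0) h_ge0.
pose L0 := (o |` L00)%fset.
have hL0 : a - e < ic L0 s h [:: Some o; None].
  by apply: lt_le_trans hL00 _; apply: icor_fsub => //; [exact: ltW|exact: fsubsetUr].
have oL0 : o \in L0 by rewrite fset1U1.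
(* The points of L0 together lose at most e through the bonds leaving L. *)
pose e' := e / (#|` L0|%:R + 1).
have e'0 : 0 < e' by rewrite divr_gt0// ltr_wpDl.
have [L L0L hL] := bond_tail_unif L0 e'0 bond_le.
have oL : o \in L by exact: (fsubsetP L0L).
pose f (u : R) : R := ic L u h [:: Some o; None].
have df (u : R) : 0 <= u -> is_derive u 1 f (dmag J L u h o) by move=> u0; exact: is_derive_mag.
have itv0 u : u \in `[s, t] -> 0 <= u.
  by rewrite in_itv/= => /andP[su _]; apply: le_trans su; exact: ltW.
have [||w ws] := @MVT_segment R f (fun u => dmag J L u h o) s t (ltW st).
- by move=> u /subset_itv_oo_cc/itv0; exact: df.
- by apply: derivable_within_continuous => u /itv0/df[].
move: (ws); rewrite in_itv/= => /andP[sw wt] fst.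
have w_gt0 : 0 < w := lt_le_trans s_gt0 sw.
have w_ge0 := ltW w_gt0.
have fb u : s <= u -> u <= t -> f u <= b.
  move=> su ut; have u0 : 0 <= u by apply: le_trans su; exact: ltW.
  apply: le_trans (icor_vcor J_ge0 L [:: Some o; None] u0 h_ge0) _.
  exact: vcor_mono.
have hM y : y \in L -> ic L w h [:: Some y; None] <= b.
  move=> yL; apply: le_trans (icor_vcor J_ge0 L [:: Some y; None] w_ge0 h_ge0) _.
  by rewrite (vcor_spin_const J_ge0 J_hom y o)//; exact: vcor_mono.
have [K [S [p [p0 SL pS tr DI]]]] := differential_inequality J_ge0 J_sym oL w_ge0 h_ge0 hM.
pose G (x : V) (i : K) := ic (S i) w 0 [:: Some o; Some x].
have G0 x i : 0 <= G x i by exact: icor_ge0.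
pose A i := \sum_(x <- S i) \sum_(y <- L | y \notin S i) J x y * G x i.
pose r x := if x \in L0 then e' else B.
pose T x := trunc (ising J L w h) (Some o) None (Some x).
have T0 x : 0 <= T x by exact: trunc_ising_ge0.
have dup1 (s' : seq V) u k' : 0 <= u -> 0 <= k' -> ic s' u k' [:: Some o; Some o] = 1.
  by move=> u0 k'0; apply: cor_xx; exact: nng_ising.
have sum_p : \sum_i p i = 1 - f w ^+ 2.
  transitivity (T o); last by rewrite /T /trunc -!/(icor _ _ _ _ _) dup1// expr2.
  rewrite /T tr//; apply: eq_bigr => i _; rewrite dup1// mulr1.
  by case: (boolP (o \in S i)) => [|/pS->]; rewrite ?mul1r ?mulr0.
have err_eq : \sum_i p i * (\sum_(x <- S i) r x * G x i) = \sum_(x <- L) r x * T x.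
  rewrite [RHS]big_seq [RHS](eq_bigr (fun x => \sum_i r x * ((x \in S i)%:R * p i * G x i))); last first.
    by move=> x xL; rewrite /T tr// mulr_sumr.
  rewrite -[RHS]big_seq [RHS]exchange_big /=; apply: eq_bigr => i _.
  rewrite -(sum_fset_restr _ (SL i)) big_mkcond mulr_sumr; apply: eq_bigr => x _.
  by case: ifP => _; rewrite ?mul0r ?mulr0// mul1r; ring.
have err : \sum_(x <- L) r x * T x <= e + B / h * (b - a + e).
  rewrite (bigID (fun x => x \in L0)) /=; apply: lerD.
    rewrite sum_fset_restr//; apply: (@le_trans _ _ (\sum_(x <- L0) e')).
      rewrite big_seq [leRHS]big_seq; apply: ler_sum => x xL0; rewrite /r xL0.
      apply: ler_piMr; [exact: ltW|rewrite /T /trunc].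
      have g0 : 0 <= cor (ising J L w h) [:: Some o; None] * cor (ising J L w h) [:: Some x; None].
        by rewrite mulr_ge0// -/(icor _ _ _ _ _) icor_ge0.
      have := icor_le1 J_ge0 L [:: Some o; Some x] w_ge0 h_ge0; rewrite /icor; lra.
    rewrite big_const_seq count_predT iter_addr_0 -mulr_natl /e' mulrA ler_pdivrMr ?ltr_wpDl//.
    by rewrite mulrC ler_pM2l// lerDl.
  rewrite (eq_bigr (fun x => B * T x)) => [|x /negbTE xL0]; last by rewrite /r xL0.
  rewrite -mulr_sumr -mulrA ler_wpM2l//.
  rewrite mulrC -ler_pdivrMr ?invr_gt0// invrK mulrC.
  apply: le_trans (boundary_trunc J_ge0 o L0L w_ge0 h_ge0) _.
  have h1 := fb w sw wt; rewrite /f in h1.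
  have h2 : ic L0 s h [:: Some o; None] <= ic L0 w h [:: Some o; None].
    by apply: icor_le => //; exact: ltW.
  by lra.
have hi i : (1 - e) * p i <= w * (p i * A i + p i * (\sum_(x <- S i) r x * G x i)).
  have [oS|/pS->] := boolP (o \in S i); last by rewrite mulr0 !mul0r addr0 mulr0.
  rewrite -mulrDr mulrCA mulrC ler_wpM2l//.
  apply: outflow_split => //; first exact: le_trans sw.
  move=> x Y xS LY.
  have xL : x \in L by exact: (fsubsetP (SL i)).
  have eY : \sum_(y <- Y) J x y = \sum_(y <- Y | y != x) J x y.
    rewrite big_seq [RHS]big_seq_cond; apply: eq_bigl => y.
    case: (boolP (y \in Y)) => //= yY; apply/esym.
    by apply: contraTneq yY => ->; move/fdisjointP: LY; apply.
  by rewrite eY /r; case: ifPn => xL0; [exact: hL|exact: bond_le].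
have {hi}hsum : (1 - e) * (1 - f w ^+ 2) <= w * (b * dmag J L w h o + (e + B / h * (b - a + e))).
  rewrite -sum_p mulr_sumr; apply: (@le_trans _ _ (\sum_i w * (p i * A i + p i * (\sum_(x <- S i) r x * G x i)))).
    by apply: ler_sum => i _.
  rewrite -mulr_sumr ler_wpM2l// big_split /= err_eq; exact: lerD.
have f_ge0 u : 0 <= u -> 0 <= f u by move=> u0; exact: icor_ge0.
have fw2 : f w ^+ 2 <= b ^+ 2.
  by apply: lerXn2r; rewrite ?nnegrE ?f_ge0 ?fb.
set D := dmag J L w h o in fst hsum.
set H := b * D + _ in hsum.
have H0 : 0 <= (1 - e) * (1 - b ^+ 2) by rewrite mulr_ge0// subr_ge0.
have hsum' : (1 - e) * (1 - b ^+ 2) <= w * H.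
  by apply: le_trans hsum; rewrite ler_wpM2l ?subr_ge0// lerD2l lerN2.
have H_ge0 : 0 <= H by rewrite -(pmulr_rge0 _ w_gt0) (le_trans H0).
have hsum2 : (1 - e) * (1 - b ^+ 2) <= t * H.
  by apply: le_trans hsum' _; rewrite ler_wpM2r.
have hsum3 : (t - s) / t * ((1 - e) * (1 - b ^+ 2)) <= (t - s) * H.
  by rewrite -mulrA ler_pM2l// ler_pdivrMl.
have ft : f t <= b by apply: fb => //; exact: ltW.
have fs : a - e <= f s.
  by apply: le_trans (ltW hL0) _; apply: icor_fsub => //; exact: ltW.
have bD : b * (D * (t - s)) <= b * (b - a + e).
  by rewrite -fst ler_wpM2l//; lra.
have eH : (t - s) * H = b * (D * (t - s)) + (t - s) * e + (t - s) * (B / h) * (b - a + e).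
  by rewrite /H; ring.
move: bD hsum3 ek; rewrite /k eH.
set q := (t - s) / t; set X := 1 - b ^+ 2.
set C := B / h; set dl := t - s; move=> u0 u1 u2.
have -> : q * X = q * ((1 - e) * X) + e * (q * X) by ring.
have -> : (b + C * dl) * (b - a) + eta =
   b * (b - a + e) + dl * e + dl * C * (b - a + e) + (eta - e * (b + dl + dl * C)) by ring.
have e3 : e * (b + q * X + dl + dl * C) = e * (q * X) + e * (b + dl + dl * C) by ring.
by rewrite e3 in u2; lra.
Qed.
End Supercritical.

(** * The critical parameter *)

Section Dichotomy.
Context {R : realType} {V : choiceType}.
Variable J : V -> V -> R.
Hypothesis J_ge0 : forall x y, 0 <= J x y.
Hypothesis J_sym : forall x y, J x y = J y x.
Hypothesis J_hom : forall x y, exists2 g, J_auto J g & g x = y.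
Implicit Types (L S Y Z : {fset V}) (b h c : R) (o v x y z : V).
Local Notation ic := (icor J).

Lemma contracting_mono b b' o S c : 0 <= b -> b <= b' ->
  contracting J b' o S c -> contracting J b o S c.
Proof.
move=> b0 bb [oS c1 H]; split=> // Y; apply: le_trans (H Y).
apply: ler_sum => x _; apply: ler_sum => y _.
apply: ler_pM; [exact: mulr_ge0|exact: icor_ge0| |exact: icor_le].
exact: ler_wpM2r.
Qed.

Lemma vcor_gt0 b h o : 0 <= b -> 0 < h -> 0 < vcor J b h [:: Some o; None].
Proof.
move=> b0 h0; apply: lt_le_trans (icor_vcor J_ge0 [fset o]%fset _ b0 (ltW h0)).
rewrite /icor /ising.
have bn : nng (bonds J [fset o]%fset b).
  by apply/allP => e /mapP[p _ ->] /=; rewrite mulr_ge0 // /halfJ; case: ifP => // _;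
     rewrite mulr_ge0.
have E1 : fields ([fset o]%fset : seq V) h = [:: (Some o, None, h)].
  rewrite /fields; suff -> : ([fset o]%fset : seq V) = [:: o] by [].
  by apply: perm_small_eq => //; apply: uniq_perm => // y; rewrite !inE.
apply: lt_le_trans (le_cor_cat _ bn _); last by rewrite E1 /= /nng /= ltW.
rewrite E1 /cor divr_gt0 //= /all_even /= ?eqxx /=.
  rewrite mulr0 mulr1 add0r.
  exact: lt_le_trans h0 (sh_ge (ltW h0)).
by rewrite mulr1 mulr0 addr0 ch_gt0.
Qed.

(** With bounded bond sums, [magnetization_increment] is integrated by
    [discrete_ode] at each positive field. *)
Lemma supercritical_bound b0 b1 o : 0 < b0 -> b0 < b1 ->
  (forall S c, ~ contracting J b0 o S c) ->
  Num.sqrt (1 - b0 ^+ 2 / b1 ^+ 2) <= magnetization J b1 o.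
Proof.
move=> p0 b01 nc; have p1 := lt_trans p0 b01.
apply: (magnetization_inf J_ge0 o (ltW p1)).2 => h h0.
have v0 : 0 <= vcor J b1 h [:: Some o; None] by rewrite vcor_ge0 // ltW.
suff sq : (1 - vcor J b1 h [:: Some o; None] ^+ 2) * b1 ^+ 2 <= b0 ^+ 2.
  rewrite -[leRHS]ger0_norm // -sqrtr_sqr ler_wsqrtr //.
  by rewrite lerBlDr -lerBlDl ler_pdivlMr ?exprn_gt0.
have [H|H] := pselect (forall B : R, exists Y, B < \sum_(y <- Y | y != o) satbond J b1 o y).
  have -> : vcor J b1 h [:: Some o; None] = 1.
    by apply/le_anti; rewrite vcor_le1 ?(ltW p1) ?(ltW h0) // vcor_star.
  by rewrite expr1n subrr mul0r sqr_ge0.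
have [B HB] := bond_sum_bounded J_ge0 p1 H.
have B0 : 0 <= B by move: (HB fset0); rewrite big_nil.
apply: (@discrete_ode _ (fun s => vcor J s h [:: Some o; None]) _ _ (B / h)) => //.
- by rewrite divr_ge0 // ltW.
- exact: vcor_gt0 (ltW p0) h0.
- by move=> s bs; rewrite vcor_le1 // ?(ltW h0) // (le_trans (ltW p0)).
- by move=> s t bs st; rewrite vcor_mono // ?(ltW h0) // (le_trans (ltW p0)).
- move=> s t bs st _.
  exact: (magnetization_increment J_ge0 J_sym J_hom p0 h0 (bond_sum_const J_hom HB) nc).
- exact: ltW.
Qed.

(** Otherwise [supercritical_bound] would produce a positive magnetization
    strictly below the critical parameter. *)
Lemma contracting_below_critical b o : 0 < b -> (b%:E < beta_c J o)%E ->
  exists S c, contracting J b o S c.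
Proof.
move=> b0 bc; apply: contrapT => H.
have nc S c : ~ contracting J b o S c by move=> ?; apply: H; exists S, c.
have [b' bb b'c] : exists2 b', b < b' & (b'%:E < beta_c J o)%E.
  move: bc; case: (beta_c J o) => [r| |] //.
  - rewrite lte_fin => br; exists ((b + r) / 2); last rewrite lte_fin; lra.
  - by move=> _; exists (b + 1); rewrite ?ltry // ltrDl.
suff : (beta_c J o <= b'%:E)%E by rewrite leNgt b'c.
apply: ereal_inf_lbound; exists b' => //; split; first exact: lt_trans bb.
apply: lt_le_trans (supercritical_bound b0 bb nc).
have b'0 := lt_trans b0 bb.
by rewrite sqrtr_gt0 subr_gt0 ltr_pdivrMr ?exprn_gt0 // mul1r ltr_pXn2r ?nnegrE ?ltW.
Qed.

(** There is a magnetized parameter below [b], and it would be contracting as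
    well. *)
Lemma not_contracting_above_critical b o S c : (beta_c J o < b%:E)%E ->
  ~ contracting J b o S c.
Proof.
move=> /ereal_inf_lt[_ [b' [b'0 m0] <-]]; rewrite lte_fin => bb C.
move: m0; rewrite (@magnetization_contracting _ _ J J_ge0 J_sym J_hom _ _ S c) ?ltxx //.
exact: contracting_mono (ltW b'0) (ltW bb) C.
Qed.

Lemma beta_c_ge0 o : (0 <= beta_c J o)%E.
Proof. by apply: le_ereal_inf_tmp => _ [b [b0 _] <-]; rewrite lee_fin ltW. Qed.

Lemma magnetization_lower_bound b o : (beta_c J o < b%:E)%E ->
  Num.sqrt ((b ^+ 2 - fine (beta_c J o) ^+ 2) / b ^+ 2) <= magnetization J b o.
Proof.
move: (beta_c_ge0 o) (@not_contracting_above_critical ^~ o).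
case: (beta_c J o) => [r| |] //; rewrite !lee_fin => r0 nc; rewrite lte_fin => rb /=.
have b0 := le_lt_trans r0 rb.
have m0 := magnetization_ge0 J_ge0 o (ltW b0).
set m := magnetization J b o in m0 *.
have H b' : r < b' -> b' < b -> (1 - m ^+ 2) * b ^+ 2 <= b' ^+ 2.
  move=> rb' b'b.
  have b'0 := le_lt_trans r0 rb'.
  have := supercritical_bound b'0 b'b (fun S c => nc b' S c rb'); rewrite -/m => Hm.
  have : 1 - b' ^+ 2 / b ^+ 2 <= m ^+ 2.
    rewrite -[leLHS]sqr_sqrtr ?ler_sqr ?nnegrE ?sqrtr_ge0 //.
    by rewrite subr_ge0 ler_pdivrMr ?exprn_gt0 // mul1r ler_pXn2r ?nnegrE ?ltW.
  by rewrite lerBlDr -lerBlDl ler_pdivlMr ?exprn_gt0.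
have {}H : (1 - m ^+ 2) * b ^+ 2 <= r ^+ 2.
  rewrite leNgt; apply/negP => Hr.
  pose d := (1 - m ^+ 2) * b ^+ 2 - r ^+ 2.
  have d0 : 0 < d by rewrite subr_gt0.
  pose b' := Num.min ((r + b) / 2) (r + d / (4 * b)).
  have e0 : 0 < d / (4 * b) by rewrite divr_gt0 // mulr_gt0.
  have h1 : r < b' by rewrite lt_min; apply/andP; split; lra.
  have h2 : b' < b by rewrite gt_min; apply/orP; left; lra.
  have h3 : b' - r <= d / (4 * b).
    by rewrite lerBlDl ge_min lexx orbT.
  have h4 : (b' - r) * (4 * b) <= d by rewrite -ler_pdivlMr // mulr_gt0.
  have := H b' h1 h2.
  have h5 : (b' - r) * (b' + r) <= (b' - r) * (2 * b) by apply: ler_wpM2l; lra.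
  rewrite /d in h4 d0; nra.
rewrite -[leRHS]ger0_norm // -sqrtr_sqr ler_wsqrtr //.
by rewrite ler_pdivrMr ?exprn_gt0 //; lra.
Qed.

Lemma susceptibility_finite b o : 0 < b -> (b%:E < beta_c J o)%E ->
  (\esum_(x in [set: V]) (two_point J b o x)%:E < +oo)%E.
Proof.
move=> b0 /(contracting_below_critical b0)[S [c C]].
apply: (@le_lt_trans _ _ ((#|` S|%:R / (1 - c))%:E)); last exact: ltry.
apply: ge_ereal_sup => _ [A [Af _] <-].
rewrite fsbig_finite // sumEFin lee_fin.
exact: (sum_two_point_contracting J_ge0 J_sym J_hom _ b0 C).
Qed.
End Dichotomy.

Local Open Scope classical_set_scope.
Local Open Scope ring_scope.

Theorem theorem2p1 (R : realType) (V : choiceType) (E : rel V) (o : V)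
    (J : V -> V -> R)
    (E_simple : simple_graph E) (E_conn : connected_graph E)
    (E_lf : locally_finite E) (E_trans : vertex_transitive E)
    (V_inf : infinite_set [set: V])
    (J_cc : coupling_constants J) (J_inv : invariant_coupling E J) :
  [/\ (forall b : R, (beta_c J o < b%:E)%E ->
         Num.sqrt ((b ^+ 2 - fine (beta_c J o) ^+ 2) / b ^+ 2)
           <= magnetization J b o),
      (forall b : R, 0 < b -> (b%:E < beta_c J o)%E ->
         (\esum_(x in [set: V]) (two_point J b o x)%:E < +oo)%E) &
      (finite_range E J ->
       forall b : R, 0 < b -> (b%:E < beta_c J o)%E ->
         exists2 c : R, 0 < c & forall x : V,
           two_point J b o x <= expR (- c * (gdist E o x)%:R))].
Proof.
have [J_sym J_ge0] := J_cc.
have EJ_hom x y : exists g, [/\ J_auto J g, automorphism E g & g x = y].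
  have [Gamma [[aut _ _ _] trans inv]] := J_inv.
  have [g Gg gxy] := trans x y; exists g; split=> //; last exact: aut.
  by split=> [|x' y']; [have [] := aut g Gg|exact: inv].
have J_hom x y : exists2 g, J_auto J g & g x = y.
  by have [g [Jg _ gxy]] := EJ_hom x y; exists g.
split=> [b|b|fr b b0 bc].
- exact: magnetization_lower_bound.
- exact: susceptibility_finite.
have [S [c C]] := contracting_below_critical J_ge0 J_sym J_hom b0 bc.
exact: two_point_decay C fr.
Qed.
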